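(* There exist absolute constants $\varepsilon_0\in(0,1)$ and $C\ge1$ such that the following holds. Let $N_1,N_2,L_1,L_2>0$, let $\pm_1,\pm_2\in\{+,-\}$ be arbitrary signs, let $r>0$, $\omega\in\mathbb S^2$, and let $I_0\subset\mathbb R$ be a compact interval. Let $u_1,u_2\in L^2(\mathbb R^{1+3})$ satisfy $\operatorname{supp}\widehat{u_j}\subset K^{\pm_j}_{N_j,L_j}$ for $j=1,2$, and assume $r\le\varepsilon_0\min(N_1,N_2)$. Then $$\bigl\|\mathbf P_{\xi_0\cdot\omega\in I_0}\,\mathfrak B_{\theta_{12}\ll1}(\mathbf P_{\mathbb R\times T_r(\omega)}u_1,u_2)\bigr\|\le C\,(r^2L_1L_2)^{1/2}\Bigl(\sup_{I_1}\bigl\|\mathbf P_{\xi_1\cdot\omega\in I_1}u_1\bigr\|\Bigr)\|u_2\|,$$ where the supremum is over all translates $I_1$ of $I_0$, and $\mathfrak B_{\theta_{12}\ll1}$ is the bilinear operator with symbol $\theta_{12}\,\chi_{\theta_{12}\le\varepsilon_0}$.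
   Context: Points of $\mathbb R^{1+3}$ are written $X=(\tau,\xi)$ with $\tau\in\mathbb R$, $\xi\in\mathbb R^3$ (Fourier variables of $(t,x)$); $\|\cdot\|$ is the norm of $L^2(\mathbb R^{1+3})$; $\widehat u=\mathcal Fu$ is the space-time Fourier transform. For $N,L>0$ and a sign $\pm$, $$K^{\pm}_{N,L}=\Bigl\{(\tau,\xi)\in\mathbb R^{1+3}:\ \tfrac N2<|\xi|\le N,\ \bigl|-\tau\pm|\xi|\bigr|\le L\Bigr\}.$$ The statement $\operatorname{supp}\widehat u\subset A$ means that $\widehat u$ vanishes almost everywhere outside $A$. For measurable $A\subset\mathbb R^{1+3}$, $\mathbf P_A$ is the Fourier multiplier with symbol $\chi_A$; for an interval $I$, both $\mathbf P_{\xi_0\cdot\omega\in I}$ and $\mathbf P_{\xi_1\cdot\omega\in I}$ denote $\mathbf P_A$ with $A=\{(\tau,\xi):\xi\cdot\omega\in I\}$ (the index on $\xi$ only records to which function the multiplier is applied). The tube is $T_r(\omega)=\{\xi\in\mathbb R^3:\operatorname{dist}(\xi,\mathbb R\omega)\le r\}$. For nonzero $a,b\in\mathbb R^3$, $\theta(a,b)\in[0,\pi]$ is the angle between $a$ and $b$. With $X_j=(\tau_j,\xi_j)$ and $\theta_{12}=\theta(\pm_1\xi_1,\pm_2\xi_2)$, the bilinear operator $\mathfrak B_{\theta_{12}\ll1}$ is defined by $$\mathcal F\bigl(\mathfrak B_{\theta_{12}\ll1}(u_1,u_2)\bigr)(X_0)=\iint\theta_{12}\,\chi_{\theta_{12}\le\varepsilon_0}\,\widehat{u_1}(X_1)\widehat{u_2}(X_2)\,\delta(X_0-X_1-X_2)\,dX_1\,dX_2,$$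 i.e. the integral over $X_1\in\mathbb R^{1+3}$ with $X_2=X_0-X_1$. *)

(* Defs.v *)
From HB Require Import structures.
From mathcomp Require Import all_boot all_order all_algebra.
From mathcomp Require Import all_classical all_reals all_analysis.
From mathcomp Require Import complex.

Set Implicit Arguments.
Unset Strict Implicit.
Unset Printing Implicit Defensive.

Import Order.TTheory GRing.Theory Num.Theory.
Import numFieldNormedType.Exports.
Import ComplexField.

Local Open Scope classical_set_scope.
Local Open Scope ring_scope.

Notation vec3 R :=
  (measurableTypeR R * measurableTypeR R * measurableTypeR R)%type.
Notation spacetime R := (measurableTypeR R * vec3 R)%type.

(* The library norm on a product type is the sup norm, so the Euclidean
   structure of R^3 is spelled out. *)
Section euclidean.
Context {R : realType}.
Implicit Types (a b w : vec3 R) (s : bool).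

Definition dot3 a b : R := a.1.1 * b.1.1 + a.1.2 * b.1.2 + a.2 * b.2.

Definition norm3 a : R := Num.sqrt (dot3 a a).

Definition scale3 (t : R) a : vec3 R := (t * a.1.1, t * a.1.2, t * a.2).

(* Only meaningful for nonzero [a] and [b]; the junk value is [pi / 2]. *)
Definition angle a b : R := acos (dot3 a b / (norm3 a * norm3 b)).

(* A sign is a boolean [s] standing for [(-1) ^+ s]: [false] is +, [true] is -. *)
Definition theta s1 s2 a b : R :=
  angle (scale3 ((-1) ^+ s1) a) (scale3 ((-1) ^+ s2) b).

Definition dist_line a w : R :=
  inf [set norm3 (a - scale3 t w) | t in [set: R]].

Definition tube (r : R) w : set (vec3 R) := [set a | dist_line a w <= r].

End euclidean.

Section lebesgue_measure_spacetime.
Context {R : realType}.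

(* The sigma-finite instance that is found by inference for [m1 \x m2] in the
   library is the one of products of subprobabilities; the right one has to be
   re-established in order to iterate products of Lebesgue measures. *)
Lemma product_sigma_finite d1 d2 (T1 : measurableType d1)
    (T2 : measurableType d2) (m1 : {sigma_finite_measure set T1 -> \bar R})
    (m2 : {sigma_finite_measure set T2 -> \bar R}) :
  sigma_finite setT (m1 \x m2)%E.
Proof.
have /sigma_finiteP[F [TF ndF Foo]] := sigma_finiteT m1.
have /sigma_finiteP[G [TG ndG Goo]] := sigma_finiteT m2.
exists (fun n => F n `*` G n).
  rewrite -setXTT TF TG predeqE => -[x y]; split.
    move=> [/= [n _ Fnx] [k _ Gky]]; exists (maxn n k) => //; split.
    - by move: x Fnx; exact/subsetPset/ndF/leq_maxl.
    - by move: y Gky; exact/subsetPset/ndG/leq_maxr.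
  by move=> [n _ []/= ? ?]; split; exists n.
move=> k; have [? ?] := Foo k; have [? ?] := Goo k.
split; first exact: measurableX.
by rewrite product_measure1E// lte_mul_pinfty// ge0_fin_numE.
Qed.

Definition leb2 : set (measurableTypeR R * measurableTypeR R) -> \bar R :=
  (@lebesgue_measure R \x @lebesgue_measure R)%E.
HB.instance Definition _ := Measure.on leb2.
HB.instance Definition _ := Measure_isSigmaFinite.Build _ _ _ leb2
  (product_sigma_finite (@lebesgue_measure R) (@lebesgue_measure R)).

Definition leb3 : set (vec3 R) -> \bar R := (leb2 \x @lebesgue_measure R)%E.
HB.instance Definition _ := Measure.on leb3.
HB.instance Definition _ := Measure_isSigmaFinite.Build _ _ _ leb3
  (product_sigma_finite leb2 (@lebesgue_measure R)).

Definition leb13 : set (spacetime R) -> \bar R :=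
  (@lebesgue_measure R \x leb3)%E.
HB.instance Definition _ := Measure.on leb13.
HB.instance Definition _ := Measure_isSigmaFinite.Build _ _ _ leb13
  (product_sigma_finite (@lebesgue_measure R) leb3).

End lebesgue_measure_spacetime.

Section fourier.
Context {R : realType}.
Implicit Types (A : set (spacetime R)) (u v f : spacetime R -> R[i])
  (X Y : spacetime R) (s : bool).

Definition cLp (p : \bar R) u : Prop :=
  [/\ measurable_fun setT (fun X => complex.Re (u X)),
      measurable_fun setT (fun X => complex.Im (u X)) &
      finite_norm leb13 p (fun X => Normc.normc (u X))].

Definition L2norm u : \bar R :=
  'N[leb13]_2%:E[EFin \o (fun X => Normc.normc (u X))].

Definition cintegral u : R[i] :=
  (Rintegral leb13 setT (fun X => complex.Re (u X)) +i*
   Rintegral leb13 setT (fun X => complex.Im (u X)))%C.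

Definition cis (t : R) : R[i] := (cos t +i* sin t)%C.

Definition fourier1 u X : R[i] :=
  cintegral (fun Y => cis (- (X.1 * Y.1 + dot3 X.2 Y.2)) * u Y).

(* The graph of the Fourier transform on L^2: the closure in L^2 x L^2 of the
   graph of the integral transform on L^1 /\ L^2. *)
Definition is_fourier u v : Prop :=
  [/\ cLp 2%:E u, cLp 2%:E v &
      exists f : nat -> spacetime R -> R[i],
        [/\ forall n, cLp 1%:E (f n) /\ cLp 2%:E (f n),
            L2norm (fun X => f n X - u X) @[n --> \oo] --> 0%E &
            L2norm (fun X => fourier1 (f n) X - v X) @[n --> \oo] --> 0%E]].

(* Representatives modulo a.e. equality are picked by choice; the default value
   is only reached outside of L^2. *)
Definition fourier u : spacetime R -> R[i] :=
  xget (fun=> 0) [set v | is_fourier u v].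

Definition inv_fourier v : spacetime R -> R[i] :=
  xget (fun=> 0) [set u | is_fourier u v].

Definition fsupp_in u A : Prop :=
  {ae leb13, forall X, ~ A X -> fourier u X = 0}.

(* The multiplier P_A with symbol the indicator of [A]. *)
Definition fproj A u : spacetime R -> R[i] :=
  inv_fourier (fun X => (\1_A X : R)%:C%C * fourier u X).

Definition slab w (I : set R) : set (spacetime R) :=
  [set X | I (dot3 X.2 w)].

(* The set K^{+-}_{N,L}. *)
Definition cone_nbhd s (N L : R) : set (spacetime R) :=
  [set X | N / 2 < norm3 X.2 <= N /\
           `| - X.1 + (-1) ^+ s * norm3 X.2 | <= L].

(* The Fourier transform of the bilinear operator with symbol
   theta_12 * chi_(theta_12 <= eps). *)
Definition bilin_hat (eps : R) s1 s2 u1 u2 : spacetime R -> R[i] := fun X0 =>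
  cintegral (fun X1 =>
    let X2 := X0 - X1 in
    let t12 := theta s1 s2 X1.2 X2.2 in
    (t12 * (t12 <= eps)%R%:R)%:C%C * fourier u1 X1 * fourier u2 X2).

Definition bilin eps s1 s2 u1 u2 : spacetime R -> R[i] :=
  inv_fourier (bilin_hat eps s1 s2 u1 u2).

End fourier.

(* Main.v *)
Require Import Defs.
From HB Require Import structures.
From mathcomp Require Import all_boot all_order all_algebra.
From mathcomp Require Import all_classical all_reals all_analysis.
From mathcomp Require Import measurable_realfun complex ring lra.

Import Order.TTheory GRing.Theory Num.Theory.
Import numFieldNormedType.Exports.
Import ComplexField.

Set Implicit Arguments.
Unset Strict Implicit.
Unset Printing Implicit Defensive.

Local Open Scope classical_set_scope.
Local Open Scope ring_scope.

(* Proof idea. Write [G1] and [G2] for the Fourier transforms of the two factors.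
   Cauchy-Schwarz gives [|F(B)(X0)|^2 <= k(X0) * (|G1|^2 * |G2|^2)(X0)] (a
   convolution), where [k(X0)] is the integral of the squared symbol over the
   [X1] allowed by the supports. Integrating over the slab of [X0], for each
   fixed [X2] the variable [X1] runs through a translate of that slab, whence
   the supremum; what is left is [k <= C r^2 L1 L2].

   Integrating [tau1] first yields [min(L1, L2)] and leaves the condition
   [|tau0 - f(xi1)| <= 2 max(L1, L2)] with [f(xi) = +-|xi| +- |xi0 - xi|]. The
   angle is comparable to [|d|], where [d], the gradient of [f], is a difference
   of two unit vectors [a] and [b]. As [|d|^2 = 2 d.a] and [a] is [r/N1]-close to
   the axis of the tube, [|d|^2] is at most a constant times [|d.w|] plus [r/N1]
   times the transversal components of [d]. On any line of direction [v] the
   derivative [d.v] of [f] changes sign at most once, so the integral of [|d.v|]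
   over the part where [|f - tau0| <= M] is [O(M)]; the lines along the tube
   form a family of measure [O(r^2)] and the transversal ones of measure
   [O(r N1)].

   The slab projections are applied to functions given through the L^2 Fourier
   transform, which is defined as the closure of the graph of the integral
   transform. The Plancherel theorem is proved for that graph, and the indicator
   of a slab preserves its range, being an iterated pointwise limit of
   polynomials in [cos (t * (xi.w - c))], which act by translations. Constants
   are not tracked, so that [|u + v|^2 <= 2|u|^2 + 2|v|^2] serves as triangle
   inequality. *)

(** * Square-integrable complex functions *)

(** [fourier] and [inv_fourier] are picked by choice and equal 0 where no transform exists, and the
    range of the transform is not identified with $L^2$. The projections and the bilinear operator
    on the left are only bounded from above, and there the default 0 is harmless. The slab
    projections of [u1] on the right have to be bounded from below, which the default 0 would ruin.
    This is the one place where a function must be shown to be a transform, and the reason why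
    indicators of slabs are studied as multipliers.

    The choice $\varepsilon_0=1/2$ serves twice. It gives $2r/N_1\le1$, a bound for the angular
    width of the tube seen from the origin on the shell $|\xi|>N_1/2$. It also keeps the admissible
    angles below the junk value $\pi/2$ at zero vectors and in the range where $\sin t$ is
    comparable to $t$.

    The lines along the tube are parametrized by the third coordinate, which needs $w_3$ bounded
    away from 0. Some coordinate of a unit vector has square at least $1/3$, and a cyclic
    permutation of the coordinates puts it in third place. *)

Section complex_square.
Context {R : realType}.
Implicit Types z w : R[i].

Lemma ReD z w : complex.Re (z + w) = complex.Re z + complex.Re w.
Proof. by case: z; case: w. Qed.
Lemma ImD z w : complex.Im (z + w) = complex.Im z + complex.Im w.
Proof. by case: z; case: w. Qed.
Lemma ReM z w : complex.Re (z * w) =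
  complex.Re z * complex.Re w - complex.Im z * complex.Im w.
Proof. by case: z; case: w. Qed.
Lemma ImM z w : complex.Im (z * w) =
  complex.Re z * complex.Im w + complex.Im z * complex.Re w.
Proof. by case: z; case: w. Qed.
Lemma ReN z : complex.Re (- z) = - complex.Re z.
Proof. by case: z. Qed.
Lemma ImN z : complex.Im (- z) = - complex.Im z.
Proof. by case: z. Qed.

Definition csq z : R := complex.Re z ^+ 2 + complex.Im z ^+ 2.

Lemma csq_ge0 z : 0 <= csq z.
Proof. by rewrite addr_ge0// sqr_ge0. Qed.

Lemma normcE2 z : Normc.normc z = Num.sqrt (csq z).
Proof. by case: z. Qed.

Lemma normc_ge0 z : 0 <= Normc.normc z.
Proof. by rewrite normcE2 sqrtr_ge0. Qed.

Lemma sqr_normc z : Normc.normc z ^+ 2 = csq z.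
Proof. by rewrite normcE2 sqr_sqrtr// csq_ge0. Qed.

Lemma csqM z w : csq (z * w) = csq z * csq w.
Proof. by rewrite /csq ReM ImM; ring. Qed.

Lemma csqN z : csq (- z) = csq z.
Proof. by rewrite /csq ReN ImN !sqrrN. Qed.

Lemma csqD z w : csq (z + w) <= 2 * csq z + 2 * csq w.
Proof.
rewrite /csq ReD ImD -subr_ge0.
rewrite (_ : _ - _ = (complex.Re z - complex.Re w) ^+ 2 +
  (complex.Im z - complex.Im w) ^+ 2); last by ring.
by rewrite addr_ge0// sqr_ge0.
Qed.

Lemma csq_cis t : csq (cis t : R[i]) = 1.
Proof. by rewrite /csq /= cos2Dsin2. Qed.

Lemma csq0 : csq 0 = 0 :> R.
Proof. by rewrite /csq /= expr0n addr0. Qed.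

Lemma csq_eq0 z : csq z = 0 -> z = 0.
Proof.
case: z => a b; rewrite /csq /= => /eqP.
rewrite paddr_eq0 ?sqr_ge0// !sqrf_eq0 => /andP[/eqP -> /eqP ->].
by [].
Qed.

Lemma cisD s t : cis (s + t) = cis s * cis t :> R[i].
Proof. by rewrite /cis cosD sinD; simpc; congr (_ +i* _)%C; ring. Qed.

Lemma Re_le_normc z : `|complex.Re z| <= Normc.normc z.
Proof.
by rewrite normcE2 -sqrtr_sqr ler_wsqrtr// /csq lerDl sqr_ge0.
Qed.

Lemma Im_le_normc z : `|complex.Im z| <= Normc.normc z.
Proof.
by rewrite normcE2 -sqrtr_sqr ler_wsqrtr// /csq lerDr sqr_ge0.
Qed.

Lemma normc_le_ReIm z :
  Normc.normc z <= `|complex.Re z| + `|complex.Im z|.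
Proof.
rewrite normcE2 -[leRHS]ger0_norm ?addr_ge0// -sqrtr_sqr ler_wsqrtr//.
rewrite /csq sqrrD !real_normK ?num_real//.
by rewrite -addrA lerD2l lerDr mulrn_wge0// mulr_ge0.
Qed.

End complex_square.

Section complex_measurable.
Context {R : realType} {d} {T : measurableType d}.
Implicit Types u v : T -> R[i].

Definition cmeas u := measurable_fun setT (fun x => complex.Re (u x)) /\
  measurable_fun setT (fun x => complex.Im (u x)).

Lemma cmeasD u v : cmeas u -> cmeas v -> cmeas (fun x => u x + v x).
Proof.
move=> [u1 u2] [v1 v2]; split.
- by under eq_fun do rewrite ReD; exact: measurable_funD.
- by under eq_fun do rewrite ImD; exact: measurable_funD.
Qed.

Lemma cmeasM u v : cmeas u -> cmeas v -> cmeas (fun x => u x * v x).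
Proof.
move=> [u1 u2] [v1 v2]; split.
- by under eq_fun do rewrite ReM; apply: measurable_funB; exact: measurable_funM.
- by under eq_fun do rewrite ImM; apply: measurable_funD; exact: measurable_funM.
Qed.

Lemma cmeas_cst z : cmeas (fun=> z).
Proof. by split; exact: measurable_cst. Qed.

Lemma cmeasN u : cmeas u -> cmeas (fun x => - u x).
Proof.
move=> [u1 u2]; split.
- by under eq_fun do rewrite ReN; exact: measurableT_comp.
- by under eq_fun do rewrite ImN; exact: measurableT_comp.
Qed.

Lemma cmeasB u v : cmeas u -> cmeas v -> cmeas (fun x => u x - v x).
Proof. by move=> mu mv; apply: cmeasD => //; exact: cmeasN. Qed.

Lemma cmeas_real (f : T -> R) : measurable_fun setT f ->
  cmeas (fun x => (f x)%:C%C).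
Proof. by move=> mf; split. Qed.

Lemma cmeas_cis (f : T -> R) : measurable_fun setT f ->
  cmeas (fun x => cis (f x)).
Proof.
move=> mf; split => /=; apply: measurableT_comp (mf).
- by apply: continuous_measurable_fun; exact: continuous_cos.
- by apply: continuous_measurable_fun; exact: continuous_sin.
Qed.

Lemma measurable_csq u : cmeas u -> measurable_fun setT (fun x => csq (u x)).
Proof.
by move=> [u1 u2]; apply: measurable_funD; exact: measurable_funX.
Qed.

Lemma measurable_normc u : cmeas u ->
  measurable_fun setT (fun x => Normc.normc (u x)).
Proof.
move=> mu; under eq_fun do rewrite normcE2.
apply: measurableT_comp (measurable_csq mu).
by apply: continuous_measurable_fun; exact: sqrt_continuous.
Qed.

Lemma measurable_Ecsq u : cmeas u ->
  measurable_fun setT (fun x => (csq (u x))%:E).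
Proof. by move=> mu; apply/measurable_EFinP; exact: measurable_csq. Qed.

Lemma measurable_Enormc u : cmeas u ->
  measurable_fun setT (fun x => (Normc.normc (u x))%:E).
Proof. by move=> mu; apply/measurable_EFinP; exact: measurable_normc. Qed.

End complex_measurable.

Lemma cmeas_comp {R : realType} d1 d2 (T1 : measurableType d1)
    (T2 : measurableType d2) (u : T2 -> R[i]) (f : T1 -> T2) :
  cmeas u -> measurable_fun setT f -> cmeas (fun x => u (f x)).
Proof.
by move=> [u1 u2] mf; split; [exact: measurableT_comp u1 mf|exact: measurableT_comp u2 mf].
Qed.

Section energy.
Context {R : realType} {d} {T : measurableType d}.
Variable m : {measure set T -> \bar R}.
Implicit Types u v : T -> R[i].
Local Open Scope ereal_scope.

Definition energy u : \bar R := \int[m]_x (csq (u x))%:E.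
Definition mass u : \bar R := \int[m]_x (Normc.normc (u x))%:E.
Definition cint u : R[i] :=
  (Rintegral m setT (fun x => complex.Re (u x)) +i*
   Rintegral m setT (fun x => complex.Im (u x)))%C.

Lemma energy_ge0 u : 0 <= energy u.
Proof. by apply: integral_ge0 => x _; rewrite lee_fin csq_ge0. Qed.

Lemma mass_ge0 u : 0 <= mass u.
Proof. by apply: integral_ge0 => x _; rewrite lee_fin normc_ge0. Qed.

Lemma ae_eq_energy u v : cmeas u -> cmeas v ->
  {ae m, forall x, u x = v x} -> energy u = energy v.
Proof.
move=> mu mv uv; apply: ge0_ae_eq_integral => //.
- exact: measurable_Ecsq.
- exact: measurable_Ecsq.
- by move=> x _; rewrite lee_fin csq_ge0.
- by move=> x _; rewrite lee_fin csq_ge0.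
- by apply: filterS uv => x /= -> _.
Qed.

Lemma energyD u v : cmeas u -> cmeas v ->
  energy (fun x => (u x + v x)%R) <= 2%:E * energy u + 2%:E * energy v.
Proof.
move=> mu mv; have ms := measurable_Ecsq.
rewrite -!ge0_integralZl//; last 4 first.
- exact: ms.
- by move=> x _; rewrite lee_fin csq_ge0.
- exact: ms.
- by move=> x _; rewrite lee_fin csq_ge0.
rewrite -ge0_integralD//; last 4 first.
- by move=> x _; rewrite -EFinM lee_fin mulr_ge0// csq_ge0.
- by apply: measurable_funeM; exact: ms.
- by move=> x _; rewrite -EFinM lee_fin mulr_ge0// csq_ge0.
- by apply: measurable_funeM; exact: ms.
apply: ge0_le_integral => //.
- by move=> x _; rewrite lee_fin csq_ge0.
- by apply: ms; exact: cmeasD.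
- by apply: emeasurable_funD; apply: measurable_funeM; exact: ms.
- by move=> x _; rewrite -!EFinM -EFinD lee_fin csqD.
Qed.

Lemma energyN u : energy (fun x => - u x)%R = energy u.
Proof. by apply: eq_integral => x _; rewrite csqN. Qed.

Lemma energyB u v : cmeas u -> cmeas v ->
  energy (fun x => (u x - v x)%R) <= 2%:E * energy u + 2%:E * energy v.
Proof.
by move=> mu mv; rewrite -(energyN v); apply: energyD => //; exact: cmeasN.
Qed.

Lemma energy_eq0 u : cmeas u -> energy u = 0 -> {ae m, forall x, u x = 0%R}.
Proof.
move=> mu u0; have := (ae_eq_integral_abs m measurableT (measurable_Ecsq mu)).1.
have -> : \int[m]_x `|(csq (u x))%:E| = energy u.
  by apply: eq_integral => x _; rewrite gee0_abs// lee_fin csq_ge0.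
move=> /(_ u0); apply: filterS => x /= /(_ I) [].
exact: csq_eq0.
Qed.

Lemma energyZ (z : R[i]) u : cmeas u ->
  energy (fun x => (z * u x)%R) = (csq z)%:E * energy u.
Proof.
move=> mu; rewrite -ge0_integralZl//; last 3 first.
- exact: measurable_Ecsq.
- by move=> x _; rewrite lee_fin csq_ge0.
- by rewrite lee_fin csq_ge0.
by apply: eq_integral => x _; rewrite csqM.
Qed.

Lemma mass_integrable u : cmeas u -> mass u < +oo ->
  m.-integrable setT (fun x => (complex.Re (u x))%:E) /\
  m.-integrable setT (fun x => (complex.Im (u x))%:E).
Proof.
move=> mu uoo; split; apply/integrableP; split;
  try by apply/measurable_EFinP; case: mu.
- apply: le_lt_trans uoo; apply: ge0_le_integral => //.
  + by apply: measurableT_comp => //; apply/measurable_EFinP; case: mu.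
  + exact: measurable_Enormc.
  + by move=> x _; rewrite abse_EFin lee_fin Re_le_normc.
- apply: le_lt_trans uoo; apply: ge0_le_integral => //.
  + by apply: measurableT_comp => //; apply/measurable_EFinP; case: mu.
  + exact: measurable_Enormc.
  + by move=> x _; rewrite abse_EFin lee_fin Im_le_normc.
Qed.

Lemma le_abs_Rintegral (f : T -> R) : measurable_fun setT f ->
  (`|Rintegral m setT f|)%:E <= \int[m]_x (`|f x|)%:E.
Proof.
move=> mf; have := le_abse_integral m measurableT
  ((measurable_EFinP _ _).2 mf).
rewrite /Rintegral /=.
(* For an infinite integral [Rintegral] takes the default value 0, and the bound is trivial. *)
case: (integral _ _ _) => [r| |] //=; rewrite ?normr0 => _.
- by apply: integral_ge0.
- by apply: integral_ge0.
Qed.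

(** The factor 2 is the price of bounding the real and the imaginary part separately. *)
Lemma normc_cint u : cmeas u ->
  (Normc.normc (cint u))%:E <= 2%:E * mass u.
Proof.
move=> mu; apply: (@le_trans _ _ (`|complex.Re (cint u)|%:E +
  `|complex.Im (cint u)|%:E)).
  by rewrite -EFinD lee_fin normc_le_ReIm.
rewrite (_ : 2%:E = 1 + 1); last by rewrite -EFinD.
rewrite ge0_muleDl// mul1e /=; case: mu => m1 m2.
apply: leeD; (apply: le_trans; first exact: le_abs_Rintegral);
  apply: ge0_le_integral => //.
- by apply/measurable_EFinP; exact: measurableT_comp.
- exact: measurable_Enormc.
- by move=> x _; rewrite lee_fin Re_le_normc.
- by apply/measurable_EFinP; exact: measurableT_comp.
- exact: measurable_Enormc.
- by move=> x _; rewrite lee_fin Im_le_normc.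
Qed.

Lemma cintD u v : cmeas u -> cmeas v -> mass u < +oo -> mass v < +oo ->
  cint (fun x => (u x + v x)%R) = (cint u + cint v)%R.
Proof.
move=> mu mv uoo voo; rewrite /cint.
have [u1 u2] := mass_integrable mu uoo.
have [v1 v2] := mass_integrable mv voo.
under eq_Rintegral do rewrite ReD.
under [X in (_ +i* X)%C]eq_Rintegral do rewrite ImD.
by rewrite !RintegralD.
Qed.

Lemma cintZ (z : R[i]) u : cmeas u -> mass u < +oo ->
  cint (fun x => (z * u x)%R) = (z * cint u)%R.
Proof.
move=> mu uoo; rewrite /cint.
have [u1 u2] := mass_integrable mu uoo.
under eq_Rintegral do rewrite ReM.
under [X in (_ +i* X)%C]eq_Rintegral do rewrite ImM.
have iz (c : R) (f : T -> R) : m.-integrable setT (EFin \o f) ->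
    m.-integrable setT (EFin \o (fun x => (c * f x)%R)).
  by move=> fi; rewrite /comp; under eq_fun do rewrite EFinM; exact: integrableZl.
rewrite RintegralB ?RintegralD ?RintegralZl//; try exact: iz.
by case: z.
Qed.

End energy.

(** * Integrals with a parameter and iterated integrals *)

Section parameter.
Context {R : realType} {d1 d2} {T1 : measurableType d1} {T2 : measurableType d2}.
Variable m2 : {sigma_finite_measure set T2 -> \bar R}.

(** Integrability may fail on some fibres. As the integral is the difference of those of the
    positive and negative parts, Tonelli's theorem still gives measurability. *)
Lemma measurable_Rintegral (F : T1 * T2 -> R) : measurable_fun setT F ->
  measurable_fun setT (fun x => Rintegral m2 setT (fun y => F (x, y))).
Proof.
move=> mF; apply: measurableT_comp => //.
have mF' : measurable_fun setT (EFin \o F) by exact/measurable_EFinP.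
have -> : (fun x => \int[m2]_(y in [set: T2]) (F (x, y))%:E)%E =
  (fun x => \int[m2]_y ((EFin \o F)^\+ (x, y)) -
            \int[m2]_y ((EFin \o F)^\- (x, y)))%E.
  apply/funext => x; rewrite [LHS]integralE.
  by congr (_ - _)%E; apply: eq_integral => y _; rewrite ?funeposE ?funenegE.
apply: emeasurable_funB.
- apply: (measurable_fun_fubini_tonelli_F ((EFin \o F)^\+)%E) => //.
  exact: measurable_funepos.
- apply: (measurable_fun_fubini_tonelli_F ((EFin \o F)^\-)%E) => //.
  exact: measurable_funeneg.
Qed.

Lemma cmeas_cint (F : T1 * T2 -> R[i]) : cmeas F ->
  cmeas (fun x => cint m2 (fun y => F (x, y))).
Proof.
by move=> [F1 F2]; split => /=;
  [exact: (measurable_Rintegral F1)|exact: (measurable_Rintegral F2)].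
Qed.

End parameter.

Section cint_fubini.
Context {R : realType} {d1 d2} {T1 : measurableType d1} {T2 : measurableType d2}.
Variable m1 : {sigma_finite_measure set T1 -> \bar R}.
Variable m2 : {sigma_finite_measure set T2 -> \bar R}.

(** Fubini's theorem makes the inner integral finite only for almost every [x], so [fine] is removed
    from it almost everywhere. *)
Lemma Rintegral_prod (F : T1 * T2 -> R) :
  (m1 \x m2)%E.-integrable setT (EFin \o F) ->
  Rintegral (m1 \x m2)%E setT F =
  Rintegral m1 setT (fun x => Rintegral m2 setT (fun y => F (x, y))).
Proof.
move=> iF; rewrite /Rintegral; congr fine.
rewrite -integral12_prod_meas1//.
apply: ae_eq_integral => //.
- exact: (measurable_fubini_F iF).
- apply/measurable_EFinP; apply: (@measurable_Rintegral _ _ _ _ _ m2 F).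
  by have /integrableP[/measurable_EFinP] := iF.
apply: filterS (ae_integrable1 iF) => x /= ix _.
by rewrite fineK//; exact: integrable_fin_num.
Qed.

Lemma Rintegral_swap (F : T1 * T2 -> R) :
  (m1 \x m2)%E.-integrable setT (EFin \o F) ->
  Rintegral m1 setT (fun x => Rintegral m2 setT (fun y => F (x, y))) =
  Rintegral m2 setT (fun y => Rintegral m1 setT (fun x => F (x, y))).
Proof.
move=> iF; rewrite -Rintegral_prod// /Rintegral; congr fine.
rewrite -integral21_prod_meas1//.
have mF : measurable_fun setT F.
  by have /integrableP[/measurable_EFinP] := iF.
apply: ae_eq_integral => //.
- exact: (measurable_fubini_G iF).
- apply/measurable_EFinP.
  apply: (@measurable_Rintegral _ _ _ _ _ m1 (fun z => F (z.2, z.1))).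
  by apply: (measurableT_comp mF); exact: measurable_fun_pair.
apply: filterS (ae_integrable2 iF) => x /= ix _.
by rewrite fineK//; exact: integrable_fin_num.
Qed.

Lemma cint_prod (F : T1 * T2 -> R[i]) : cmeas F ->
  (mass (m1 \x m2)%E F < +oo)%E ->
  cint (m1 \x m2)%E F = cint m1 (fun x => cint m2 (fun y => F (x, y))).
Proof.
move=> mF Foo; have [F1 F2] := mass_integrable mF Foo.
by rewrite /cint; congr (_ +i* _)%C; rewrite Rintegral_prod.
Qed.

End cint_fubini.

Section ereal_limits.
Context {R : realType}.
Local Open Scope ereal_scope.

Lemma ecvg0P (D : nat -> \bar R) : (forall n, 0 <= D n) ->
  D n @[n --> \oo] --> 0 <->
  forall e : R, (0 < e)%R -> \forall n \near \oo, D n <= e%:E.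
Proof.
move=> D0; split.
- move=> /fine_cvgP[Dfin /cvgrPdist_le Dcvg] e e0.
  have := Dcvg e e0; apply: filterS2 Dfin => n Dn.
  rewrite sub0r normrN /= ger0_norm ?fine_ge0//.
  by rewrite -lee_fin fineK.
- move=> De; apply/fine_cvgP; split.
    have := De 1%R ltr01; apply: filterS => n Dn.
    by rewrite ge0_fin_numE// (le_lt_trans Dn)// ltry.
  apply/cvgrPdist_le => e e0; have := De e e0; apply: filterS => n Dn.
  have Dfin : D n \is a fin_num by rewrite ge0_fin_numE// (le_lt_trans Dn)// ltry.
  by rewrite sub0r normrN /= ger0_norm ?fine_ge0// -lee_fin fineK.
Qed.

Lemma squeeze_ecvg0 (D E : nat -> \bar R) : (forall n, 0 <= D n) ->
  (forall n, D n <= E n) -> E n @[n --> \oo] --> 0 -> D n @[n --> \oo] --> 0.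
Proof.
move=> D0 DE E0; apply: (@squeeze_cvge _ _ _ _ (cst 0) D E) => //.
- by near=> n; rewrite D0 DE.
- exact: cvg_cst.
Unshelve. all: by end_near. Qed.

End ereal_limits.

(** * Transformations that preserve Lebesgue measure *)

Section invariance.
Context {R : realType}.
Local Open Scope ereal_scope.

(* Invariance is stated for nonnegative integrals, the form in which it passes
   to products by Tonelli. *)
Definition invariant d (T : measurableType d) (m : {measure set T -> \bar R})
    (phi : T -> T) :=
  measurable_fun setT phi /\
  forall f : T -> \bar R, measurable_fun setT f -> (forall x, 0 <= f x) ->
    \int[m]_x f (phi x) = \int[m]_x f x.

Lemma invariant_prod d1 d2 (T1 : measurableType d1) (T2 : measurableType d2)
    (m1 : {sigma_finite_measure set T1 -> \bar R})
    (m2 : {sigma_finite_measure set T2 -> \bar R}) phi1 phi2 :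
  invariant m1 phi1 -> invariant m2 phi2 ->
  invariant (m1 \x m2) (fun z => (phi1 z.1, phi2 z.2)).
Proof.
move=> [mphi1 i1] [mphi2 i2].
have mphi : measurable_fun setT (fun z : T1 * T2 => (phi1 z.1, phi2 z.2)).
  apply: measurable_fun_pair.
    exact: (measurableT_comp mphi1 measurable_fst).
  exact: (measurableT_comp mphi2 measurable_snd).
split => // f mf f0.
have mfp : measurable_fun setT (fun z : T1 * T2 => f (phi1 z.1, phi2 z.2)).
  exact: (measurableT_comp mf mphi).
rewrite (fubini_tonelli1 _ mfp (fun z => f0 _)) (fubini_tonelli1 _ mf f0).
rewrite -[RHS]i1; last 2 first.
- exact: measurable_fun_fubini_tonelli_F.
- by move=> x; apply: integral_ge0.
apply: eq_integral => x _; rewrite /fubini_F /=.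
apply: (i2 (fun y => f (phi1 x, y))) => //.
by apply: (measurableT_comp mf); exact: measurable_fun_pair.
Qed.

Lemma invariant_integral d (T : measurableType d)
    (m : {measure set T -> \bar R}) (phi : T -> T) (f : T -> \bar R) :
  invariant m phi -> measurable_fun setT f ->
  \int[m]_x f (phi x) = \int[m]_x f x.
Proof.
move=> [mphi iphi] mf; rewrite integralE [RHS]integralE; congr (_ - _).
- rewrite -(iphi (f^\+))//; last exact: measurable_funepos.
  by apply: eq_integral => x _; rewrite !funeposE.
- rewrite -(iphi (f^\-))//; last exact: measurable_funeneg.
  by apply: eq_integral => x _; rewrite !funenegE.
Qed.

Lemma invariant_Rintegral d (T : measurableType d)
    (m : {measure set T -> \bar R}) (phi : T -> T) (f : T -> R) :
  invariant m phi -> measurable_fun setT f ->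
  Rintegral m setT (fun x => f (phi x)) = Rintegral m setT f.
Proof.
move=> iphi mf; rewrite /Rintegral; congr fine.
by apply: (invariant_integral (f := EFin \o f)) => //; exact/measurable_EFinP.
Qed.

Lemma invariant_cint d (T : measurableType d)
    (m : {measure set T -> \bar R}) (phi : T -> T) (u : T -> R[i]) :
  invariant m phi -> cmeas u -> cint m (fun x => u (phi x)) = cint m u.
Proof.
move=> iphi [u1 u2]; rewrite /cint.
by rewrite (invariant_Rintegral iphi u1) (invariant_Rintegral iphi u2).
Qed.

(** A null set has a null preimage, since the integrals of the two indicators agree. *)
Lemma invariant_ae d (T : measurableType d)
    (m : {measure set T -> \bar R}) (phi : T -> T) (P : T -> Prop) :
  invariant m phi -> {ae m, forall x, P x} -> {ae m, forall x, P (phi x)}.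
Proof.
move=> [mphi iphi] [N [mN N0 PN]]; exists (phi @^-1` N); split.
- by rewrite -[X in measurable X]setTI; exact: mphi.
- have mphiN : measurable (phi @^-1` N).
    by rewrite -[X in measurable X]setTI; exact: mphi.
  transitivity (\int[m]_x (\1_N (phi x))%:E).
    by rewrite -[in LHS](setIT (phi @^-1` N)) -integral_indic.
  rewrite (iphi (EFin \o \1_N)).
  + by rewrite integral_indic// setIT.
  + exact/measurable_EFinP.
  + by move=> x; rewrite lee_fin.
- by move=> x /= Px; exact: PN.
Qed.

(** The pushforward under the translation agrees with Lebesgue measure on half-open intervals, which
    determines it. *)
Lemma invariant_shift (c : R) :
  invariant (@lebesgue_measure R) (fun x => x + c)%R.
Proof.
have mphi : measurable_fun setT ((fun x => x + c)%R :
   measurableTypeR R -> measurableTypeR R) by exact: measurable_funD.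
split => // f mf f0.
have := ge0_integral_pushforward mphi (@lebesgue_measure R) (D := setT) (f := f)
  measurableT mf (fun y _ => f0 y).
rewrite preimage_setT => <-.
apply: eq_measure_integral => A mA _; apply/esym.
apply: lebesgue_measure_unique => //= _ [[a b]] _ <-.
rewrite /pushforward /=.
rewrite (_ : _ @^-1` _ = `](a - c)%R, (b - c)%R]%classic).
  rewrite !lebesgue_measure_itv/= !lte_fin ltrD2r.
  by case: ifP => // _; rewrite -!EFinB; congr EFin; ring.
apply/seteqP; split => x /=; rewrite !in_itv/=.
- by rewrite ltrBlDr lerBrDr.
- by rewrite ltrBlDr lerBrDr.
Qed.

Lemma invariant_opp : invariant (@lebesgue_measure R) (fun x => - x)%R.
Proof.
have mphi : measurable_fun setT ((fun x => - x)%R :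
   measurableTypeR R -> measurableTypeR R) by exact: measurableT_comp.
split => // f mf f0.
have := ge0_integral_pushforward mphi (@lebesgue_measure R) (D := setT) (f := f)
  measurableT mf (fun y _ => f0 y).
rewrite preimage_setT => <-.
by apply: eq_measure_integral => A mA _; exact: lebesgue_measureN.
Qed.

Lemma invariant_reflect (c : R) :
  invariant (@lebesgue_measure R) (fun x => c - x)%R.
Proof.
have [m1 i1] := invariant_opp; have [m2 i2] := invariant_shift c.
split; first exact: measurable_funB.
move=> f mf f0; transitivity (\int[@lebesgue_measure R]_x f (- x + c)%R).
  by apply: eq_integral => x _; rewrite addrC.
rewrite (i1 (fun x => f (x + c)%R))//; first exact: i2.
exact: (measurableT_comp mf m2).
Qed.

Lemma ge0_integral_dilate (k : R) (f : R -> \bar R) : (0 < k)%R ->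
  measurable_fun setT f -> (forall x, 0 <= f x) ->
  k%:E * \int[lebesgue_measure]_x f (k * x)%R = \int[lebesgue_measure]_x f x.
Proof.
move=> k0 mf f0.
have mphi : measurable_fun setT ((fun x => k * x)%R :
   measurableTypeR R -> measurableTypeR R) by exact: measurable_funM.
have := ge0_integral_pushforward mphi (@lebesgue_measure R) (D := setT) (f := f)
  measurableT mf (fun y _ => f0 y).
rewrite preimage_setT => <-.
rewrite -(ge0_integral_mscale _ _ (NngNum (ltW k0)))//.
apply: eq_measure_integral => A mA _; apply/esym.
apply: lebesgue_measure_unique => //= _ [[a b]] _ <-.
have pre : (fun x => k * x)%R @^-1` `]a, b]%classic =
    `](a / k)%R, (b / k)%R]%classic.
  apply/seteqP; split => x /=; rewrite !in_itv/=.
  - by rewrite ltr_pdivrMr// ler_pdivlMr// mulrC.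
  - by rewrite ltr_pdivrMr// ler_pdivlMr// mulrC.
rewrite /mscale /= /pushforward pre.
rewrite !lebesgue_measure_itv/= !lte_fin ltr_pM2r ?invr_gt0//.
case: ifP => // _; last by rewrite mule0.
by rewrite -!EFinB -EFinM; congr EFin; field; rewrite gt_eqF.
Qed.

Lemma integral_dilate (k : R) (f : R -> \bar R) : (0 < k)%R ->
  measurable_fun setT f ->
  k%:E * \int[lebesgue_measure]_x f (k * x)%R = \int[lebesgue_measure]_x f x.
Proof.
move=> k0 mf; rewrite [in LHS]integralE [RHS]integralE.
rewrite -(ge0_integral_dilate (f := f^\+) k0)//; last exact: measurable_funepos.
rewrite -(ge0_integral_dilate (f := f^\-) k0)//; last exact: measurable_funeneg.
(* Both parts of the integral may be infinite, so distributivity is checked case by case; it holds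
   because [k] is finite and positive. *)
have muleB_gt0 (y z : \bar R) : k%:E * (y - z) = k%:E * y - k%:E * z.
  have k0' : 0 < k%:E by rewrite lte_fin.
  case: y z => [y| |] [z| |] //=; rewrite ?gt0_muley ?gt0_muleNy//.
  exact: (congr1 EFin (mulrBr k y z)).
rewrite -muleB_gt0; congr (_ * (_ - _)); apply: eq_integral => x _.
  by rewrite !funeposE.
by rewrite !funenegE.
Qed.

Lemma leb13_invariant_prod (p q r s : R -> R) :
  invariant (@lebesgue_measure R) p -> invariant (@lebesgue_measure R) q ->
  invariant (@lebesgue_measure R) r -> invariant (@lebesgue_measure R) s ->
  invariant (@leb13 R)
    (fun X => (p X.1, (q X.2.1.1, r X.2.1.2, s X.2.2))).
Proof.
move=> ip iq ir is_.
have i2 : invariant (@leb2 R) (fun z => (q z.1, r z.2)).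
  exact: (@invariant_prod _ _ _ _ lebesgue_measure lebesgue_measure _ _ iq ir).
have i3 : invariant (@leb3 R) (fun z => (q z.1.1, r z.1.2, s z.2)).
  exact: (@invariant_prod _ _ _ _ (@leb2 R) lebesgue_measure _ _ i2 is_).
exact: (@invariant_prod _ _ _ _ lebesgue_measure (@leb3 R) _ _ ip i3).
Qed.

Lemma leb13_invariant_shift (c : spacetime R) :
  invariant (@leb13 R) (fun X => X + c)%R.
Proof.
case: c => c0 [[c1 c2] c3]; have i := invariant_shift.
exact: (leb13_invariant_prod (i c0) (i c1) (i c2) (i c3)).
Qed.

Lemma leb13_invariant_reflect (c : spacetime R) :
  invariant (@leb13 R) (fun X => c - X)%R.
Proof.
case: c => c0 [[c1 c2] c3]; have i := invariant_reflect.
exact: (leb13_invariant_prod (i c0) (i c1) (i c2) (i c3)).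
Qed.

End invariance.

(** * Real square integrals and continuity of translations *)

Section sqint.
Context {R : realType} {d} {T : measurableType d}.
Variable m : {measure set T -> \bar R}.
Implicit Types f g : T -> R.
Local Open Scope ereal_scope.

Definition sqint f : \bar R := \int[m]_x ((f x) ^+ 2)%:E.

Lemma sqint_ge0 f : 0 <= sqint f.
Proof. by apply: integral_ge0 => x _; rewrite lee_fin sqr_ge0. Qed.

Lemma measurable_Esqr f : measurable_fun setT f ->
  measurable_fun setT (fun x => ((f x) ^+ 2)%:E).
Proof. by move=> mf; apply/measurable_EFinP; exact: measurable_funX. Qed.

Lemma sqintD f g : measurable_fun setT f -> measurable_fun setT g ->
  sqint (fun x => f x + g x)%R <= 2%:E * sqint f + 2%:E * sqint g.
Proof.
move=> mf mg; have E h : sqint h = energy m (fun x => (h x)%:C%C).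
  by apply: eq_integral => x _; rewrite /csq /= expr0n addr0.
rewrite !E; have := energyD m (cmeas_real mf) (cmeas_real mg).
by rewrite [X in energy m X](_ : _ = (fun x => (f x + g x)%:C%C))//; apply/funext => x;
  rewrite rmorphD.
Qed.

End sqint.

Section clip.
Context {R : realType}.

(** For $M\ge0$ this is the truncation of [t] to $[-M,M]$, in a form that inherits continuity and
    the Lipschitz bound from the absolute value. *)
Definition clip (M t : R) : R := (`|t + M| - `|t - M|) / 2.

Lemma clip_le (M t : R) : 0 <= M -> `|clip M t| <= M.
Proof.
rewrite /clip => M0; rewrite ler_norml.
by case: (ler0P (t + M)); case: (ler0P (t - M)) => *; apply/andP; split; lra.
Qed.

Lemma clip_id (M t : R) : `|t| <= M -> clip M t = t.
Proof.
rewrite /clip ler_norml => /andP[? ?].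
by rewrite ger0_norm ?ler0_norm; lra.
Qed.

Lemma clip_lip (M s t : R) : `|clip M s - clip M t| <= `|s - t|.
Proof.
have h1 := ler_dist_dist (s + M) (t + M); have h2 := ler_dist_dist (s - M) (t - M).
rewrite (_ : s + M - (t + M) = s - t) in h1; last by ring.
rewrite (_ : s - M - (t - M) = s - t) in h2; last by ring.
move: h1 h2; rewrite /clip !ler_norml => /andP[h1 h2] /andP[h3 h4].
by apply/andP; split; lra.
Qed.

Lemma continuous_clip (M : R) : continuous (clip M).
Proof.
move=> x; apply: cvgM; last exact: cvg_cst.
apply: cvgB; apply: cvg_norm.
  by apply: cvgD; [exact: cvg_id|exact: cvg_cst].
by apply: cvgB; [exact: cvg_id|exact: cvg_cst].
Qed.

End clip.

Lemma quarters {R : realFieldType} (e : R) :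
  (2%:E * (e / 4)%:E + 2%:E * (e / 4)%:E = e%:E)%E.
Proof. by rewrite -!EFinM -EFinD; congr EFin; field. Qed.

Section translation.
Context {R : realType}.
Local Notation mu := (@lebesgue_measure R).
Local Open Scope ereal_scope.

Lemma lebesgue_measure_itvcc_lty (a b : R) : mu `[a, b]%classic < +oo.
Proof.
by rewrite lebesgue_measure_itv/=; case: ifP => // _; rewrite -EFinB ltry.
Qed.

Lemma truncation_approx (f : R -> R) : measurable_fun setT f ->
  sqint mu f < +oo ->
  sqint mu (fun x => f x - f x *
    \1_(`[(- n%:R)%R, n%:R%R]%classic `&` [set x | (`|f x| <= n%:R)%R]) x)%R
  @[n --> \oo] --> 0.
Proof.
move=> mf foo; pose E n := `[(- n%:R)%R, n%:R%R]%classic `&`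
  [set x | (`|f x| <= n%:R)%R] : set R.
have mE n : measurable (E n).
  apply: measurableI => //; rewrite -[X in measurable X]setTI.
  by apply: measurable_fun_le => //; exact: measurableT_comp.
have mfE n : measurable_fun setT (fun x => f x - f x * \1_(E n) x)%R.
  by apply: measurable_funB => //; exact: measurable_funM.
have [] := @dominated_convergence _ _ _ mu setT measurableT
  (fun n x => ((f x - f x * \1_(E n) x) ^+ 2)%:E) (cst 0)
  (fun x => (f x ^+ 2)%:E).
- by move=> n; exact: (measurable_Esqr (mfE n)).
- exact: measurable_cst.
- apply: aeW => x _; apply: cvg_near_cst.
  near=> n; rewrite indicE mem_set ?mulr1 ?subrr ?expr0n//.
  split => /=.
    rewrite in_itv/= -ler_norml.
    by near: n; exact: nbhs_infty_ger.
  by near: n; exact: nbhs_infty_ger.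
- apply/integrableP; split; first exact: measurable_Esqr.
  under eq_integral do rewrite gee0_abs ?lee_fin ?sqr_ge0//.
  exact: foo.
- apply: aeW => x n _; rewrite gee0_abs ?lee_fin ?sqr_ge0//.
  rewrite indicE; case: (x \in E n) => /=; rewrite ?mulr1 ?mulr0 ?subr0//.
  by rewrite subrr expr0n sqr_ge0.
- move=> _ _; rewrite integral0; exact.
Unshelve. all: by end_near. Qed.

(** Approximation in $L^1$ by continuous functions is upgraded to $L^2$. After truncation $|g|\le
    M$; clipping the approximant to the same bound does not increase its distance to $g$, and then
    $|g-h|^2\le2M|g-h|$. *)
Lemma L2_approx (f : R -> R) (eta : R) : measurable_fun setT f ->
  sqint mu f < +oo -> (0 < eta)%R ->
  exists M (h : R -> R), [/\ (0 <= M)%R, continuous h,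
    forall x, (`|h x| <= M)%R &
    sqint mu (fun x => f x - h x * \1_(`[(- M)%R, M]%classic) x)%R <= eta%:E].
Proof.
move=> mf foo eta0.
have := truncation_approx mf foo.
move=> /ecvg0P => /(_ (fun n => sqint_ge0 _ _)) /(_ (eta / 4)%R).
move=> /(_ ltac:(by rewrite divr_gt0))[n _ /(_ n (leqnn n))] /=.
set E := _ `&` _ => nE; pose g := (fun x => f x * \1_E x)%R.
pose M := n%:R : R; have M0 : (0 <= M)%R by exact: ler0n.
have mE : measurable E.
  apply: measurableI => //; rewrite -[X in measurable X]setTI.
  by apply: measurable_fun_le => //; exact: measurableT_comp.
have mg : measurable_fun setT g by exact: measurable_funM.
have gM x : (`|g x| <= M)%R.
  rewrite /g indicE; have [xE|xE] := boolP (x \in E).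
    by rewrite mulr1; move: xE; rewrite inE => -[].
  by rewrite mulr0 normr0.
have [] := @approximation_continuous_integrable R `[(- M)%R, M]%classic g.
- exact: measurable_itv.
- exact: lebesgue_measure_itvcc_lty.
- apply: measurable_bounded_integrable => //.
  + exact: lebesgue_measure_itvcc_lty.
  + exact: measurable_funTS.
  + exists M; split; first exact: num_real.
    by move=> t Mt x _ /=; rewrite (le_trans (gM x))// ltW.
move=> hs [hc hi] /ecvg0P; have h0 k : 0 <= \int[mu]_(z in `[(- M)%R, M])
  `|(g z - hs k z)%:E| by exact: integral_ge0.
(* With this $L^1$ error, $2Mb\le\eta/4$; the summand 1 covers the case $M=0$. *)
pose b := (eta / (8 * (M + 1)))%R.
have b0 : (0 < b)%R by rewrite divr_gt0// mulr_gt0// ltr_wpDl.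
move=> /(_ h0 b b0)[k _ /(_ k (leqnn k))] /= hk.
exists M, (clip M \o hs k); split => //.
- move=> x; apply: continuous_comp; first exact: hc.
  exact: continuous_clip.
- by move=> x; exact: clip_le.
have mhk : measurable_fun setT (fun x => clip M (hs k x)).
  apply: continuous_measurable_fun => x.
  by apply: continuous_comp; [exact: hc|exact: continuous_clip].
pose h := (fun x => clip M (hs k x) * \1_(`[(- M)%R, M]%classic) x)%R : R -> R.
rewrite (_ : sqint _ _ = sqint mu (fun x => f x - h x)%R)//.
have mh : measurable_fun setT h by exact: measurable_funM.
rewrite (_ : sqint _ _ = sqint mu (fun x => (f x - g x) + (g x - h x))%R); last first.
  by apply: eq_integral => x _; congr (_ ^+ 2)%:E; ring.
apply: le_trans (sqintD _ _ _) _.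
- exact: measurable_funB.
- exact: measurable_funB.
rewrite -(quarters eta) leeD ?lee_pmul2l ?lte_fin//.
apply: (@le_trans _ _ (\int[mu]_(z in `[(- M)%R, M])
   ((2 * M)%:E * `|(g z - hs k z)%:E|))); last first.
  rewrite ge0_integralZl//.
  - apply: (@le_trans _ _ ((2 * M)%:E * b%:E)).
      by rewrite lee_pmul// lee_fin mulr_ge0.
    rewrite -EFinM lee_fin /b mulrA ler_pdivrMr; last by rewrite mulr_gt0// ltr_wpDl.
    by nra.
  - apply: measurable_funTS; apply: measurableT_comp => //.
    apply/measurable_EFinP; apply: measurable_funB => //.
    exact: continuous_measurable_fun.
  - by rewrite lee_fin mulr_ge0.
rewrite [leRHS]integral_mkcond; apply: ge0_le_integral => //.
- by move=> x _; rewrite lee_fin sqr_ge0.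
- by apply: measurable_Esqr; exact: measurable_funB.
- apply/(measurable_restrictT _ _).1 => //.
  apply: measurable_funTS; apply: measurable_funeM; apply: measurableT_comp => //.
  apply/measurable_EFinP; apply: measurable_funB => //.
  exact: continuous_measurable_fun.
move=> x _; rewrite patchE; have [xM|xM] := boolP (x \in _).
  rewrite abse_EFin -EFinM lee_fin /h indicE xM mulr1 -real_normK ?num_real// expr2.
  have := clip_lip M (g x) (hs k x); rewrite (clip_id (gM x)) => lip.
  rewrite ler_pM//.
  apply: (le_trans (ler_normB _ _)); rewrite mulrDl mul1r lerD//.
  exact: clip_le.
rewrite /h indicE (negbTE xM) mulr0 subr0 /g indicE memNset ?mulr0 ?expr0n//.
by move=> [xM' _]; move: xM; rewrite mem_set.
Qed.

(** Dominated convergence: the function is continuous off the jumps of the cut-off at $\pm M$, and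
    all its translates by at most [B] live on one bounded interval. *)
Lemma translation_box (h : R -> R) (M B : R) (z : nat -> R) : (0 <= M)%R ->
  continuous h -> (forall x, `|h x| <= M)%R ->
  (forall n, `|z n| <= B)%R -> (z n @[n --> \oo] --> (0 : R))%R ->
  let g := (fun x => h x * \1_(`[(- M)%R, M]%classic) x)%R in
  sqint mu (fun x => g (x - z n) - g x)%R @[n --> \oo] --> 0.
Proof.
move=> M0 hc hM zB z0 g.
have B0 : (0 <= B)%R by exact: le_trans (zB 0%N).
have mh : measurable_fun setT h by exact: continuous_measurable_fun.
have mg : measurable_fun setT g by exact: measurable_funM.
have mgz (c : R) : measurable_fun setT (fun x : R => g (x - c)%R).
  by apply: (measurableT_comp mg); exact: measurable_funB.
have gM x : (`|g x| <= M)%R.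
  rewrite /g indicE; case: (_ \in _); rewrite ?mulr1 ?mulr0 ?normr0//.
have gout x : (M < `|x|)%R -> g x = 0%R.
  move=> Mx; rewrite /g indicE memNset ?mulr0//= in_itv/= -ler_norml.
  by apply/negP; rewrite -ltNge.
have gin x : (`|x| <= M)%R -> g x = h x.
  by move=> xM; rewrite /g indicE mem_set ?mulr1//= in_itv/= -ler_norml.
have [] := @dominated_convergence _ _ _ mu setT measurableT
  (fun n x => ((g (x - z n) - g x) ^+ 2)%:E)%R (cst 0)
  (fun x => ((2 * M) ^+ 2 * \1_(`[(- (M + B))%R, (M + B)%R]%classic) x)%:E)%R.
- by move=> n; exact: (measurable_Esqr (measurable_funB (mgz (z n)) mg)).
- exact: measurable_cst.
- have nM (c : R) : {ae mu, forall x, x != c}.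
    exists [set c]; split; [exact: measurable_set1|exact: lebesgue_measure_set1|].
    by move=> x /= /negP; rewrite negbK => /eqP.
  have aeF : Filter (almost_everywhere mu) by exact: (ae_filter_ringOfSetsType mu).
  apply: (@filterS2 _ _ aeF _ _ _ _ (nM M) (nM (- M)%R)) => x xM xNM _.
  have xM' : (`|x| != M)%R.
    apply/negP => /eqP xE; case: (ler0P x) xE => _ /eqP.
      by rewrite eqr_oppLR (negbTE xNM).
    by rewrite (negbTE xM).
  suff gz : (g (x - z n) @[n --> \oo] --> g x)%R.
    rewrite (_ : cst 0 x = ((g x - g x) ^+ 2)%:E)%R; last by rewrite subrr expr0n.
    apply: cvg_EFin; first by near=> n.
    rewrite /comp/= expr2; under eq_fun do rewrite expr2.
    by apply: cvgM; apply: cvgB => //; exact: cvg_cst.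
  have xz : (x - z n @[n --> \oo] --> x)%R.
    by rewrite -[X in _ --> X]subr0; apply: cvgB => //; exact: cvg_cst.
  have xzn : (`|x - z n| @[n --> \oo] --> `|x|)%R by exact: cvg_norm.
  have [xltM|Mltx|/eqP] := ltgtP `|x|%R M; last by rewrite (negbTE xM').
  - rewrite (gin _ (ltW xltM)); apply: cvg_trans (_ : h (x - z n)%R @[n --> \oo] --> _).
      apply: near_eq_cvg; near=> n; rewrite gin// ltW//.
      by near: n; exact: cvgr_lt xzn _ xltM.
    by apply: cvg_comp xz _; exact: hc.
  - rewrite (gout _ Mltx); apply: cvg_near_cst.
    near=> n; apply: gout; near: n; exact: cvgr_gt xzn _ Mltx.
- rewrite [X in mu.-integrable _ X](_ : _ = fun x => ((2 * M) ^+ 2)%:E *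
    (EFin \o \1_(`[(- (M + B))%R, (M + B)%R]%classic)) x).
    by apply: integrableZl => //; exact: integrable_indic_itv.
  by apply/funext => x; rewrite /= EFinM.
- apply: aeW => x n _; rewrite gee0_abs ?lee_fin ?sqr_ge0// indicE.
  have [xin|xout] := boolP (x \in _).
    rewrite mulr1 -real_normK ?num_real// ler_sqr ?nnegrE ?mulr_ge0//.
    apply: (le_trans (ler_normB _ _)); rewrite mulrDl mul1r lerD//.
  rewrite mulr0; suff [-> ->] : g (x - z n)%R = 0%R /\ g x = 0%R.
    by rewrite subrr expr0n.
  have MBx : (M + B < `|x|)%R.
    rewrite ltNge; apply: contra xout => xMB; rewrite inE/= in_itv/=.
    by rewrite -ler_norml.
  split; apply: gout; last by apply: le_lt_trans MBx; rewrite lerDl.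
  rewrite -(ltrD2r B); apply: lt_le_trans MBx _.
  rewrite -[x in leLHS](subrK (z n)) (le_trans (ler_normD _ _))//.
  by rewrite lerD2l.
- by move=> _ _; rewrite integral0; exact.
Unshelve. all: by end_near. Qed.

Lemma sqint_shift (f : R -> R) c : measurable_fun setT f ->
  sqint mu (fun x => f (x - c))%R = sqint mu f.
Proof.
move=> mf; have [_ i] := invariant_shift (- c)%R.
by apply: (i (fun x => ((f x) ^+ 2)%:E)) => //;
  [exact: measurable_Esqr|move=> x; rewrite lee_fin sqr_ge0].
Qed.

Lemma translation_cvg (f : R -> R) (B : R) (z : nat -> R) :
  measurable_fun setT f -> sqint mu f < +oo ->
  (forall n, `|z n| <= B)%R -> (z n @[n --> \oo] --> (0 : R))%R ->
  sqint mu (fun x => f (x - z n) - f x)%R @[n --> \oo] --> 0.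
Proof.
move=> mf foo zB z0; apply/ecvg0P; first by move=> n; exact: sqint_ge0.
move=> e e0.
(* Two applications of [sqintD] weigh the three errors by 2, 4 and 4, and ten times $e/20$ is below
   $e$. *)
have e20 : (0 < e / 20)%R by rewrite divr_gt0.
have [M [h [M0 hc hM fh]]] := L2_approx mf foo e20.
have /ecvg0P := translation_box M0 hc hM zB z0.
pose g := (fun x => h x * \1_(`[(- M)%R, M]%classic) x)%R : R -> R.
rewrite -/g => /(_ (fun n => sqint_ge0 _ _) _ e20).
have mg : measurable_fun setT g.
  by apply: measurable_funM => //; exact: continuous_measurable_fun.
have mz (c : R) (k : R -> R) : measurable_fun setT k ->
    measurable_fun setT (fun x : R => k (x - c)%R).
  by move=> mk; apply: (measurableT_comp mk); exact: measurable_funB.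
apply: filterS => n gn.
have := sqint_shift (z n) (measurable_funB mf mg) => /= fgz.
rewrite (_ : sqint _ _ = sqint mu (fun x =>
   (f (x - z n) - g (x - z n)) + ((g (x - z n) - g x) + (- (f x - g x))))%R); last first.
  by apply: eq_integral => x _; congr (_ ^+ 2)%:E; ring.
apply: le_trans (sqintD _ _ _) _.
- by apply: measurable_funB; exact: mz.
- apply: measurable_funD; first by apply: measurable_funB => //; exact: mz.
  by apply: measurableT_comp => //; exact: measurable_funB.
apply: (@le_trans _ _ (2%:E * (e / 20)%:E + 2%:E * (2%:E * (e / 20)%:E + 2%:E * (e / 20)%:E))).
  rewrite leeD ?lee_pmul2l ?lte_fin//; first by rewrite fgz.
  apply: le_trans (sqintD _ _ _) _.
  - by apply: measurable_funB => //; exact: mz.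
  - by apply: measurableT_comp => //; exact: measurable_funB.
  rewrite leeD ?lee_pmul2l ?lte_fin//.
  rewrite (_ : sqint _ _ = sqint mu (fun x => f x - g x)%R)//.
  by apply: eq_integral => x _; rewrite sqrrN.
by rewrite -!(EFinM, EFinD) lee_fin; lra.
Qed.

End translation.

(** * The Plancherel theorem *)

Section poisson.
Context {R : realType}.
Local Notation mu := (@lebesgue_measure R).
Implicit Types e z x : R.

(** A primitive of $e^{-ex}(1+\cos xz)$. The added 1 makes the integrand nonnegative, as the
    fundamental theorem on a half line used below requires. The case $z=0$ then yields the integral
    of the weight alone, which is subtracted in [Rintegral_poisson]. *)
Let prim e z x := - (expR (- (e * x)) / e) +
  expR (- (e * x)) * (z * sin (x * z) - e * cos (x * z)) / (e ^+ 2 + z ^+ 2).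

Let is_derive_prim e z x : 0 < e ->
  is_derive x 1 (prim e z) (expR (- (e * x)) * (1 + cos (x * z))).
Proof.
move=> e0; rewrite /prim.
have dl c : is_derive x 1 (fun t : R => t * c) c.
  have := is_deriveM (is_derive_id x 1) (is_derive_cst c x 1).
  by rewrite scaler0 add0r /GRing.scale /= mulr1.
have dexp : is_derive x 1 (fun t => expR (- (e * t))) (- e * expR (- (e * x))).
  have h : is_derive x 1 (fun t => - (e * t)) (- e).
    rewrite (_ : (fun t => _) = (fun t => t * - e)) //.
    by apply/funext => t; rewrite mulrN mulrC.
  by have := @is_derive1_comp _ expR (fun t => - (e * t)) x _ _ (is_derive_expR _) h;
    rewrite mulrC.
have ds := @is_derive1_comp _ (@sin R) (fun t => t * z) x _ _ (is_derive_sin _) (dl z).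
have dc := @is_derive1_comp _ (@cos R) (fun t => t * z) x _ _ (is_derive_cos _) (dl z).
pose k := (e ^+ 2 + z ^+ 2)^-1.
have d1 := is_deriveM dexp (is_derive_cst e^-1 x 1).
have d2 := is_deriveB (is_deriveM (is_derive_cst z x 1) ds)
   (is_deriveM (is_derive_cst e x 1) dc).
have d3 := is_deriveM (is_deriveM dexp d2) (is_derive_cst k x 1).
have d4 := is_deriveD (is_deriveN d1) d3.
apply: (is_derive_eq d4).
rewrite !scaler0 !addr0 !add0r /GRing.scale /= /k.
have ez : e ^+ 2 + z ^+ 2 != 0 by rewrite gt_eqF// ltr_pwDl ?exprn_gt0 ?sqr_ge0.
rewrite -[X in expR _ * _ + X * _]/(z * sin (x * z) - e * cos (x * z)).
by field; rewrite ez gt_eqF.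
Qed.

Let prim0 e z : 0 < e -> prim e z 0 = - (1 / e + e / (e ^+ 2 + z ^+ 2)).
Proof.
move=> e0; rewrite /prim !mulr0 !mul0r oppr0 expR0 sin0 cos0 mulr0 sub0r !mul1r.
by rewrite mulr1 mulNr opprD.
Qed.

Let prim_cvg e z : 0 < e -> prim e z x @[x --> +oo] --> 0.
Proof.
move=> e0; pose K := e^-1 + (`|z| + e) / (e ^+ 2 + z ^+ 2).
have ez : 0 < e ^+ 2 + z ^+ 2 by rewrite ltr_pwDl ?exprn_gt0 ?sqr_ge0.
have ex0 : expR (- (e * x)) @[x --> +oo] --> (0 : R).
  apply: (@cvg_comp _ _ _ (fun x => e * x) (fun y => expR (- y)) _ +oo%R).
    by apply: gt0_cvgMry => //; exact: cvg_cst.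
  exact: cvgr_expR.
have Kex0 : K * expR (- (e * x)) @[x --> +oo] --> (0 : R).
  by rewrite -(mulr0 K); apply: cvgM => //; exact: cvg_cst.
have bound x : `|prim e z x| <= K * expR (- (e * x)).
  rewrite /prim /K -mulrN -mulrA -mulrDr normrM ger0_norm ?expR_ge0// mulrC.
  rewrite ler_pM2r ?expR_gt0// (le_trans (ler_normD _ _))//.
  rewrite normrN ger0_norm ?invr_ge0 ?(ltW e0)// lerD2l normrM.
  rewrite [X in _ * X]ger0_norm ?invr_ge0 ?(ltW ez)//.
  rewrite ler_pM2r ?invr_gt0// (le_trans (ler_normB _ _))// !normrM.
  rewrite (gtr0_norm e0) lerD// ?ler_piMr ?sin_max ?cos_max//.
  by rewrite ltW.
apply/cvgr0Pnorm_le => d d0.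
have /cvgr0Pnorm_le/(_ d d0) := Kex0.
apply: filterS => x; apply: le_trans.
by rewrite (le_trans (bound x))// ler_norm.
Qed.

Lemma integral_poisson e z : 0 < e ->
  (\int[mu]_x (expR (- (e * `|x|)) * (1 + cos (x * z)))%:E =
  (2 / e + 2 * e / (e ^+ 2 + z ^+ 2))%:E)%E.
Proof.
move=> e0.
have cc : continuous (fun x : R => 1 + cos (x * z)).
  move=> x; apply: cvgD; first exact: cvg_cst.
  apply: continuous_comp; last exact: continuous_cos.
  by apply: cvgM; [exact: cvg_id|exact: cvg_cst].
have ce (k : R -> R) : continuous k -> continuous (fun x => expR (- (e * k x))).
  move=> ck x; apply: continuous_comp; last exact: continuous_expR.
  by apply: cvgN; apply: cvgM; [exact: cvg_cst|exact: ck].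
rewrite ge0_symfun_integralT; last 3 first.
- by move=> x; rewrite mulr_ge0 ?expR_ge0// -lerBlDl sub0r cos_geN1.
- move=> x; apply: cvgM; last exact: cc.
  by apply: (ce (fun x : R => `|x|)); exact: norm_continuous.
- by move=> x /=; rewrite normrN mulNr cosN.
rewrite (_ : [set x | 0 <= x] = `[0, +oo[%classic); last first.
  by apply/seteqP; split => x /=; rewrite in_itv/= ?andbT.
have -> : (\int[mu]_(x in `[0%R, +oo[)
    (expR (- (e * `|x|)) * (1 + cos (x * z)))%:E =
    \int[mu]_(x in `[0%R, +oo[) (expR (- (e * x)) * (1 + cos (x * z)))%:E)%E.
  apply: eq_integral => x; rewrite inE/= in_itv/= andbT => x0.
  by rewrite ger0_norm.
rewrite (@ge0_continuous_FTC2y _ _ (prim e z) 0 0).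
- rewrite prim0// -EFinB -EFinM sub0r opprK mulrDr; congr (_ + _)%:E.
    by rewrite mul1r.
  by rewrite mulrA.
- by move=> x _; rewrite mulr_ge0 ?expR_ge0// -lerBlDl sub0r cos_geN1.
- apply: continuous_subspaceT => x; apply: cvgM; last exact: cc.
  by apply: (ce id) => y; exact: cvg_id.
- exact: prim_cvg.
- by move=> x _; have [] := is_derive_prim z x e0.
- apply: cvg_at_right_filter.
  have [d _] := is_derive_prim z 0 e0.
  by apply: differentiable_continuous; apply/derivable1_diffP.
- move=> x _; rewrite derive1E; exact: (@derive_val _ _ _ _ _ _ _ (is_derive_prim z x e0)).
Qed.

Lemma measurable_expR_abs e : measurable_fun setT (fun x : R => expR (- (e * `|x|))).
Proof.
apply: measurableT_comp => //; apply: measurableT_comp => //.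
by apply: measurable_funM => //; exact: measurableT_comp.
Qed.

Lemma integral_expR_abs e : 0 < e ->
  (\int[mu]_x (expR (- (e * `|x|)))%:E = (2 / e)%:E)%E.
Proof.
move=> e0; have := integral_poisson 0 e0.
under eq_integral do rewrite mulr0 cos0 EFinM muleC.
rewrite ge0_integralZl//; last first.
  by apply/measurable_EFinP; exact: measurable_expR_abs.
rewrite (_ : 2 / e + _ = 2 * (2 / e)); last by rewrite expr0n addr0; field; rewrite gt_eqF.
rewrite EFinM; have i0 : (0 <= \int[mu]_x (expR (- (e * `|x|)))%:E)%E.
  by apply: integral_ge0 => x _; rewrite lee_fin expR_ge0.
case: (integral _ _ _) i0 => [r _| |] //=.
- by rewrite -!EFinM => -[] /mulfI -> //; rewrite pnatr_eq0.
- by rewrite gt0_muley// lte_fin.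
Qed.

Lemma integrable_expR_abs e : 0 < e ->
  mu.-integrable setT (EFin \o (fun x => expR (- (e * `|x|)))).
Proof.
move=> e0; apply/integrableP; split.
  by apply/measurable_EFinP; exact: measurable_expR_abs.
under eq_integral do rewrite gee0_abs ?lee_fin ?expR_ge0//.
by rewrite integral_expR_abs// ltry.
Qed.

Lemma measurable_cosM z : measurable_fun setT (fun x : R => cos (x * z)).
Proof.
have mz : measurable_fun setT (fun x : R => x * z) by exact: measurable_funM.
by apply: measurableT_comp mz; apply: continuous_measurable_fun; exact: continuous_cos.
Qed.

Lemma measurable_sinM z : measurable_fun setT (fun x : R => sin (x * z)).
Proof.
have mz : measurable_fun setT (fun x : R => x * z) by exact: measurable_funM.
by apply: measurableT_comp mz; apply: continuous_measurable_fun; exact: continuous_sin.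
Qed.

Lemma integrable_expR_cos e z : 0 < e ->
  mu.-integrable setT (EFin \o (fun x => expR (- (e * `|x|)) * cos (x * z))).
Proof.
move=> e0; apply: le_integrable (integrable_expR_abs e0) => //.
- apply/measurable_EFinP; apply: measurable_funM; first exact: measurable_expR_abs.
  exact: measurable_cosM.
- move=> x _; rewrite lee_fin normrM ger0_norm ?expR_ge0//.
  by rewrite ler_piMr ?expR_ge0// cos_max.
Qed.

Lemma Rintegral_poisson e z : 0 < e ->
  Rintegral mu setT (fun x => expR (- (e * `|x|)) * cos (x * z)) =
  2 * e / (e ^+ 2 + z ^+ 2).
Proof.
move=> e0; have iw := integrable_expR_abs e0.
have ic := integrable_expR_cos z e0.
have : Rintegral mu setT (fun x => expR (- (e * `|x|)) * (1 + cos (x * z))) =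
  2 / e + 2 * e / (e ^+ 2 + z ^+ 2) by rewrite /Rintegral integral_poisson.
under eq_Rintegral do rewrite mulrDr mulr1.
rewrite RintegralD// {1}/Rintegral integral_expR_abs//=.
by move/addrI.
Qed.

Lemma integral_oneDsqrT :
  (\int[mu]_x ((oneDsqr x)^-1)%:E = (pi : R)%:E)%E.
Proof.
rewrite ge0_symfun_integralT; last 3 first.
- by move=> x; rewrite invr_ge0 addr_ge0// sqr_ge0.
- exact: continuous_oneDsqrV.
- by move=> x; rewrite /= /oneDsqr sqrrN.
rewrite (_ : [set x | 0 <= x] = `[0, +oo[%classic); last first.
  by apply/seteqP; split => x /=; rewrite in_itv/= ?andbT.
by rewrite integral0y_oneDsqr -EFinM; congr EFin; field.
Qed.

End poisson.

(** * Plancherel for real functions on the line *)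

Section cosine_sine_transforms.
Context {R : realType}.
Local Notation mu := (@lebesgue_measure R).

Definition fcos (g : R -> R) (y : R) := Rintegral mu setT (fun x => cos (y * x) * g x).
Definition fsin (g : R -> R) (y : R) := Rintegral mu setT (fun x => sin (y * x) * g x).

Lemma measurable_cos2 (y : R) : measurable_fun setT (fun x : R => cos (y * x)).
Proof. by under eq_fun do rewrite mulrC; exact: measurable_cosM. Qed.

Lemma measurable_sin2 (y : R) : measurable_fun setT (fun x : R => sin (y * x)).
Proof. by under eq_fun do rewrite mulrC; exact: measurable_sinM. Qed.

Lemma integrable_boundedM (c g : R -> R) : measurable_fun setT c ->
  (forall x, `|c x| <= 1) -> mu.-integrable setT (EFin \o g) ->
  mu.-integrable setT (EFin \o (fun x => c x * g x)).
Proof.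
move=> mc c1 ig; apply: le_integrable (ig) => //.
- apply/measurable_EFinP; apply: measurable_funM => //.
  by apply/measurable_EFinP; case/integrableP: ig.
- by move=> x _; rewrite /= lee_fin normrM ler_piMl.
Qed.

Lemma measurable_oscillatory_integral (c g : R -> R) : continuous c -> measurable_fun setT g ->
  measurable_fun setT (fun y : R => Rintegral mu setT (fun x : R => c (y * x) * g x)).
Proof.
move=> cc mg.
apply: (@measurable_Rintegral R _ _ (measurableTypeR R) (measurableTypeR R) mu
  (fun p => c (p.1 * p.2) * g p.2)).
apply: measurable_funM; last exact: (measurableT_comp mg measurable_snd).
apply: (measurableT_comp (f := c)); first exact: continuous_measurable_fun.
by apply: measurable_funM; [exact: measurable_fst|exact: measurable_snd].
Qed.

Lemma measurable_fcos (g : R -> R) : measurable_fun setT g -> measurable_fun setT (fcos g).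
Proof. exact: (measurable_oscillatory_integral (@continuous_cos R)). Qed.

Lemma measurable_fsin (g : R -> R) : measurable_fun setT g -> measurable_fun setT (fsin g).
Proof. exact: (measurable_oscillatory_integral (@continuous_sin R)). Qed.

End cosine_sine_transforms.

Section plancherel_real.
Context {R : realType}.
Local Notation mu := (@lebesgue_measure R).
Variable f : R -> R.
Hypothesis mf : measurable_fun setT f.
Hypothesis f1 : mu.-integrable setT (EFin \o f).
Hypothesis f2 : (sqint mu f < +oo)%E.

Let A (z : R) := Rintegral mu setT (fun x => f x * f (x - z)).
Let Q := fine (sqint mu f).

Let QE : sqint mu f = Q%:E.
Proof. by rewrite /Q fineK// ge0_fin_numE// sqint_ge0. Qed.

Let mfz (z : R) : measurable_fun setT (fun x : R => f (x - z)).
Proof. by apply: (measurableT_comp mf); exact: measurable_funB. Qed.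

Let sq_integrable (g : R -> R) : measurable_fun setT g -> (sqint mu g < +oo)%E ->
  mu.-integrable setT (EFin \o (fun x => g x ^+ 2)).
Proof.
move=> mg goo; apply/integrableP; split; first exact: (measurable_Esqr mg).
under eq_integral do rewrite /= ger0_norm ?sqr_ge0//.
exact: goo.
Qed.

Let diff_lty z : (sqint mu (fun x => (f (x - z) - f x)%R) <= (4 * Q)%:E)%E.
Proof.
have mNf : measurable_fun setT (fun x => - f x) by exact: measurableT_comp.
have := sqintD mu (mfz z) mNf; rewrite sqint_shift//.
rewrite (_ : sqint mu (fun x => - f x) = sqint mu f); last first.
  by apply: eq_integral => x _; rewrite sqrrN.
move/le_trans; apply; rewrite QE -!(EFinM, EFinD) lee_fin.
by rewrite -mulrDl -natrD.
Qed.

(** Polarization. It reduces the continuity of [A] at 0 to that of translations in $L^2$, and also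
    yields $|A|\le Q$. *)
Let AE z : A z = Q - fine (sqint mu (fun x => f (x - z) - f x)) / 2.
Proof.
have i1 := sq_integrable mf f2.
have i2 : mu.-integrable setT (EFin \o (fun x => f (x - z) ^+ 2)).
  by apply: sq_integrable => //; rewrite sqint_shift.
have i3 : mu.-integrable setT (EFin \o (fun x => (f (x - z) - f x) ^+ 2)).
  apply: sq_integrable; first exact: measurable_funB.
  by apply: le_lt_trans (diff_lty z) _; exact: ltry.
have QR : Rintegral mu setT (fun x => f x ^+ 2) = Q by [].
have QR2 : Rintegral mu setT (fun x => f (x - z) ^+ 2) = Q.
  by rewrite /Rintegral /Q -(sqint_shift z mf).
rewrite -[X in _ - X / _]/(Rintegral mu setT (fun x => (f (x - z) - f x) ^+ 2)).
rewrite /A (_ : (fun x => _) = (fun x =>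
  2^-1 * (f x ^+ 2 + f (x - z) ^+ 2 - (f (x - z) - f x) ^+ 2))); last first.
  by apply/funext => x; field.
have i12 : mu.-integrable setT (EFin \o (fun x => f x ^+ 2 + f (x - z) ^+ 2)).
  exact: (integrableD measurableT i1 i2).
have i123 : mu.-integrable setT (EFin \o
    (fun x => f x ^+ 2 + f (x - z) ^+ 2 - (f (x - z) - f x) ^+ 2)).
  exact: (integrableB measurableT i12 i3).
rewrite RintegralZl//.
rewrite (@RintegralB _ _ _ mu setT (fun x => f x ^+ 2 + f (x - z) ^+ 2)
  (fun x => (f (x - z) - f x) ^+ 2) measurableT i12 i3).
by rewrite RintegralD// QR QR2; field.
Qed.

Let A_le z : `|A z| <= Q.
Proof.
have := diff_lty z; have := sqint_ge0 mu (fun x => f (x - z) - f x).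
rewrite AE; case: (sqint _ _) => [r| |] //=; rewrite !lee_fin => r0 r4.
by rewrite ler_norml; apply/andP; split; lra.
Qed.

Let A_cvg (z : nat -> R) (B : R) : (forall n, `|z n| <= B) ->
  z n @[n --> \oo] --> (0 : R) -> A (z n) @[n --> \oo] --> Q.
Proof.
move=> zB z0; under eq_fun do rewrite AE.
suff h : fine (sqint mu (fun x => f (x - z n) - f x)) / 2 @[n --> \oo] --> (0 : R).
  have -> : nbhs Q = nbhs (Q - 0) by rewrite subr0.
  by apply: cvgB; [exact: cvg_cst|exact: h].
rewrite (_ : 0 = 0 / 2 :> R); last by rewrite mul0r.
apply: cvgM; last exact: cvg_cst.
have := translation_cvg mf f2 zB z0.
by move/fine_cvg.
Qed.

Local Notation RR := (measurableTypeR R * measurableTypeR R)%type.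

Let F (p : RR) := f p.1 * f (p.1 - p.2).

Let mF : measurable_fun setT F.
Proof.
apply: measurable_funM; first exact: (measurableT_comp mf measurable_fst).
by apply: (measurableT_comp mf); exact: measurable_funB.
Qed.

(** Reflecting the inner variable turns the double integral of $|F|$ into the square of the $L^1$
    norm of [f]. *)
Let iF : (mu \x mu)%E.-integrable setT (EFin \o F).
Proof.
apply/integrable12ltyP; first by apply/measurable_EFinP; exact: mF.
have [m1 foo] := integrableP _ _ _ f1.
have -> : (\int[mu]_x \int[mu]_y `|(EFin \o F) (x, y)| =
   \int[mu]_x (`|f x|%:E * \int[mu]_y `|f y|%:E))%E.
  apply: eq_integral => x _.
  have [_ i] := invariant_reflect x.
  rewrite -(i (fun y => `|f y|%:E)%E)//; last first.
    by apply/measurable_EFinP; exact: measurableT_comp.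
  rewrite -ge0_integralZl//.
  - by apply: eq_integral => y _; rewrite /= normrM EFinM.
  - apply/measurable_EFinP; apply: measurableT_comp => //.
    by apply: (measurableT_comp mf); exact: measurable_funB.
rewrite ge0_integralZr//.
- by rewrite lte_mul_pinfty// ?integral_ge0// ge0_fin_numE// integral_ge0.
- by apply/measurable_EFinP; exact: measurableT_comp.
- by apply: integral_ge0.
Qed.

(** Square integrability of [f] gives this for every [z], not just almost every one, so [A] is
    everywhere the inner integral of [F]. *)
Let iFz z : mu.-integrable setT (EFin \o (fun x => F (x, z))).
Proof.
have i1 := sq_integrable mf f2.
have i2 : mu.-integrable setT (EFin \o (fun x => f (x - z) ^+ 2)).
  by apply: sq_integrable => //; rewrite sqint_shift.
apply: le_integrable (integrableD measurableT i1 i2) => //.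
- apply/measurable_EFinP; exact: (measurable_funM mf (mfz z)).
- move=> x _; rewrite /= /F /= normrM lee_fin [X in _ <= X]ger0_norm ?addr_ge0 ?sqr_ge0//.
  rewrite -[f x ^+ 2]real_normK ?num_real// -[f (x - z) ^+ 2]real_normK ?num_real//.
  have := sqr_ge0 (`|f x| - `|f (x - z)|); have := normr_ge0 (f x).
  by have := normr_ge0 (f (x - z)); nra.
Qed.

Let iA : mu.-integrable setT (EFin \o A).
Proof.
have AG : EFin \o A = fubini_G mu (EFin \o F).
  apply/funext => z; rewrite /fubini_G /A /= fineK//.
  exact: (integrable_fin_num measurableT (iFz z)).
have mEF : measurable_fun setT (EFin \o F) by apply/measurable_EFinP; exact: mF.
have mG : measurable_fun setT (fubini_G mu (EFin \o F)) by exact: (measurable_fubini_G iF).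
apply/integrableP; rewrite AG; split; first exact: mG.
have h := (@integrable21ltyP _ _ _ _ _ mu mu _ mEF).1 iF; apply: le_lt_trans h.
apply: ge0_le_integral => //.
- exact: measurableT_comp.
- apply: (measurable_fun_fubini_tonelli_G (abse \o (EFin \o F))%E).
    exact: measurableT_comp.
  by move=> p; exact: abse_ge0.
- move=> z _; apply: le_abse_integral => //.
  by case/integrableP: (iFz z).
Qed.

(** The Wiener-Khinchin relation: write the square as a double integral of $\cos(y(x-t))f(x)f(t)$
    and substitute $z=x-t$. *)
Let power_spectrum y : fcos f y ^+ 2 + fsin f y ^+ 2 =
  Rintegral mu setT (fun z => cos (y * z) * A z).
Proof.
have icf := integrable_boundedM (measurable_cos2 y) (fun x => cos_max _) f1.
have isf := integrable_boundedM (measurable_sin2 y) (fun x => sin_max _) f1.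
transitivity (Rintegral mu setT (fun x => Rintegral mu setT (fun z =>
   cos (y * z) * F (x, z)))).
  transitivity (Rintegral mu setT (fun x => fcos f y * (cos (y * x) * f x) +
      fsin f y * (sin (y * x) * f x))).
    rewrite RintegralD//; last 2 first.
    - exact: (integrableZl measurableT _ icf).
    - exact: (integrableZl measurableT _ isf).
    by rewrite !RintegralZl.
  apply: eq_Rintegral => x _.
  have mc := measurable_cos2 y; have ms := measurable_sin2 y.
  have mk : measurable_fun setT (fun x0 : R => f x * (cos (y * (x - x0)) * f x0)).
    apply: measurable_funM => //; apply: measurable_funM => //.
    rewrite (_ : (fun _ => _) = (fun t =>
      cos (y * x) * cos (y * t) + sin (y * x) * sin (y * t))).
      by apply: measurable_funD; exact: measurable_funM.
    by apply/funext => t; rewrite mulrBr cosB.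
  have := invariant_Rintegral (invariant_reflect x) mk.
  rewrite (_ : (fun _ => _) = (fun z => cos (y * z) * F (x, z))); last first.
    by apply/funext => z; rewrite /F /= subKr; ring.
  move=> ->.
  rewrite (_ : (fun _ => _) = (fun t => (f x * cos (y * x)) * (cos (y * t) * f t) +
     (f x * sin (y * x)) * (sin (y * t) * f t))); last first.
    by apply/funext => t; rewrite mulrBr cosB; ring.
  rewrite RintegralD//; last 2 first.
  - exact: (integrableZl measurableT _ icf).
  - exact: (integrableZl measurableT _ isf).
  by rewrite !RintegralZl// -/(fcos f y) -/(fsin f y); ring.
have icF : (mu \x mu)%E.-integrable setT (EFin \o (fun p : RR => cos (y * p.2) * F p)).
  apply: le_integrable (iF) => //.
  - apply/measurable_EFinP; apply: measurable_funM; last exact: mF.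
    exact: (measurableT_comp (measurable_cos2 y) measurable_snd).
  - by move=> x _; rewrite /= lee_fin normrM ler_piMl// cos_max.
rewrite (@Rintegral_swap _ _ _ _ _ _ _ (fun p : RR => cos (y * p.2) * F p) icF).
apply: eq_Rintegral => z _ /=.
by rewrite RintegralZl.
Qed.

Let w (e y : R) := expR (- (e * `|y|)).

(** This is the purpose of the weight: without it the double integral of $\cos(yz)A(z)$ is in
    general not absolutely convergent, and the order of integration could not be exchanged. *)
Let iwA e : 0 < e -> (mu \x mu)%E.-integrable setT
  (EFin \o (fun p : RR => w e p.1 * (cos (p.1 * p.2) * A p.2))).
Proof.
move=> e0; have [mA Aoo] := integrableP _ _ _ iA.
have mA' : measurable_fun setT A by exact/measurable_EFinP.
have mwA : measurable_fun setT
    (fun p : RR => w e p.1 * (cos (p.1 * p.2) * A p.2)).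
  apply: measurable_funM.
    exact: (measurableT_comp (measurable_expR_abs e) measurable_fst).
  apply: measurable_funM; last exact: (measurableT_comp mA' measurable_snd).
  apply: (measurableT_comp (f := @cos R)).
    by apply: continuous_measurable_fun; exact: continuous_cos.
  by apply: measurable_funM; [exact: measurable_fst|exact: measurable_snd].
apply/integrable12ltyP; first exact/measurable_EFinP.
apply: (@le_lt_trans _ _ (\int[mu]_x ((w e x)%:E * \int[mu]_y `|(EFin \o A) y|))%E).
  apply: ge0_le_integral => //.
  - by move=> x _; exact: integral_ge0.
  - apply: (@measurable_fun_fubini_tonelli_F _ _ _ _ _ mu (abse \o (EFin \o (fun p : RR =>
    (w e p.1 * (cos (p.1 * p.2) * A p.2))%R)))%E) => //.
      by apply: measurableT_comp => //; exact/measurable_EFinP.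
    by move=> p; exact: abse_ge0.
  - apply: emeasurable_funM; last exact: measurable_cst.
    by apply/measurable_EFinP; exact: measurable_expR_abs.
  move=> x _; rewrite -ge0_integralZl//; last 2 first.
  - exact: measurableT_comp.
  - by rewrite lee_fin expR_ge0.
  apply: ge0_le_integral => //.
  - apply: measurableT_comp => //; apply/measurable_EFinP.
    exact: (measurableT_comp mwA (measurable_fun_pair _ _)).
  - by apply: measurable_funeM; exact: measurableT_comp.
  move=> y _; rewrite /= normrM ger0_norm ?expR_ge0// EFinM lee_pmul2l//.
    by rewrite lee_fin normrM ler_piMl// cos_max.
  by rewrite lte_fin expR_gt0.
rewrite ge0_integralZr//.
- rewrite integral_expR_abs// lte_mul_pinfty//.
  by rewrite lee_fin divr_ge0// ltW.
- by apply/measurable_EFinP; exact: measurable_expR_abs.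
- by move=> x _; rewrite lee_fin expR_ge0.
- exact: integral_ge0.
Qed.

Let mA : measurable_fun setT A.
Proof. by case/integrableP: iA => /measurable_EFinP. Qed.

Let mH e : measurable_fun setT (fun x : R => A (e * x) * (2 * (oneDsqr x)^-1)).
Proof.
apply: measurable_funM.
  by apply: (measurableT_comp mA); exact: measurable_funM.
apply: measurable_funM => //.
by apply: continuous_measurable_fun; exact: continuous_oneDsqrV.
Qed.

Let iV : mu.-integrable setT (fun x => (Q * (2 * (oneDsqr x)^-1))%:E).
Proof.
have mV : measurable_fun setT (fun x : R => (oneDsqr x)^-1).
  by apply: continuous_measurable_fun; exact: continuous_oneDsqrV.
rewrite (_ : (fun _ => _) = (fun x => (Q * 2)%:E * ((oneDsqr x)^-1)%:E)%E).
  apply: integrableZl => //; apply/integrableP; split.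
    exact/measurable_EFinP.
  under eq_integral do rewrite gee0_abs ?lee_fin ?invr_ge0 ?addr_ge0 ?sqr_ge0//.
  by rewrite integral_oneDsqrT ltry.
by apply/funext => x; rewrite -EFinM mulrA.
Qed.

Let H_le e x : `|A (e * x) * (2 * (oneDsqr x)^-1)| <= Q * (2 * (oneDsqr x)^-1).
Proof.
have v0 : 0 <= 2 * (oneDsqr x)^-1 by rewrite mulr_ge0// invr_ge0 addr_ge0 ?sqr_ge0.
by rewrite normrM [X in _ * X]ger0_norm// ler_wpM2r.
Qed.

Let iH e : mu.-integrable setT (fun x => (A (e * x) * (2 * (oneDsqr x)^-1))%:E).
Proof.
apply: le_integrable (iV) => //; first by apply/measurable_EFinP; exact: mH.
by move=> x _; rewrite /= lee_fin (le_trans (H_le _ _))// ler_norm.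
Qed.

(* Abel summation: the transform of the weight [exp (- e |y|)] is the Poisson
   kernel, integrated here against the autocorrelation [A] of [f]. *)
Let weighted_energy e : 0 < e ->
  (\int[mu]_y (w e y * (fcos f y ^+ 2 + fsin f y ^+ 2))%:E =
  \int[mu]_x (A (e * x) * (2 * (oneDsqr x)^-1))%:E)%E.
Proof.
move=> e0.
have iw1 := iwA e0.
have ix y : mu.-integrable setT (EFin \o (fun z => w e y * (cos (y * z) * A z))).
  have := integrable_boundedM (measurable_cos2 y) (fun x => cos_max _) iA.
  by move=> /(integrableZl measurableT (w e y)).
have iz z : mu.-integrable setT (EFin \o (fun y => w e y * (cos (y * z) * A z))).
  have := integrable_expR_cos z e0 => /(integrableZl measurableT (A z)).
  apply: eq_integrable => // y _ /=; rewrite -EFinM; congr EFin.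
  by rewrite /w; ring.
transitivity (\int[mu]_y \int[mu]_z (w e y * (cos (y * z) * A z))%:E)%E.
  apply: eq_integral => y _; rewrite power_spectrum.
  rewrite -RintegralZl//; last first.
    exact: (integrable_boundedM (measurable_cos2 y) (fun x => cos_max _) iA).
  by rewrite /Rintegral fineK//; exact: (integrable_fin_num measurableT (ix y)).
rewrite (Fubini iw1) /=.
have mA' : measurable_fun setT A.
  by case/integrableP: iA => /measurable_EFinP.
transitivity (\int[mu]_z (A z * (2 * e / (e ^+ 2 + z ^+ 2)))%:E)%E.
  apply: eq_integral => z _; rewrite -(Rintegral_poisson z e0).
  rewrite -RintegralZl//; last exact: integrable_expR_cos.
  rewrite /Rintegral fineK.
    by apply: eq_integral => y _; congr EFin; rewrite /w; ring.
  apply: (integrable_fin_num measurableT).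
  exact: (integrableZl measurableT (A z) (integrable_expR_cos z e0)).
have me : measurable_fun setT (fun z : R => A z * (2 * e / (e ^+ 2 + z ^+ 2))).
  apply: measurable_funM => //; apply: measurable_funM => //.
  apply: continuous_measurable_fun => x; apply: cvgV.
    by rewrite gt_eqF// ltr_pwDl ?exprn_gt0 ?sqr_ge0.
  by apply: cvgD; [exact: cvg_cst|exact: exprn_continuous].
rewrite -(integral_dilate e0); last exact/measurable_EFinP.
have -> : (\int[mu]_x (A (e * x) * (2 * e / (e ^+ 2 + (e * x) ^+ 2)))%:E =
  \int[mu]_x ((e^-1)%:E * (A (e * x) * (2 * (oneDsqr x)^-1))%:E))%E.
  apply: eq_integral => x _; rewrite -EFinM; congr EFin.
  have x0 : 1 + x ^+ 2 != 0 by rewrite gt_eqF// ltr_pwDl ?sqr_ge0.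
  rewrite /oneDsqr exprMn -[X in X + _ * _]mulr1 -mulrDr; field.
  by rewrite x0 gt_eqF.
rewrite integralZl// muleA -EFinM mulfV ?mul1e//.
by rewrite gt_eqF.
Qed.

Let eps (n : nat) : R := n.+1%:R^-1.

Let eps_gt0 n : 0 < eps n. Proof. by rewrite invr_gt0. Qed.

Let eps_cvg0 : eps n @[n --> \oo] --> (0 : R).
Proof. exact: cvg_harmonic. Qed.

Let m2 : measurable_fun setT (fun y => fcos f y ^+ 2 + fsin f y ^+ 2).
Proof.
by apply: measurable_funD; apply: measurable_funX;
  [exact: measurable_fcos|exact: measurable_fsin].
Qed.

(** Let $e\to0$ in [weighted_energy]. The left side converges monotonically, so its finiteness need
    not be known beforehand; the right side converges by domination, as [A] is bounded by [Q] and
    $A(ex)\to Q$. *)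
Lemma plancherel_real : (\int[mu]_y (fcos f y ^+ 2 + fsin f y ^+ 2)%:E =
  (2 * pi)%:E * sqint mu f)%E.
Proof.
have V0 x : 0 <= (oneDsqr x)^-1 :> R by rewrite invr_ge0 addr_ge0 ?sqr_ge0.
have p0 y : 0 <= fcos f y ^+ 2 + fsin f y ^+ 2 by rewrite addr_ge0 ?sqr_ge0.
have lim1 : (\int[mu]_y (w (eps n) y * (fcos f y ^+ 2 + fsin f y ^+ 2))%:E
    @[n --> \oo] --> \int[mu]_y (fcos f y ^+ 2 + fsin f y ^+ 2)%:E)%E.
  have := @cvg_monotone_convergence _ _ _ mu setT measurableT
    (fun n y => (w (eps n) y * (fcos f y ^+ 2 + fsin f y ^+ 2))%:E).
  have -> : (\int[mu]_y (fcos f y ^+ 2 + fsin f y ^+ 2)%:E = \int[mu]_y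
      limn (fun n => (w (eps n) y * (fcos f y ^+ 2 + fsin f y ^+ 2))%:E))%E.
    apply: eq_integral => y _; apply/esym/cvg_lim => //; apply: cvg_EFin; first by near=> n.
    have -> : nbhs (fcos f y ^+ 2 + fsin f y ^+ 2) =
      nbhs (expR 0 * (fcos f y ^+ 2 + fsin f y ^+ 2)) by rewrite expR0 mul1r.
     apply: cvgM; last exact: cvg_cst.
    have h : - (eps n * `|y|) @[n --> \oo] --> (0 : R).
      rewrite -oppr0 -(mul0r `|y|); apply: cvgN.
      by apply: cvgM; [exact: eps_cvg0|exact: cvg_cst].
    exact: (cvg_comp _ _ h (@continuous_expR R 0)).
  apply.
  - move=> n; apply/measurable_EFinP; apply: measurable_funM => //.
    exact: measurable_expR_abs.
  - by move=> n y _; rewrite lee_fin mulr_ge0 ?expR_ge0.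
  - move=> y _ n k nk; rewrite lee_fin ler_wpM2r// ler_expR lerN2 ler_wpM2r//.
    by rewrite lef_pV2 ?posrE// ler_nat.
have [] := @dominated_convergence _ _ _ mu setT measurableT
  (fun n x => (A (eps n * x) * (2 * (oneDsqr x)^-1))%:E)
  (fun x => (Q * (2 * (oneDsqr x)^-1))%:E) (fun x => (Q * (2 * (oneDsqr x)^-1))%:E).
- by move=> n; apply/measurable_EFinP; exact: mH.
- by case/integrableP: iV.
- apply: aeW => x _; apply: cvg_EFin; first by near=> n.
  apply: cvgM; last exact: cvg_cst.
  apply: (@A_cvg _ `|x|).
    move=> n; rewrite normrM ger0_norm ?(ltW (eps_gt0 n))// ler_piMl// invf_le1//.
    by rewrite ler1n.
  by rewrite -(mul0r x); apply: cvgM; [exact: eps_cvg0|exact: cvg_cst].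
- exact: iV.
- by apply: aeW => x n _; rewrite /= lee_fin.
move=> _ _ lim2.
have -> : ((2 * pi)%:E * sqint mu f = \int[mu]_x (Q * (2 * (oneDsqr x)^-1))%:E)%E.
  transitivity (\int[mu]_x ((Q * 2)%:E * ((oneDsqr x)^-1)%:E))%E.
    rewrite ge0_integralZl//.
    - by rewrite integral_oneDsqrT QE -!EFinM; congr EFin; ring.
    - apply/measurable_EFinP.
      by apply: continuous_measurable_fun; exact: continuous_oneDsqrV.
    - by rewrite lee_fin mulr_ge0// fine_ge0// sqint_ge0.
  by apply: eq_integral => x _; rewrite -EFinM mulrA.
apply: cvg_unique lim1 _ => //=.
by under eq_fun do rewrite weighted_energy//.
Unshelve. all: by end_near. Qed.

End plancherel_real.

(** * Plancherel for complex functions and for products *)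

Section plancherel_def.
Context {R : realType} {d} {T : measurableType d}.
Variable m : {measure set T -> \bar R}.
Local Open Scope ereal_scope.

Definition itrans (e : T -> T -> R[i]) (u : T -> R[i]) (y : T) : R[i] :=
  cint m (fun x => (e y x * u x)%R).

(** Stated for an arbitrary unimodular kernel, so that it passes to product kernels and spacetime is
    reached one coordinate at a time. *)
Definition plancherel_for (e : T -> T -> R[i]) (K : R) : Prop :=
  [/\ cmeas (fun p : T * T => e p.1 p.2), forall y x, csq (e y x) = 1%R,
    (0 < K)%R &
    forall u : T -> R[i], cmeas u -> mass m u < +oo -> energy m u < +oo ->
      cmeas (itrans e u) /\ energy m (itrans e u) = K%:E * energy m u].

Lemma ae_eq_cint (u v : T -> R[i]) : cmeas u -> cmeas v ->
  {ae m, forall x, u x = v x} -> cint m u = cint m v.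
Proof.
move=> [u1 u2] [v1 v2] uv; rewrite /cint /Rintegral.
congr (fine _ +i* fine _)%C.
- apply: ae_eq_integral => //; [exact/measurable_EFinP|exact/measurable_EFinP|].
  by apply: filterS uv => x /= -> _.
- apply: ae_eq_integral => //; [exact/measurable_EFinP|exact/measurable_EFinP|].
  by apply: filterS uv => x /= -> _.
Qed.

Lemma ae_lty (f : T -> \bar R) : measurable_fun setT f -> (forall x, 0 <= f x) ->
  \int[m]_x f x < +oo -> {ae m, forall x, f x < +oo}.
Proof.
move=> mf f0 foo; have : m.-integrable setT f.
  apply/integrableP; split => //.
  by under eq_integral do rewrite gee0_abs//.
move=> /(integrable_ae measurableT); apply: filterS => x /= /(_ I).
by rewrite ge0_fin_numE.
Qed.

Lemma normc_unit (e : R[i]) z : csq e = 1%R -> Normc.normc (e * z)%R = Normc.normc z.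
Proof. by move=> e1; rewrite !normcE2 csqM e1 mul1r. Qed.

Lemma mass_unit (e u : T -> R[i]) : (forall x, csq (e x) = 1%R) ->
  mass m (fun x => (e x * u x)%R) = mass m u.
Proof. by move=> e1; apply: eq_integral => x _; rewrite normc_unit. Qed.

Lemma energy_unit (e u : T -> R[i]) : (forall x, csq (e x) = 1%R) ->
  energy m (fun x => (e x * u x)%R) = energy m u.
Proof. by move=> e1; apply: eq_integral => x _; rewrite csqM e1 mul1r. Qed.

End plancherel_def.

Section plancherel_line.
Context {R : realType}.
Local Notation mu := (@lebesgue_measure R).
Local Open Scope ereal_scope.

Lemma fcosN (g : R -> R) y : fcos g (- y)%R = fcos g y.
Proof. by apply: eq_Rintegral => x _; rewrite mulNr cosN. Qed.

Lemma fsinN (g : R -> R) y : mu.-integrable setT (EFin \o g) ->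
  fsin g (- y)%R = (- fsin g y)%R.
Proof.
move=> ig; rewrite /fsin -[RHS]mulN1r -RintegralZl//.
  by apply: eq_Rintegral => x _; rewrite mulNr sinN mulN1r mulNr.
by apply: integrable_boundedM (ig); [exact: measurable_sin2|move=> x; exact: sin_max].
Qed.

Lemma energy_ReIm d (T : measurableType d) (m : {measure set T -> \bar R})
    (u : T -> R[i]) : cmeas u ->
  energy m u = sqint m (fun x => complex.Re (u x)) + sqint m (fun x => complex.Im (u x)).
Proof.
move=> [u1 u2]; rewrite /energy /sqint -ge0_integralD//.
- by move=> x _; rewrite lee_fin sqr_ge0.
- exact: measurable_Esqr.
- by move=> x _; rewrite lee_fin sqr_ge0.
- exact: measurable_Esqr.
Qed.

Definition line_kernel (y x : measurableTypeR R) : R[i] := cis (- (y * x))%R.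

Lemma plancherel_line : plancherel_for mu line_kernel (2 * pi)%R.
Proof.
split.
- apply: cmeas_cis; apply: measurableT_comp => //.
  by apply: measurable_funM; [exact: measurable_fst|exact: measurable_snd].
- by move=> y x; exact: csq_cis.
- by rewrite mulr_gt0// pi_gt0.
move=> u mu_ uoo eoo; have [u1 u2] := mu_.
pose g x := complex.Re (u x); pose h x := complex.Im (u x).
have [ig ih] := mass_integrable mu_ uoo.
move: (eoo); rewrite energy_ReIm// => ghoo.
have goo : sqint mu g < +oo.
  by apply: le_lt_trans ghoo; rewrite leeDl// sqint_ge0.
have hoo : sqint mu h < +oo.
  by apply: le_lt_trans ghoo; rewrite leeDr// sqint_ge0.
have tE y : itrans mu line_kernel u y =
    ((fcos g y + fsin h y)%R +i* (fcos h y - fsin g y)%R)%C.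
  rewrite /itrans /cint; congr (_ +i* _)%C.
  - rewrite /fcos /fsin -RintegralD//; last 2 first.
    + by apply: integrable_boundedM => //; [exact: measurable_cos2|move=> x; exact: cos_max].
    + by apply: integrable_boundedM => //; [exact: measurable_sin2|move=> x; exact: sin_max].
    apply: eq_Rintegral => x _; rewrite ReM /= cosN sinN /g /h.
    by rewrite mulNr opprK.
  - rewrite /fcos /fsin -RintegralB//; last 2 first.
    + by apply: integrable_boundedM => //; [exact: measurable_cos2|move=> x; exact: cos_max].
    + by apply: integrable_boundedM => //; [exact: measurable_sin2|move=> x; exact: sin_max].
    apply: eq_Rintegral => x _; rewrite ImM /= cosN sinN /g /h.
    by rewrite mulNr.
have mg : measurable_fun setT g by exact: u1.
have mh : measurable_fun setT h by exact: u2.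
have mt : cmeas (itrans mu line_kernel u).
  split; under eq_fun do rewrite tE /=.
  - by apply: measurable_funD; [exact: measurable_fcos|exact: measurable_fsin].
  - by apply: measurable_funB; [exact: measurable_fcos|exact: measurable_fsin].
split => //.
have [mN iN] := @invariant_opp R.
set X := energy _ _.
(* The cross terms between the real part [g] and the imaginary part [h] are odd in $y$. Adding the
   value at $-y$ cancels them pointwise, at the cost of a factor 2. *)
have XX : 2%:E * X = 2%:E * ((2 * pi)%:E * sqint mu g + (2 * pi)%:E * sqint mu h).
  transitivity (\int[mu]_y ((csq (itrans mu line_kernel u y))%:E +
      (csq (itrans mu line_kernel u (- y)%R))%:E)).
    rewrite ge0_integralD//.
    - rewrite (iN (fun y => (csq (itrans mu line_kernel u y))%:E)).
      + by rewrite -/X (_ : 2%:E = 1 + 1)// ge0_muleDl// mul1e.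
      + exact: measurable_Ecsq.
      + by move=> x; rewrite lee_fin csq_ge0.
    - by move=> x _; rewrite lee_fin csq_ge0.
    - exact: measurable_Ecsq.
    - by move=> x _; rewrite lee_fin csq_ge0.
    - exact: (measurableT_comp (measurable_Ecsq mt) mN).
  rewrite -plancherel_real// -plancherel_real//.
  have mE (k : R -> R) : measurable_fun setT k ->
      measurable_fun setT (fun y => (fcos k y ^+ 2 + fsin k y ^+ 2)%:E).
    move=> mk; apply/measurable_EFinP; apply: measurable_funD; apply: measurable_funX.
      exact: measurable_fcos.
    exact: measurable_fsin.
  have E0 (k : R -> R) y : 0 <= (fcos k y ^+ 2 + fsin k y ^+ 2)%:E :> \bar R.
    by rewrite lee_fin addr_ge0 ?sqr_ge0.
  rewrite -ge0_integralD//; [|exact: mE|exact: mE].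
  rewrite -ge0_integralZl//; last 2 first.
  - by apply: emeasurable_funD; exact: mE.
  - by move=> y _; rewrite adde_ge0.
  apply: eq_integral => y _; rewrite !tE /csq /= !fcosN !fsinN//.
  by rewrite -!(EFinD, EFinM); congr EFin; ring.
have half (a b : \bar R) : 2%:E * a = 2%:E * b -> a = b.
  have h1 c : (2^-1)%:E * (2%:E * c) = c :> \bar R.
    by rewrite muleA -EFinM mulVf ?mul1e// pnatr_eq0.
  by move=> ab; rewrite -(h1 a) ab h1.
rewrite (half _ _ XX); apply/esym; apply: ge0_muleDr; exact: sqint_ge0.
Qed.

End plancherel_line.

Section product_sigma_finite_measure.
Context {R : realType} {d1 d2} {T1 : measurableType d1} {T2 : measurableType d2}.
Variable m1 : {sigma_finite_measure set T1 -> \bar R}.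
Variable m2 : {sigma_finite_measure set T2 -> \bar R}.

(** The product gets a name of its own so that a sigma-finite structure can be attached to it. *)
Definition pmeas : set (T1 * T2) -> \bar R := (m1 \x m2)%E.
HB.instance Definition _ := Measure.on pmeas.
HB.instance Definition _ := Measure_isSigmaFinite.Build _ _ _ pmeas
  (product_sigma_finite m1 m2).

End product_sigma_finite_measure.

Section plancherel_product.
Context {R : realType} {d1 d2} {T1 : measurableType d1} {T2 : measurableType d2}.
Variable m1 : {sigma_finite_measure set T1 -> \bar R}.
Variable m2 : {sigma_finite_measure set T2 -> \bar R}.
Variables (e1 : T1 -> T1 -> R[i]) (e2 : T2 -> T2 -> R[i]) (K1 K2 : R).
Local Open Scope ereal_scope.

Definition prod_kernel (y x : T1 * T2) : R[i] := (e1 y.1 x.1 * e2 y.2 x.2)%R.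

Lemma energy_prod1 (F : T1 * T2 -> R[i]) : cmeas F ->
  energy (m1 \x m2) F = \int[m1]_x energy m2 (fun y => F (x, y)).
Proof.
move=> mF; rewrite /energy (fubini_tonelli1 (fun z => (csq (F z))%:E))//.
- exact: measurable_Ecsq.
- by move=> x; rewrite lee_fin csq_ge0.
Qed.

Lemma energy_prod2 (F : T1 * T2 -> R[i]) : cmeas F ->
  energy (m1 \x m2) F = \int[m2]_y energy m1 (fun x => F (x, y)).
Proof.
move=> mF; rewrite /energy (fubini_tonelli2 (fun z => (csq (F z))%:E))//.
- exact: measurable_Ecsq.
- by move=> x; rewrite lee_fin csq_ge0.
Qed.

Lemma mass_prod1 (F : T1 * T2 -> R[i]) : cmeas F ->
  mass (m1 \x m2) F = \int[m1]_x mass m2 (fun y => F (x, y)).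
Proof.
move=> mF; rewrite /mass (fubini_tonelli1 (fun z => (Normc.normc (F z))%:E))//.
- exact: measurable_Enormc.
- by move=> x; rewrite lee_fin normc_ge0.
Qed.

Lemma measurable_energy1 (F : T1 * T2 -> R[i]) : cmeas F ->
  measurable_fun setT (fun x => energy m2 (fun y => F (x, y))).
Proof.
move=> mF; apply: (measurable_fun_fubini_tonelli_F (fun z => (csq (F z))%:E)).
- exact: measurable_Ecsq.
- by move=> x; rewrite lee_fin csq_ge0.
Qed.

Lemma measurable_energy2 (F : T1 * T2 -> R[i]) : cmeas F ->
  measurable_fun setT (fun y => energy m1 (fun x => F (x, y))).
Proof.
move=> mF; apply: (measurable_fun_fubini_tonelli_G (fun z => (csq (F z))%:E)).
- exact: measurable_Ecsq.
- by move=> x; rewrite lee_fin csq_ge0.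
Qed.

Lemma measurable_mass1 (F : T1 * T2 -> R[i]) : cmeas F ->
  measurable_fun setT (fun x => mass m2 (fun y => F (x, y))).
Proof.
move=> mF; apply: (measurable_fun_fubini_tonelli_F (fun z => (Normc.normc (F z))%:E)).
- exact: measurable_Enormc.
- by move=> x; rewrite lee_fin normc_ge0.
Qed.

(** Transform the second variable, then the first. The partial transform [G] multiplies the energy
    of almost every fibre by [K2]; then almost every slice of [G] in the first variable has finite
    energy, and [K1] comes in. *)
Lemma plancherel_prod : plancherel_for m1 e1 K1 -> plancherel_for m2 e2 K2 ->
  plancherel_for (pmeas m1 m2) prod_kernel (K1 * K2).
Proof.
move=> [me1 e1u K10 P1] [me2 e2u K20 P2].
have mK : cmeas (fun p : (T1 * T2) * (T1 * T2) => prod_kernel p.1 p.2).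
  have m1' : measurable_fun setT (fun p : (T1 * T2) * (T1 * T2) => (p.1.1, p.2.1)).
    by apply: measurable_fun_pair; apply: measurableT_comp.
  have m2' : measurable_fun setT (fun p : (T1 * T2) * (T1 * T2) => (p.1.2, p.2.2)).
    by apply: measurable_fun_pair; apply: measurableT_comp.
  apply: cmeasM.
  - exact: (cmeas_comp me1 m1').
  - exact: (cmeas_comp me2 m2').
have Ku y x : csq (prod_kernel y x) = 1%R by rewrite csqM e1u e2u mulr1.
split => //; first by rewrite mulr_gt0.
move=> u mu_ uoo eoo.
have mF : cmeas (itrans (pmeas m1 m2) prod_kernel u).
  apply: (@cmeas_cint _ _ _ _ _ (pmeas m1 m2) (fun p => prod_kernel p.1 p.2 * u p.2)%R).
  by apply: cmeasM => //; exact: (cmeas_comp mu_ measurable_snd).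
pose G (p : T1 * T2) := itrans m2 e2 (fun x2 => u (p.1, x2)) p.2.
have mG : cmeas G.
  apply: (@cmeas_cint _ _ _ (T1 * T2)%type T2 m2
    (fun q => e2 q.1.2 q.2 * u (q.1.1, q.2))%R).
  apply: cmeasM.
  - apply: (@cmeas_comp _ _ _ _ _ _ (fun q : (T1 * T2) * T2 => (q.1.2, q.2)) me2).
    by apply: measurable_fun_pair => //; exact: measurableT_comp.
  - apply: (@cmeas_comp _ _ _ _ _ _ (fun q : (T1 * T2) * T2 => (q.1.1, q.2)) mu_).
    by apply: measurable_fun_pair => //; exact: measurableT_comp.
have mu1 x1 : cmeas (fun x2 => u (x1, x2)).
  by apply: (cmeas_comp mu_); exact: measurable_fun_pair.
have mG2 y2 : cmeas (fun x1 => G (x1, y2)).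
  by apply: (cmeas_comp mG); exact: measurable_fun_pair.
have me1y y1 : cmeas (fun x1 => e1 y1 x1).
  by apply: (cmeas_comp me1 (f := fun x => (y1, x))); exact: measurable_fun_pair.
have me2y y2 : cmeas (fun x2 => e2 y2 x2).
  by apply: (cmeas_comp me2 (f := fun x => (y2, x))); exact: measurable_fun_pair.
have fin_mass : {ae m1, forall x1, mass m2 (fun x2 => u (x1, x2)) < +oo}.
  apply: ae_lty.
  - exact: measurable_mass1.
  - by move=> x; exact: mass_ge0.
  - by rewrite -mass_prod1.
have fin_energy : {ae m1, forall x1, energy m2 (fun x2 => u (x1, x2)) < +oo}.
  apply: ae_lty.
  - exact: measurable_energy1.
  - by move=> x; exact: energy_ge0.
  - by rewrite -energy_prod1.
split => //.
have FE y : itrans (pmeas m1 m2) prod_kernel u y =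
    itrans m1 e1 (fun x1 => G (x1, y.2)) y.1.
  have mku : cmeas (fun x => prod_kernel y x * u x)%R.
    apply: cmeasM => //.
    apply: (@cmeas_comp _ _ _ _ _ _ (fun x => (y, x)) mK).
    exact: measurable_fun_pair.
  rewrite /itrans (_ : cint (pmeas m1 m2) _ = cint (m1 \x m2)
     (fun x => prod_kernel y x * u x)%R)//.
  rewrite cint_prod//; last by rewrite mass_unit.
  apply: ae_eq_cint.
  - exact: (@cmeas_cint _ _ _ _ _ m2 (fun x => prod_kernel y x * u x)%R mku).
  - by apply: cmeasM.
  apply: filterS fin_mass => x1 x1oo /=.
  rewrite /G /itrans /= -cintZ.
  - by congr cint; apply/funext => x2; rewrite mulrA.
  - exact: cmeasM.
  - by rewrite mass_unit.
have EG : energy (m1 \x m2) G = K2%:E * energy (m1 \x m2) u.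
  rewrite energy_prod1//.
  transitivity (\int[m1]_x (K2%:E * energy m2 (fun x2 => u (x, x2)))).
    apply: ge0_ae_eq_integral => //.
    - exact: measurable_energy1.
    - by apply: measurable_funeM; exact: measurable_energy1.
    - by move=> x _; exact: energy_ge0.
    - by move=> x _; rewrite mule_ge0 ?energy_ge0// lee_fin ltW.
    - apply: filterS2 fin_mass fin_energy => x1 h1 h2 _ /=.
      by rewrite /G /= (P2 _ (mu1 x1) h1 h2).2.
  rewrite ge0_integralZl//.
  - by rewrite energy_prod1.
  - exact: measurable_energy1.
  - by move=> x _; exact: energy_ge0.
  - by rewrite lee_fin ltW.
(* True for every [y2]: $|G|$ is at most twice the mass of the fibre, whatever the frequency. *)
have mass_G y2 : mass m1 (fun x1 => G (x1, y2)) < +oo.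
  apply: (@le_lt_trans _ _ (2%:E * mass (m1 \x m2) u)); last first.
    rewrite lte_mul_pinfty//.
  rewrite mass_prod1// -ge0_integralZl//; last 2 first.
  - exact: measurable_mass1.
  - by move=> x _; exact: mass_ge0.
  apply: ge0_le_integral => //.
  - by move=> x _; rewrite lee_fin normc_ge0.
  - exact: measurable_Enormc.
  - by apply: measurable_funeM; exact: measurable_mass1.
  move=> x _; apply: le_trans (normc_cint _ _) _; first exact: cmeasM.
  by rewrite mass_unit.
have energy_G : {ae m2, forall y2, energy m1 (fun x1 => G (x1, y2)) < +oo}.
  apply: ae_lty.
  - exact: measurable_energy2.
  - by move=> y; exact: energy_ge0.
  - rewrite -energy_prod2// EG lte_mul_pinfty ?lee_fin ?ltW//.
rewrite (_ : energy (pmeas m1 m2) _ = energy (m1 \x m2)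
    (itrans (pmeas m1 m2) prod_kernel u))// energy_prod2//.
transitivity (\int[m2]_y (K1%:E * energy m1 (fun x1 => G (x1, y)))).
  apply: ge0_ae_eq_integral => //.
  - exact: measurable_energy2.
  - by apply: measurable_funeM; exact: measurable_energy2.
  - by move=> x _; exact: energy_ge0.
  - by move=> x _; rewrite mule_ge0 ?energy_ge0// lee_fin ltW.
  - apply: filterS energy_G => y2 h1 _ /=.
    under eq_fun do rewrite FE /=.
    exact: (P1 _ (mG2 y2) (mass_G y2) h1).2.
rewrite ge0_integralZl//.
- by rewrite -energy_prod2// EG muleA -EFinM.
- exact: measurable_energy2.
- by move=> x _; exact: energy_ge0.
- by rewrite lee_fin ltW.
Qed.

End plancherel_product.

Section plancherel_spacetime.
Context {R : realType}.
Local Open Scope ereal_scope.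

(** Passes from [pmeas] to [leb2], [leb3] and [leb13], the same set functions under different
    measure structures. *)
Lemma plancherel_eq_measure d (T : measurableType d)
    (m m' : {measure set T -> \bar R}) e K :
  (forall A, measurable A -> m A = m' A) ->
  plancherel_for m e K -> plancherel_for m' e K.
Proof.
move=> mm' [me eu K0 P].
have I f : \int[m']_x f x = \int[m]_x f x.
  by apply: eq_measure_integral => A mA _; rewrite mm'.
have E u : energy m' u = energy m u by exact: I.
have M u : mass m' u = mass m u by exact: I.
have tE u : itrans m' e u = itrans m e u.
  by apply/funext => y; rewrite /itrans /cint /Rintegral !I.
by split => // u mu_; rewrite M !E tE; exact: P.
Qed.

(** The constant obtained is $(2\pi)^4$. *)
Lemma plancherel_spacetime : exists2 K : R, (0 < K)%R &
  forall u : spacetime R -> R[i], cmeas u -> mass leb13 u < +oo ->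
    energy leb13 u < +oo ->
    cmeas (fourier1 u) /\ energy leb13 (fourier1 u) = K%:E * energy leb13 u.
Proof.
have P := @plancherel_line R.
have P2 : plancherel_for (@leb2 R) (prod_kernel line_kernel line_kernel)
    (2 * pi * (2 * pi)) by exact: plancherel_eq_measure (plancherel_prod P P).
have P3 : plancherel_for (@leb3 R)
    (prod_kernel (prod_kernel line_kernel line_kernel) line_kernel)
    (2 * pi * (2 * pi) * (2 * pi)).
  exact: plancherel_eq_measure (plancherel_prod P2 P).
have : plancherel_for (@leb13 R) (prod_kernel line_kernel
    (prod_kernel (prod_kernel line_kernel line_kernel) line_kernel))
    (2 * pi * (2 * pi * (2 * pi) * (2 * pi))).
  exact: plancherel_eq_measure (plancherel_prod P P3).
set k := prod_kernel _ _ => -[mK _ K0 PK].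
eexists; first exact: K0.
move=> u mu_ uoo eoo.
have kE (y x : spacetime R) : k y x = cis (- (y.1 * x.1 + dot3 y.2 x.2))%R.
  by rewrite /k /prod_kernel /line_kernel -!cisD; congr cis; rewrite /dot3; ring.
have E : fourier1 u = itrans leb13 k u.
  apply/funext => y; rewrite /fourier1 /itrans.
  by under [in RHS]eq_fun do rewrite kE.
by rewrite E; exact: PK.
Qed.

End plancherel_spacetime.

(** * The Fourier transform on L^2 *)

Section riesz_fischer.
Context {R : realType} {d} {T : measurableType d}.
Variable m : {measure set T -> \bar R}.
Local Open Scope ereal_scope.

(** The limit in [riesz_fischer] is defined as an upper limit, which is measurable without knowing
    where the sequence converges. Bounds on a tail pass to it directly. *)
Lemma limn_esup_itv (a : nat -> R) (n : nat) (x y : R) :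
  (forall k, (n <= k)%N -> x <= a k <= y)%R ->
  (x <= fine (limn_esup (EFin \o a)) <= y)%R.
Proof.
move=> axy.
have lb : x%:E <= limn_esup (EFin \o a).
  apply: le_trans (limn_einf_sup _); rewrite limn_einf_lim.
  apply: lime_ge; first exact: is_cvg_einfs.
  near=> k; apply: le_ereal_inf_tmp => _ [j /= kj <-]; rewrite lee_fin.
  have /axy/andP[] // : (n <= j)%N.
  by apply: leq_trans kj; near: k; exact: nbhs_infty_ge.
have ub : limn_esup (EFin \o a) <= y%:E.
  rewrite limn_esup_lim; apply: lime_le; first exact: is_cvg_esups.
  near=> k; apply: ge_ereal_sup => _ [j /= kj <-]; rewrite lee_fin.
  have /axy/andP[] // : (n <= j)%N.
  by apply: leq_trans kj; near: k; exact: nbhs_infty_ge.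
by case: (limn_esup _) lb ub => [r| |] //=; rewrite !lee_fin => -> ->.
Unshelve. all: by end_near. Qed.

Lemma geometric_tail (a : nat -> R) (s : R) : (0 <= s)%R ->
  (forall n, `|a n.+1 - a n| <= s / 2 ^+ n)%R ->
  forall n k, (n <= k)%N -> (`|a k - a n| <= 2 * s / 2 ^+ n)%R.
Proof.
move=> s0 as_ n k /subnK <-.
(* The remaining geometric tail is subtracted so that the induction closes. *)
suff h j : (`|a (j + n)%N - a n| <= 2 * s / 2 ^+ n - 2 * s / 2 ^+ (j + n))%R.
  apply: le_trans (h _) _; rewrite gerBl.
  by rewrite divr_ge0 ?mulr_ge0 ?exprn_ge0.
elim: j => [|j ih]; first by rewrite add0n !subrr normr0.
rewrite addSn -(subrK (a (j + n)%N) (a (j + n).+1)) -addrA.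
apply: le_trans (ler_normD _ _) _.
apply: le_trans (lerD (as_ _) ih) _.
rewrite addrCA lerD2l exprS.
have p0 : (0 < 2 ^+ (j + n) :> R)%R by rewrite exprn_gt0.
rewrite (_ : 2 * s / (2 * 2 ^+ (j + n)) = s / 2 ^+ (j + n))%R; last first.
  by field; rewrite gt_eqF.
by rewrite -mulrA -mulr_natl; lra.
Qed.

(** Let $G=\sum4^n|f_{n+1}-f_n|^2$, whose integral is at most 1. Where $G$ is finite,
    $|f_{n+1}-f_n|\le\sqrt G/2^n$, so the real and the imaginary part of $f_n$ are each within
    $2\sqrt G/2^n$ of their limits. Hence $|f_n-u|^2\le8G/4^n$. *)
Lemma riesz_fischer (f : nat -> T -> R[i]) : (forall n, cmeas (f n)) ->
  (forall n, (4 ^+ n)%:E * energy m (fun x => f n.+1 x - f n x)%R <=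
    (1 / (2 ^ n.+1)%:R)%:E) ->
  exists2 u, cmeas u & energy m (fun x => f n x - u x)%R @[n --> \oo] --> 0.
Proof.
move=> mf fcauchy.
have md n : cmeas (fun x => f n.+1 x - f n x)%R by exact: cmeasB.
pose t n x : \bar R := (4 ^+ n * csq (f n.+1 x - f n x))%:E.
have mt n : measurable_fun setT (t n).
  by apply/measurable_EFinP; apply: measurable_funM => //; exact: measurable_csq.
have t0 n x : 0 <= t n x by rewrite lee_fin mulr_ge0 ?exprn_ge0 ?csq_ge0.
pose G x := \sum_(n <oo) t n x.
have mG : measurable_fun setT G by apply: ge0_emeasurable_sum.
have G0 x : 0 <= G x by apply: nneseries_ge0.
have GI : \int[m]_x G x <= 1%:E.
  rewrite /G integral_nneseries//.
  apply: le_trans (@epsilon_trick0 R 1%R predT ler01).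
  apply: lee_nneseries => n; first by move=> *; apply: integral_ge0.
  move=> _.
  rewrite /t; apply: le_trans (fcauchy n).
  rewrite /energy -ge0_integralZl//.
  - exact: measurable_Ecsq.
  - by move=> x _; rewrite lee_fin csq_ge0.
have Goo : {ae m, forall x, G x < +oo}.
  by apply: ae_lty => //; apply: le_lt_trans GI _; exact: ltry.
pose u x := (fine (limn_esup (EFin \o (fun n => complex.Re (f n x)))) +i*
             fine (limn_esup (EFin \o (fun n => complex.Im (f n x)))))%C.
have mu : cmeas u.
  split => /=; apply: measurableT_comp => //.
  - apply: (measurable_fun_limn_esup (f := fun n x => (complex.Re (f n x))%:E)).
    by move=> n; apply/measurable_EFinP; case: (mf n).
  - apply: (measurable_fun_limn_esup (f := fun n x => (complex.Im (f n x))%:E)).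
    by move=> n; apply/measurable_EFinP; case: (mf n).
exists u => //.
have bound n : energy m (fun x => f n x - u x)%R <= (8 / 4 ^+ n)%:E.
  apply: (@le_trans _ _ (\int[m]_x ((8 / 4 ^+ n)%:E * G x))); last first.
    rewrite ge0_integralZl//.
    rewrite -[leRHS]mule1 lee_pmul// ?lee_fin ?divr_ge0 ?exprn_ge0//.
    exact: integral_ge0.
  apply: ae_ge0_le_integral => //.
  - by move=> x _; rewrite lee_fin csq_ge0.
  - by apply: measurable_Ecsq; exact: cmeasB.
  - by move=> x _; rewrite mule_ge0 ?lee_fin ?divr_ge0 ?exprn_ge0.
  - exact: measurable_funeM.
  apply: filterS Goo => x Gx _.
  have Gfin : G x \is a fin_num by rewrite ge0_fin_numE.
  have tG k : t k x <= G x.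
    apply: le_trans (nneseries_lim_ge (m := 0) (P := predT) k.+1 _) => //.
    rewrite big_nat_recr//= leeDr//.
    by apply: sume_ge0.
  rewrite -(fineK Gfin) -EFinM lee_fin.
  pose s := Num.sqrt (fine (G x)).
  have s2 : (s ^+ 2 = fine (G x))%R by rewrite sqr_sqrtr// fine_ge0.
  have s0 : (0 <= s)%R by exact: sqrtr_ge0.
  have p0 k : (0 < 2 ^+ k :> R)%R by rewrite exprn_gt0.
  have csqk k : (csq (f k.+1 x - f k x) <= (s / 2 ^+ k) ^+ 2)%R.
    rewrite expr_div_n s2 -exprM mulnC exprM (_ : 2 ^+ 2 = 4 :> R)%R;
      last by rewrite expr2 -natrM.
    rewrite ler_pdivlMr ?exprn_gt0// mulrC -lee_fin fineK//.
    exact: tG.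
  have Rek k : (`|complex.Re (f k.+1 x) - complex.Re (f k x)| <= s / 2 ^+ k)%R.
    rewrite -(@ler_pXn2r _ 2) ?nnegrE ?divr_ge0 ?(ltW (p0 _))// real_normK ?num_real//.
    apply: le_trans (csqk k); rewrite /csq ReD ImD ReN ImN lerDl sqr_ge0//.
  have Imk k : (`|complex.Im (f k.+1 x) - complex.Im (f k x)| <= s / 2 ^+ k)%R.
    rewrite -(@ler_pXn2r _ 2) ?nnegrE ?divr_ge0 ?(ltW (p0 _))// real_normK ?num_real//.
    apply: le_trans (csqk k); rewrite /csq ReD ImD ReN ImN lerDr sqr_ge0//.
  have lim (a : nat -> R) : (forall k, `|a k.+1 - a k| <= s / 2 ^+ k)%R ->
      ((a n - fine (limn_esup (EFin \o a))) ^+ 2 <= (2 * s / 2 ^+ n) ^+ 2)%R.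
    move=> ak; have h := geometric_tail s0 ak.
    have /andP[l1 l2] : (a n - 2 * s / 2 ^+ n <= fine (limn_esup (EFin \o a)) <=
        a n + 2 * s / 2 ^+ n)%R.
      apply: (@limn_esup_itv _ n) => k nk; have := h _ _ nk.
      by rewrite ler_distl.
    rewrite -[leLHS]real_normK ?num_real// ler_pXn2r ?nnegrE//.
    - by rewrite ler_distl; apply/andP; split; lra.
    - by rewrite divr_ge0 ?mulr_ge0 ?(ltW (p0 _)).
  have hR := lim _ Rek; have hI := lim _ Imk.
  rewrite /csq ReD ImD ReN ImN /=.
  apply: le_trans (lerD hR hI) _.
  rewrite -s2 expr_div_n -exprM mulnC exprM (_ : 2 ^+ 2 = 4 :> R)%R;
    last by rewrite expr2 -natrM.
  rewrite exprMn (_ : 2 ^+ 2 = 4 :> R)%R; last by rewrite expr2 -natrM.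
  by rewrite le_eqVlt; apply/orP; left; apply/eqP; field; rewrite gt_eqF// exprn_gt0.
apply: (@squeeze_ecvg0 _ _ (fun n => (8 / 4 ^+ n)%:E)) => //.
- by move=> n; exact: energy_ge0.
apply: cvg_EFin; first by near=> n.
rewrite (_ : fine \o _ = geometric 8 4^-1%R); last first.
  by apply/funext => n; rewrite /= /geometric /= exprVn.
by apply: cvg_geometric; rewrite ger0_norm ?invr_ge0// invf_lt1// ltr1n.
Unshelve. all: by end_near. Qed.

End riesz_fischer.

Section L2norm.
Context {R : realType}.
Local Open Scope ereal_scope.
Implicit Types u v : spacetime R -> R[i].

Lemma L2normE u : L2norm u = sqrte (energy leb13 u).
Proof.
rewrite /L2norm unlock /=; rewrite poweR12_sqrt; last first.
  by apply: integral_ge0 => x _; rewrite lee_fin powR_ge0.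
suff -> : \int[leb13]_x (`|Normc.normc (u x)| `^ 2)%:E = energy leb13 u by [].
apply: eq_integral => x _.
by rewrite /= powR_mulrn ?normr_ge0// ger0_norm ?normc_ge0// sqr_normc.
Qed.

Lemma L2norm_ge0 u : 0 <= L2norm u.
Proof. by rewrite L2normE sqrte_ge0. Qed.

Lemma L2norm_sqr u : L2norm u * L2norm u = energy leb13 u.
Proof.
rewrite L2normE; have := energy_ge0 leb13 u.
case: (energy _ _) => [r| |] //=; rewrite ?lee_fin => r0.
by rewrite -EFinM -expr2 sqr_sqrtr.
Qed.

Lemma mule_self_le (x y : \bar R) : 0 <= x -> 0 <= y -> x * x <= y * y -> x <= y.
Proof.
case: x y => [x| |] [y| |] //=; rewrite ?lee_fin ?leey//.
by move=> x0 y0; rewrite -!expr2 ler_pXn2r ?nnegrE.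
Qed.

Lemma cLp2P u : cLp 2%:E u <-> cmeas u /\ energy leb13 u < +oo.
Proof.
have E : L2norm u < +oo <-> energy leb13 u < +oo.
  rewrite L2normE; have := energy_ge0 leb13 u.
  by case: (energy _ _) => [r| |] //=; rewrite !ltry.
split=> [[m1 m2 uoo]|[[m1 m2] uoo]].
- by split; [split|exact/E].
- by split => //; exact/E.
Qed.

Lemma cLp1P u : cLp 1%:E u <-> cmeas u /\ mass leb13 u < +oo.
Proof.
have E : 'N[leb13]_1%:E[EFin \o (fun X => Normc.normc (u X))] = mass leb13 u.
  rewrite Lnorm1; apply: eq_integral => x _.
  by rewrite gee0_abs// lee_fin normc_ge0.
split=> [[m1 m2]|[[m1 m2] uoo]].
- by rewrite /finite_norm E => uoo; split; [split|].
- by split => //; rewrite /finite_norm E.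
Qed.

Lemma L2norm_cvg0 (w : nat -> spacetime R -> R[i]) :
  L2norm (w n) @[n --> \oo] --> 0 <-> energy leb13 (w n) @[n --> \oo] --> 0.
Proof.
rewrite (ecvg0P (fun n => L2norm_ge0 _)) (ecvg0P (fun n => energy_ge0 _ _)).
split => h e e0.
- have s0 : (0 < Num.sqrt e)%R by rewrite sqrtr_gt0.
  have := h _ s0; apply: filterS => n wn; rewrite -L2norm_sqr.
  have -> : e%:E = (Num.sqrt e)%:E * (Num.sqrt e)%:E.
    by rewrite -EFinM -expr2 sqr_sqrtr// ltW.
  by rewrite lee_pmul// L2norm_ge0.
- have e20 : (0 < e * e)%R by rewrite mulr_gt0.
  have := h _ e20; apply: filterS => n wn.
  apply: mule_self_le; [exact: L2norm_ge0|by rewrite lee_fin ltW|].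
  by rewrite L2norm_sqr -EFinM.
Qed.

End L2norm.

Lemma measurable_coord {R : realType} d (T : measurableType d) (f : T -> vec3 R) : measurable_fun setT f ->
  [/\ measurable_fun setT (fun x => (f x).1.1 : measurableTypeR R),
      measurable_fun setT (fun x => (f x).1.2 : measurableTypeR R) &
      measurable_fun setT (fun x => (f x).2 : measurableTypeR R)].
Proof.
move=> mf; split.
- by apply: (measurableT_comp measurable_fst); exact: (measurableT_comp measurable_fst mf).
- by apply: (measurableT_comp measurable_snd); exact: (measurableT_comp measurable_fst mf).
- exact: (measurableT_comp measurable_snd mf).
Qed.

Section fourier_linear.
Context {R : realType}.
Local Open Scope ereal_scope.
Implicit Types (f g u v : spacetime R -> R[i]) (X Y s : spacetime R).

Definition L12 f := [/\ cmeas f, mass leb13 f < +oo & energy leb13 f < +oo].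

Lemma measurable_dot3 d (T : measurableType d) (f g : T -> vec3 R) :
  measurable_fun setT f -> measurable_fun setT g ->
  measurable_fun setT (fun x => dot3 (f x) (g x)).
Proof.
move=> /measurable_coord[f1 f2 f3] /measurable_coord[g1 g2 g3].
by rewrite /dot3; apply: measurable_funD; [apply: measurable_funD|]; exact: measurable_funM.
Qed.

Lemma cmeas_phase X : cmeas (fun Y : spacetime R => cis (- (X.1 * Y.1 + dot3 X.2 Y.2))%R).
Proof.
apply: cmeas_cis; apply: measurableT_comp => //; apply: measurable_funD.
  apply: measurable_funM; first exact: measurable_cst.
  exact: measurable_fst.
by apply: measurable_dot3; [exact: measurable_cst|exact: measurable_snd].
Qed.

Lemma massD f g : cmeas f -> cmeas g ->
  mass leb13 (fun X => f X + g X)%R <= mass leb13 f + mass leb13 g.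
Proof.
move=> mf mg; rewrite /mass -ge0_integralD//; last 4 first.
- by move=> x _; rewrite lee_fin normc_ge0.
- exact: measurable_Enormc.
- by move=> x _; rewrite lee_fin normc_ge0.
- exact: measurable_Enormc.
apply: ge0_le_integral => //.
- by move=> x _; rewrite lee_fin normc_ge0.
- by apply: measurable_Enormc; exact: cmeasD.
- by apply: emeasurable_funD; exact: measurable_Enormc.
- by move=> x _; rewrite -EFinD lee_fin le_normcD.
Qed.

Lemma massZ (z : R[i]) f : cmeas f ->
  mass leb13 (fun X => z * f X)%R = (Normc.normc z)%:E * mass leb13 f.
Proof.
move=> mf; rewrite -ge0_integralZl//; last 3 first.
- exact: measurable_Enormc.
- by move=> x _; rewrite lee_fin normc_ge0.
- by rewrite lee_fin normc_ge0.
by apply: eq_integral => x _; rewrite -EFinM Normc.normcM.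
Qed.

Lemma energyD_lty f g : cmeas f -> cmeas g -> energy leb13 f < +oo ->
  energy leb13 g < +oo -> energy leb13 (fun X => f X + g X)%R < +oo.
Proof.
move=> mf mg foo goo; apply: le_lt_trans (energyD leb13 mf mg) _.
by rewrite lte_add_pinfty// lte_mul_pinfty.
Qed.

Lemma energyZ_lty (z : R[i]) f : cmeas f -> energy leb13 f < +oo ->
  energy leb13 (fun X => z * f X)%R < +oo.
Proof.
by move=> mf foo; rewrite energyZ// lte_mul_pinfty// lee_fin csq_ge0.
Qed.

Lemma energyB_lty f g : cmeas f -> cmeas g -> energy leb13 f < +oo ->
  energy leb13 g < +oo -> energy leb13 (fun X => f X - g X)%R < +oo.
Proof.
move=> mf mg foo goo; apply: energyD_lty => //; first exact: cmeasN.
by rewrite energyN.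
Qed.

Lemma L12D f g : L12 f -> L12 g -> L12 (fun X => f X + g X)%R.
Proof.
move=> [mf f1 f2] [mg g1 g2]; split.
- exact: cmeasD.
- by apply: le_lt_trans (massD mf mg) _; rewrite lte_add_pinfty.
- exact: energyD_lty.
Qed.

Lemma L12Z (z : R[i]) f : L12 f -> L12 (fun X => z * f X)%R.
Proof.
move=> [mf f1 f2]; split.
- by apply: cmeasM => //; exact: cmeas_cst.
- by rewrite massZ// lte_mul_pinfty// lee_fin normc_ge0.
- exact: energyZ_lty.
Qed.

Lemma fourier1D f g : L12 f -> L12 g ->
  fourier1 (fun X => f X + g X)%R = (fun X => fourier1 f X + fourier1 g X)%R.
Proof.
move=> [mf f1 _] [mg g1 _]; apply/funext => X; rewrite /fourier1.
rewrite -(cintD (m := leb13)).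
- by congr cintegral; apply/funext => Y; rewrite mulrDr.
- by apply: cmeasM => //; exact: cmeas_phase.
- by apply: cmeasM => //; exact: cmeas_phase.
- by rewrite mass_unit// => Y; exact: csq_cis.
- by rewrite mass_unit// => Y; exact: csq_cis.
Qed.

Lemma fourier1Z (z : R[i]) f : L12 f ->
  fourier1 (fun X => z * f X)%R = (fun X => z * fourier1 f X)%R.
Proof.
move=> [mf f1 _]; apply/funext => X; rewrite /fourier1.
rewrite -(cintZ (m := leb13)).
- by congr cintegral; apply/funext => Y; rewrite mulrCA.
- by apply: cmeasM => //; exact: cmeas_phase.
- by rewrite mass_unit// => Y; exact: csq_cis.
Qed.

Lemma L12B f g : L12 f -> L12 g -> L12 (fun X => f X - g X)%R.
Proof.
move=> Lf Lg; have := L12D Lf (L12Z (-1)%R Lg).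
by rewrite (_ : (fun _ => _) = (fun X => f X - g X)%R)//; apply/funext => X; rewrite mulN1r.
Qed.

Lemma fourier1B f g : L12 f -> L12 g ->
  fourier1 (fun X => f X - g X)%R = (fun X => fourier1 f X - fourier1 g X)%R.
Proof.
move=> Lf Lg; have := fourier1D Lf (L12Z (-1)%R Lg).
rewrite fourier1Z// (_ : (fun _ => _) = (fun X => f X - g X)%R); last first.
  by apply/funext => X; rewrite mulN1r.
by move=> ->; apply/funext => X; rewrite mulN1r.
Qed.

Lemma L12_shift f s : L12 f -> L12 (fun X => f (X + s)%R).
Proof.
have [ms i] := leb13_invariant_shift s.
move=> [mf f1 f2]; split.
- exact: (cmeas_comp mf ms).
- rewrite /mass (i (fun X => (Normc.normc (f X))%:E))//.
    exact: measurable_Enormc.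
  by move=> X; rewrite lee_fin normc_ge0.
- rewrite /energy (i (fun X => (csq (f X))%:E))//.
    exact: measurable_Ecsq.
  by move=> X; rewrite lee_fin csq_ge0.
Qed.

Definition phase s X : R[i] := cis (X.1 * s.1 + dot3 X.2 s.2)%R.

Lemma fourier1_shift f s : L12 f ->
  fourier1 (fun X => f (X + s)%R) = (fun X => phase s X * fourier1 f X)%R.
Proof.
move=> [mf f1 f2]; apply/funext => X; rewrite /fourier1.
have mpf : cmeas (fun Y => cis (- (X.1 * Y.1 + dot3 X.2 Y.2)) * f Y)%R.
  by apply: cmeasM => //; exact: cmeas_phase.
rewrite [RHS](_ : _ = cint leb13 (fun Z => phase s X *
    (cis (- (X.1 * Z.1 + dot3 X.2 Z.2)) * f Z))%R); last first.
  apply/esym; apply: cintZ => //.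
  by rewrite mass_unit// => Y; exact: csq_cis.
transitivity (cint leb13 (fun Y => (fun Z => phase s X *
    (cis (- (X.1 * Z.1 + dot3 X.2 Z.2)) * f Z))%R (Y + s)%R)); last first.
  apply: (invariant_cint (leb13_invariant_shift s)).
  by apply: cmeasM => //; exact: cmeas_cst.
congr cintegral; apply/funext => Y; rewrite mulrA /phase -cisD.
by congr (cis _ * _)%R; rewrite /dot3 /=; ring.
Qed.

End fourier_linear.

(** * Plancherel bounds and the range of the transform *)

Section fourier_range.
Context {R : realType}.
Local Open Scope ereal_scope.
Local Opaque leb13.
Variable K : R.
Hypothesis K0 : (0 < K)%R.
Hypothesis PK : forall u : spacetime R -> R[i], cmeas u -> mass leb13 u < +oo ->
  energy leb13 u < +oo ->
  cmeas (fourier1 u) /\ energy leb13 (fourier1 u) = K%:E * energy leb13 u.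
Implicit Types (f g u v : spacetime R -> R[i]) (X Y s : spacetime R).

Lemma is_fourierP u v : is_fourier u v <->
  [/\ cmeas u /\ energy leb13 u < +oo, cmeas v /\ energy leb13 v < +oo &
    exists f : nat -> spacetime R -> R[i], [/\ forall n, L12 (f n),
      energy leb13 (fun X => f n X - u X)%R @[n --> \oo] --> 0 &
      energy leb13 (fun X => fourier1 (f n) X - v X)%R @[n --> \oo] --> 0]].
Proof.
split=> [[/cLp2P uP /cLp2P vP [f [fL /L2norm_cvg0 fu /L2norm_cvg0 fv]]]|].
  split => //; exists f; split => // n.
  by have [/cLp1P[mf f1] /cLp2P[_ f2]] := fL n; split.
move=> [/cLp2P uP /cLp2P vP [f [fL fu fv]]]; split => //.
exists f; split; [|exact/L2norm_cvg0|exact/L2norm_cvg0].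
by move=> n; have [mf f1 f2] := fL n; split; [exact/cLp1P|exact/cLp2P].
Qed.

Lemma cmeas_fourier1 f : L12 f -> cmeas (fourier1 f).
Proof. by move=> [mf f1 f2]; have [] := PK mf f1 f2. Qed.

Lemma energy_fourier1 f : L12 f -> energy leb13 (fourier1 f) = K%:E * energy leb13 f.
Proof. by move=> [mf f1 f2]; have [] := PK mf f1 f2. Qed.

Lemma energy_inv_fourier1 f : L12 f ->
  energy leb13 f = K^-1%:E * energy leb13 (fourier1 f).
Proof.
move=> Lf; rewrite energy_fourier1// muleA -EFinM mulVf ?mul1e//.
by rewrite gt_eqF.
Qed.

Lemma energy_split u v : cmeas u -> cmeas v ->
  energy leb13 v <= 2%:E * energy leb13 (fun X => u X - v X)%R + 2%:E * energy leb13 u.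
Proof.
move=> mu mv; rewrite addeC -energyN.
rewrite [X in X <= _](_ : _ = energy leb13 (fun X => - u X + (u X - v X))%R).
  rewrite -[X in X + _](_ : 2%:E * energy leb13 (fun X => - u X)%R = _).
    by apply: energyD; [exact: cmeasN|exact: cmeasB].
  by rewrite energyN.
by congr energy; apply/funext => X; rewrite addrA addNr add0r.
Qed.

(** The error terms add up to $2+4k$ times the tolerance, whence its denominator. *)
Let bound_aux (k e : R) (W B A : \bar R) : (0 < k)%R -> (0 < e)%R ->
  0 <= W -> 0 <= B -> 0 <= A -> A < +oo -> W <= (e / (2 + 4 * k))%:E ->
  B <= 2%:E * (e / (2 + 4 * k))%:E + 2%:E * A ->
  2%:E * W + 2%:E * (k%:E * B) <= (4 * k)%:E * A + e%:E.
Proof.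
move=> k0 e0; case: W => [w| |]//; case: B => [b| |]//; case: A => [a| |]//.
rewrite -!(EFinM, EFinD) !lee_fin => w0 b0 a0 _.
have ee : (e / (2 + 4 * k) * (2 + 4 * k) = e)%R.
  by rewrite divfK// gt_eqF// addr_gt0// mulr_gt0.
set e' := (e / _)%R in ee *; move=> wle ble.
have : (k * b <= k * (2 * e' + 2 * a))%R by rewrite ler_pM2l.
by nra.
Qed.

Let energy_swap u v : energy leb13 (fun X => u X - v X)%R =
  energy leb13 (fun X => v X - u X)%R.
Proof.
by rewrite -energyN; congr energy; apply/funext => X; rewrite opprB.
Qed.

(** Plancherel up to the factor 4: [energy_split] costs 2 when passing from [v] to the transform of
    an approximant, and 2 again from the approximant to [u]. *)
Lemma fourier_upper u v : is_fourier u v ->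
  energy leb13 v <= (4 * K)%:E * energy leb13 u.
Proof.
move=> /is_fourierP[[mu uoo] [mv voo] [f [fL fu fv]]].
apply/lee_addgt0Pr => e e0.
have e'0 : (0 < e / (2 + 4 * K))%R by rewrite divr_gt0// addr_gt0// mulr_gt0.
move/ecvg0P : fu => /(_ (fun n => energy_ge0 _ _) _ e'0) [n1 _ h1].
move/ecvg0P : fv => /(_ (fun n => energy_ge0 _ _) _ e'0) [n2 _ h2].
pose n := maxn n1 n2.
have {}h1 := h1 n (leq_maxl _ _); have {}h2 := h2 n (leq_maxr _ _).
have [mf f1 f2] := fL n.
apply: le_trans (energy_split (cmeas_fourier1 (fL n)) mv) _.
rewrite (energy_fourier1 (fL n)).
apply: bound_aux => //; [exact: energy_ge0|exact: energy_ge0|exact: energy_ge0|].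
apply: le_trans (energy_split mu mf) _.
by rewrite leeD2r// lee_pmul2l// energy_swap.
Qed.

Lemma fourier_lower u v : is_fourier u v ->
  energy leb13 u <= (4 / K)%:E * energy leb13 v.
Proof.
move=> /is_fourierP[[mu uoo] [mv voo] [f [fL fu fv]]].
apply/lee_addgt0Pr => e e0.
have Ki0 : (0 < K^-1)%R by rewrite invr_gt0.
have e'0 : (0 < e / (2 + 4 * K^-1))%R by rewrite divr_gt0// addr_gt0// mulr_gt0.
move/ecvg0P : fu => /(_ (fun n => energy_ge0 _ _) _ e'0) [n1 _ h1].
move/ecvg0P : fv => /(_ (fun n => energy_ge0 _ _) _ e'0) [n2 _ h2].
pose n := maxn n1 n2.
have {}h1 := h1 n (leq_maxl _ _); have {}h2 := h2 n (leq_maxr _ _).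
have [mf f1 f2] := fL n.
apply: le_trans (energy_split mf mu) _.
rewrite (energy_inv_fourier1 (fL n)).
apply: bound_aux => //; [exact: energy_ge0|exact: energy_ge0|exact: energy_ge0|].
apply: le_trans (energy_split mv (cmeas_fourier1 (fL n))) _.
by rewrite leeD2r// lee_pmul2l// energy_swap.
Qed.

Let cmeas_fourier1B f v : L12 f -> cmeas v -> cmeas (fun X => fourier1 f X - v X)%R.
Proof. by move=> Lf mv; exact: cmeasB (cmeas_fourier1 Lf) mv. Qed.

Lemma is_fourierB u v u' v' : is_fourier u v -> is_fourier u' v' ->
  is_fourier (fun X => u X - u' X)%R (fun X => v X - v' X)%R.
Proof.
move=> /is_fourierP[[mu uoo] [mv voo] [f [fL fu fv]]].
move=> /is_fourierP[[mu' uoo'] [mv' voo'] [f' [fL' fu' fv']]].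
apply/is_fourierP; split.
- by split; [exact: cmeasB|exact: energyB_lty].
- by split; [exact: cmeasB|exact: energyB_lty].
exists (fun n X => f n X - f' n X)%R.
have h (a a' : nat -> spacetime R -> R[i]) (b b' : spacetime R -> R[i]) :
    (forall n, cmeas (a n)) -> (forall n, cmeas (a' n)) -> cmeas b -> cmeas b' ->
    energy leb13 (fun X => a n X - b X)%R @[n --> \oo] --> 0 ->
    energy leb13 (fun X => a' n X - b' X)%R @[n --> \oo] --> 0 ->
    energy leb13 (fun X => a n X - a' n X - (b X - b' X))%R @[n --> \oo] --> 0.
  move=> ma ma' mb mb' ab ab'.
  apply: (@squeeze_ecvg0 _ _ (fun n => 2%:E * energy leb13 (fun X => a n X - b X)%R +
    2%:E * energy leb13 (fun X => a' n X - b' X)%R)).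
  - by move=> n; exact: energy_ge0.
  - move=> n; rewrite [X in X <= _](_ : _ =
      energy leb13 (fun X => (a n X - b X) - (a' n X - b' X))%R).
      by apply: energyB; exact: cmeasB.
    by congr energy; apply/funext => X; ring.
  - rewrite (_ : 0 = 2%:E * 0 + 2%:E * 0); last by rewrite !mule0 adde0.
    by apply: cvgeD => //; exact: cvgeZl.
split.
- by move=> n; exact: L12B.
- by apply: h mu mu' fu fu' => n; [case: (fL n)|case: (fL' n)].
- under eq_fun do rewrite fourier1B//.
  by apply: h mv mv' fv fv' => n; exact: cmeas_fourier1.
Qed.

(** The difference of the two transforms is a transform of 0, so [fourier_upper] makes its energy
    vanish. *)
Lemma is_fourier_uniq u v v' : is_fourier u v -> is_fourier u v' ->
  {ae leb13, forall X, v X = v' X}.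
Proof.
move=> uv uv'; have := is_fourierB uv uv'.
rewrite (_ : (fun X => u X - u X)%R = (fun=> 0%R)); last first.
  by apply/funext => X; rewrite subrr.
move=> h; have := fourier_upper h.
rewrite [X in _ * X](_ : _ = 0); last first.
  by apply: integral0_eq => X _; rewrite csq0.
rewrite mule0 => vv.
have mvv : cmeas (fun X => v X - v' X)%R by case/is_fourierP: h => _ [].
have : energy leb13 (fun X => v X - v' X)%R = 0.
  by apply/eqP; rewrite eq_le vv energy_ge0.
move/(energy_eq0 mvv); apply: filterS => X.
by move/eqP; rewrite subr_eq0 => /eqP.
Qed.

Lemma is_fourier0 v : is_fourier (fun=> 0%R) v -> {ae leb13, forall X, v X = 0%R}.
Proof.
move=> h; have := fourier_upper h.
rewrite [X in _ * X](_ : _ = 0); last first.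
  by apply: integral0_eq => X _; rewrite csq0.
rewrite mule0 => vv; have mv : cmeas v by case/is_fourierP: h => _ [].
apply: energy_eq0 => //.
by apply/eqP; rewrite eq_le vv energy_ge0.
Qed.

(** The preimage is left out on purpose: in this form closure under limits is immediate, and
    [fourier_range_ex] recovers a preimage at the end. *)
Definition fourier_range v := [/\ cmeas v, energy leb13 v < +oo &
  forall e : R, (0 < e)%R -> exists2 f, L12 f &
    energy leb13 (fun X => fourier1 f X - v X)%R <= e%:E].

Lemma is_fourier_range u v : is_fourier u v -> fourier_range v.
Proof.
move=> /is_fourierP[[mu uoo] [mv voo] [f [fL fu fv]]]; split => // e e0.
move/ecvg0P : fv => /(_ (fun n => energy_ge0 _ _) _ e0) [n _ h].
by exists (f n); [exact: fL|exact: h n (leqnn n)].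
Qed.

Lemma fourier_range_ex v : fourier_range v -> exists u, is_fourier u v.
Proof.
move=> [mv voo happ].
(* Undoing the transform costs $K^{-1}$, and the rate $8^{-n}$ beats the weight $4^n$ of
   [riesz_fischer] with a factor $2^{-n}$ to spare. *)
pose e n : R := (K / 8 ^+ n.+1)%R.
have e0 n : (0 < e n)%R by rewrite divr_gt0// exprn_gt0.
have /choice[f fP] : forall n, exists f, L12 f /\
    energy leb13 (fun X => fourier1 f X - v X)%R <= (e n)%:E.
  by move=> n; have [f] := happ _ (e0 n); exists f.
have fL n : L12 (f n) by case: (fP n).
have fe n : energy leb13 (fun X => fourier1 (f n) X - v X)%R <= (e n)%:E by case: (fP n).
have mf n : cmeas (f n) by case: (fL n).
have ecvg : (e n)%:E @[n --> \oo] --> 0.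
  apply: cvg_EFin; first by near=> n.
  rewrite (_ : fine \o _ = geometric (K / 8)%R 8^-1%R); last first.
    apply/funext => n; rewrite /= /geometric /= exprVn /e exprS.
    by field; rewrite gt_eqF// exprn_gt0.
  by apply: cvg_geometric; rewrite ger0_norm ?invr_ge0// invf_lt1// ltr1n.
have [|u mu fu] := @riesz_fischer _ _ _ leb13 f mf.
  move=> n; rewrite energy_inv_fourier1; last exact: L12B.
  rewrite fourier1B//.
  have h : energy leb13 (fun X => fourier1 (f n.+1) X - fourier1 (f n) X)%R <=
      2%:E * (e n.+1)%:E + 2%:E * (e n)%:E.
    rewrite [X in X <= _](_ : _ = energy leb13 (fun X =>
       (fourier1 (f n.+1) X - v X) - (fourier1 (f n) X - v X))%R); last first.
      by congr energy; apply/funext => X; rewrite opprB addrA subrK.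
    apply: le_trans (energyB _ _ _) _.
    - exact: cmeas_fourier1B.
    - exact: cmeas_fourier1B.
    - by rewrite leeD// lee_pmul2l.
  apply: (@le_trans _ _ ((4 ^+ n)%:E * (K^-1%:E * (2%:E * (e n.+1)%:E + 2%:E * (e n)%:E)))).
    by rewrite lee_pmul2l ?lte_fin ?exprn_gt0// lee_pmul2l ?lte_fin ?invr_gt0.
  rewrite -!(EFinM, EFinD) lee_fin /e natrX.
  have -> : (8 : R)%R = (4 * 2)%R by rewrite -natrM.
  rewrite !exprS !exprMn.
  have p2 : (0 < 2 ^+ n :> R)%R by rewrite exprn_gt0.
  have p4 : (0 < 4 ^+ n :> R)%R by rewrite exprn_gt0.
  rewrite -subr_ge0.
  set a := (2 ^+ n : R)%R in p2 *; set b := (4 ^+ n : R)%R in p4 *.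
  rewrite (_ : _ - _ = 7 / 32 / a)%R; first by rewrite divr_ge0// ltW.
  by field; rewrite !gt_eqF.
exists u; apply/is_fourierP; split => //.
- split => //; have [f1 f2 f3] := fL 0%N.
  move/ecvg0P : fu => /(_ (fun n => energy_ge0 _ _) _ ltr01)[n _ /(_ n (leqnn n)) h].
  apply: le_lt_trans (energy_split (mf n) mu) _.
  rewrite lte_add_pinfty ?lte_mul_pinfty//; last by case: (fL n).
  by apply: le_lt_trans h _; exact: ltry.
- exists f; split => //.
  by apply: squeeze_ecvg0 fe ecvg => n; exact: energy_ge0.
Unshelve. all: by end_near. Qed.

Lemma fourier_range_lim v : cmeas v -> energy leb13 v < +oo ->
  (forall e : R, (0 < e)%R -> exists2 v', fourier_range v' &
    energy leb13 (fun X => v' X - v X)%R <= e%:E) -> fourier_range v.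
Proof.
move=> mv voo h; split => // e e0.
have e40 : (0 < e / 4)%R by rewrite divr_gt0.
have [v' [mv' voo' /(_ _ e40)[f Lf fv']] v'v] := h _ e40.
exists f => //.
rewrite [X in X <= _](_ : _ = energy leb13 (fun X =>
   (fourier1 f X - v' X) + (v' X - v X))%R); last first.
  by congr energy; apply/funext => X; rewrite addrA subrK.
apply: le_trans (energyD _ _ _) _.
- exact: cmeas_fourier1B.
- exact: cmeasB.
by rewrite -(quarters e) leeD// lee_pmul2l.
Qed.

Lemma fourier_rangeD v v' : fourier_range v -> fourier_range v' ->
  fourier_range (fun X => v X + v' X)%R.
Proof.
move=> [mv voo h] [mv' voo' h']; split.
- exact: cmeasD.
- exact: energyD_lty.
move=> e e0; have e40 : (0 < e / 4)%R by rewrite divr_gt0.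
have [f Lf fv] := h _ e40; have [f' Lf' fv'] := h' _ e40.
exists (fun X => f X + f' X)%R; first exact: L12D.
rewrite fourier1D// [X in X <= _](_ : _ = energy leb13 (fun X =>
   (fourier1 f X - v X) + (fourier1 f' X - v' X))%R); last first.
  by congr energy; apply/funext => X; rewrite opprD addrACA.
apply: le_trans (energyD _ _ _) _.
- exact: cmeas_fourier1B.
- exact: cmeas_fourier1B.
by rewrite -(quarters e) leeD// lee_pmul2l.
Qed.

Lemma fourier_rangeZ (z : R[i]) v : fourier_range v ->
  fourier_range (fun X => z * v X)%R.
Proof.
move=> [mv voo h]; split.
- by apply: cmeasM => //; exact: cmeas_cst.
- exact: energyZ_lty.
move=> e e0; have z1 : (0 < csq z + 1)%R by rewrite ltr_wpDl// csq_ge0.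
have ez0 : (0 < e / (csq z + 1))%R by rewrite divr_gt0.
have [f Lf fv] := h _ ez0; exists (fun X => z * f X)%R; first exact: L12Z.
rewrite fourier1Z// [X in X <= _](_ : _ = energy leb13 (fun X =>
   z * (fourier1 f X - v X))%R); last first.
  by congr energy; apply/funext => X; rewrite mulrBr.
rewrite energyZ; last exact: cmeas_fourier1B.
apply: (@le_trans _ _ ((csq z)%:E * (e / (csq z + 1))%:E)).
  by rewrite lee_wpmul2l// lee_fin csq_ge0.
rewrite -EFinM lee_fin mulrA ler_pdivrMr// mulrC ler_pM2l//.
by rewrite lerDl.
Qed.

Lemma cmeas_phaseM s : cmeas (fun X : spacetime R => phase s X).
Proof.
apply: cmeas_cis; apply: measurable_funD.
  by apply: measurable_funM; [exact: measurable_fst|exact: measurable_cst].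
by apply: measurable_dot3; [exact: measurable_snd|exact: measurable_cst].
Qed.

Lemma fourier_range_phase s v : fourier_range v ->
  fourier_range (fun X => phase s X * v X)%R.
Proof.
move=> [mv voo h]; split.
- by apply: cmeasM => //; exact: cmeas_phaseM.
- by rewrite energy_unit// => X; exact: csq_cis.
move=> e e0; have [f Lf fv] := h _ e0.
exists (fun X => f (X + s)%R); first exact: L12_shift.
rewrite fourier1_shift// [X in X <= _](_ : _ = energy leb13 (fun X =>
   phase s X * (fourier1 f X - v X))%R); last first.
  by congr energy; apply/funext => X; rewrite mulrBr.
by rewrite energy_unit// => X; exact: csq_cis.
Qed.

End fourier_range.

(** * Indicators of slabs as multipliers *)

Section threshold.
Context {R : realType}.
Implicit Types x : R.

(* Tends to [1] for [x < 1/2] and to [0] for [x > 1/2]. *)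
Definition smooth_step (n : nat) x : R := (1 - x ^+ n) ^+ (2 ^ n).

Lemma bernoulli_sub (y : R) k : 0 <= y <= 1 -> 1 - k%:R * y <= (1 - y) ^+ k.
Proof.
move=> /andP[y0 y1]; elim: k => [|k ih]; first by rewrite mul0r subr0 expr0.
rewrite exprS -natr1.
have y1' : 0 <= 1 - y by rewrite subr_ge0.
apply: le_trans (ler_wpM2l y1' ih).
have k0 : 0 <= k%:R :> R by [].
have : 0 <= k%:R * (y * y) by rewrite !mulr_ge0.
by nra.
Qed.

Lemma smooth_step_itv n x : 0 <= x <= 1 -> 0 <= smooth_step n x <= 1.
Proof.
move=> /andP[x0 x1]; have h : 0 <= 1 - x ^+ n <= 1.
  by rewrite subr_ge0 exprn_ile1//= lerBlDl lerDr exprn_ge0.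
by case/andP: h => h0 h1; rewrite exprn_ge0//= exprn_ile1.
Qed.

(** Bernoulli's inequality gives $(1-x^n)^{2^n}\ge1-(2x)^n$. *)
Lemma smooth_step_lt x : 0 <= x < 2^-1 -> smooth_step n x @[n --> \oo] --> (1 : R).
Proof.
move=> /andP[x0 x12]; have x1 : x <= 1 by lra.
have g : geometric 1 (2 * x) @ \oo --> (0 : R).
  by apply: cvg_geometric; rewrite ger0_norm ?mulr_ge0//; lra.
apply: (@squeeze_cvgr _ _ _ _ (fun n => 1 - geometric 1 (2 * x) n) (cst 1)).
- near=> n; have /andP[_ ->] := @smooth_step_itv n x (introT andP (conj x0 x1)).
  rewrite andbT /geometric /= mul1r exprMn /smooth_step -natrX.
  apply: bernoulli_sub; rewrite exprn_ge0//= exprn_ile1//.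
- rewrite -[X in _ --> X]subr0; apply: cvgB => //; exact: cvg_cst.
- exact: cvg_cst.
Unshelve. all: by end_near. Qed.

(** With $y=x^n$ and $N=2^n$, $(1-y)^N(1+y)^N\le1$ and $(1+y)^N\ge Ny=(2x)^n$, so the step is at
    most $(2x)^{-n}$. *)
Lemma smooth_step_gt x : 2^-1 < x <= 1 -> smooth_step n x @[n --> \oo] --> (0 : R).
Proof.
move=> /andP[x12 x1]; have x0 : 0 < x by lra.
have i0 : 0 <= (2 * x)^-1 by rewrite invr_ge0; lra.
have g : geometric 1 (2 * x)^-1 @ \oo --> (0 : R).
  by apply: cvg_geometric; rewrite ger0_norm// invf_lt1; lra.
apply: (@squeeze_cvgr _ _ _ _ (cst 0) (geometric 1 (2 * x)^-1)).
- near=> n; have /andP[-> _] := @smooth_step_itv n x (introT andP (conj (ltW x0) x1)).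
  rewrite /= /geometric /= mul1r /smooth_step exprVn.
  set y := x ^+ n; set N := (2 ^ n)%N.
  have y0 : 0 < y by rewrite exprn_gt0.
  have y1 : y <= 1 by rewrite exprn_ile1// ltW.
  have -> : (2 * x) ^+ n = N%:R * y by rewrite exprMn /N natrX.
  have N0 : 0 < N%:R :> R by rewrite ltr0n expn_gt0.
  have h1 : (1 - y) ^+ N * (1 + y) ^+ N <= 1.
    rewrite -exprMn exprn_ile1//.
      by rewrite mulr_ge0//; lra.
    by nra.
  have h2 : N%:R * y <= (1 + y) ^+ N.
    have : 1 + N%:R * y <= (1 + y) ^+ N.
      elim: (N) => [|k ih]; first by rewrite mul0r addr0 expr0.
      rewrite exprS -natr1.
      have y1' : 0 <= 1 + y by lra.
      apply: le_trans (ler_wpM2l y1' ih).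
      have : 0 <= k%:R * (y * y) :> R by rewrite !mulr_ge0// ltW.
      by nra.
    by lra.
  have h3 : 0 <= (1 - y) ^+ N by rewrite exprn_ge0//; lra.
  rewrite -div1r ler_pdivlMr ?mulr_gt0//.
  by apply: le_trans h1; exact: ler_wpM2l.
- exact: cvg_cst.
- exact: g.
Unshelve. all: by end_near. Qed.

(** At the threshold the sequence is nondecreasing and bounded by 1. Existence of the limit is
    enough: it becomes the value at the ends of an interval, which [multiplier_itv] moves away. *)
Lemma smooth_step_half_cvg : cvg (smooth_step n (2^-1 : R) @[n --> \oo]).
Proof.
have h1 : 0 <= (2^-1 : R) <= 1 by apply/andP; split; lra.
apply: nondecreasing_is_cvgn.
  apply/nondecreasing_seqP => n; rewrite /smooth_step expnS mulnC exprM -[leRHS]exprM mulnC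
    exprM.
  apply: lerXn2r; rewrite ?nnegrE.
  - by rewrite subr_ge0 exprn_ile1//; lra.
  - by rewrite exprn_ge0// subr_ge0 exprn_ile1//; lra.
  rewrite expr2 (exprS 2^-1 n); set z := 2^-1 ^+ n; have := sqr_ge0 z.
  by rewrite expr2; nra.
exists 1 => _ [n _ <-]; by have /andP[] := smooth_step_itv n h1.
Qed.

End threshold.

Section multipliers.
Context {R : realType}.
Local Open Scope ereal_scope.
Local Opaque leb13.
Variable K : R.
Hypothesis K0 : (0 < K)%R.
Hypothesis PK : forall u : spacetime R -> R[i], cmeas u -> mass leb13 u < +oo ->
  energy leb13 u < +oo ->
  cmeas (fourier1 u) /\ energy leb13 (fourier1 u) = K%:E * energy leb13 u.
Variable w : vec3 R.
Implicit Types (v : spacetime R -> R[i]) (X : spacetime R) (phi : R -> R).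

(** A bounded measurable symbol keeps the product square-integrable, so that [fourier_range] can
    hold for it. *)
Definition multiplier phi := [/\ measurable_fun setT phi,
  exists B, forall t, (`|phi t| <= B)%R &
  forall v, fourier_range v ->
    fourier_range (fun X => (phi (dot3 X.2 w))%:C%C * v X)%R].

Lemma measurable_freq : measurable_fun setT (fun X : spacetime R => dot3 X.2 w).
Proof. by apply: measurable_dot3; [exact: measurable_snd|exact: measurable_cst]. Qed.

Lemma cmeas_multiplier phi v : measurable_fun setT phi -> cmeas v ->
  cmeas (fun X => (phi (dot3 X.2 w))%:C%C * v X)%R.
Proof.
move=> mphi mv; apply: cmeasM => //.
by apply: cmeas_real; exact: (measurableT_comp mphi measurable_freq).
Qed.

Lemma multiplierD p q : multiplier p -> multiplier q ->
  multiplier (fun t => p t + q t)%R.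
Proof.
move=> [mp [B pB] rp] [mq [C qC] rq]; split.
- exact: measurable_funD.
- exists (B + C)%R => t; exact: le_trans (ler_normD _ _) (lerD (pB t) (qC t)).
- move=> v rv; have := fourier_rangeD PK (rp v rv) (rq v rv).
  rewrite (_ : (fun _ => _) = (fun X => ((p (dot3 X.2 w) + q (dot3 X.2 w))%:C)%C * v X)%R)//.
  by apply/funext => X; rewrite -mulrDl -rmorphD.
Qed.

Lemma multiplierM p q : multiplier p -> multiplier q ->
  multiplier (fun t => p t * q t)%R.
Proof.
move=> [mp [B pB] rp] [mq [C qC] rq]; split.
- exact: measurable_funM.
- exists (B * C)%R => t; rewrite normrM ler_pM//.
- move=> v rv; have := rp _ (rq v rv).
  rewrite (_ : (fun _ => _) = (fun X => ((p (dot3 X.2 w) * q (dot3 X.2 w))%:C)%C * v X)%R)//.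
  by apply/funext => X; rewrite mulrA -rmorphM.
Qed.

Lemma multiplier_cst c : multiplier (fun=> c).
Proof.
split; first exact: measurable_cst.
- by exists `|c|%R.
- by move=> v rv; exact: (fourier_rangeZ PK).
Qed.

Lemma multiplierX p n : multiplier p -> multiplier (fun t => p t ^+ n)%R.
Proof.
move=> mp; elim: n => [|n ih].
  by under eq_fun do rewrite expr0; exact: multiplier_cst.
by under eq_fun do rewrite exprS; exact: multiplierM.
Qed.

Lemma multiplierB p q : multiplier p -> multiplier q ->
  multiplier (fun t => p t - q t)%R.
Proof.
move=> mp mq; have := multiplierD mp (multiplierM (multiplier_cst (-1)%R) mq).
by under eq_fun do rewrite mulN1r.
Qed.

Lemma multiplier_cos (t c : R) : multiplier (fun s => cos (t * (s - c)))%R.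
Proof.
split.
- have h : measurable_fun setT (fun s : R => (s - c) * t)%R.
    by apply: measurable_funM => //; exact: measurable_funB.
  under eq_fun do rewrite mulrC.
  by apply: measurableT_comp h; apply: continuous_measurable_fun; exact: continuous_cos.
- by exists 1%R => s; exact: cos_max.
move=> v rv.
pose s (a : R) : spacetime R := (0, scale3 a w)%R.
have phE a X : phase (s a) X = cis (a * dot3 X.2 w)%R.
  by rewrite /phase /= mulr0 add0r; congr cis; rewrite /dot3 /=; ring.
have := fourier_rangeD PK
  (fourier_rangeZ PK (cis (- (t * c)) * (2^-1)%:C%C)%R (fourier_range_phase (s t) rv))
  (fourier_rangeZ PK (cis (t * c) * (2^-1)%:C%C)%R (fourier_range_phase (s (- t)%R) rv)).
rewrite (_ : (fun _ => _) = (fun X => (cos (t * (dot3 X.2 w - c)))%:C%C * v X)%R)//.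
apply/funext => X; rewrite !phE !mulrA -mulrDl; congr (_ * _)%R.
rewrite ![(cis _ * (2^-1)%:C%C * cis _)%R]mulrAC -!cisD -mulrDl.
rewrite [(t * c + _)%R](_ : _ = - (t * (dot3 X.2 w - c)))%R; last by ring.
rewrite [(- (t * c) + _)%R](_ : _ = t * (dot3 X.2 w - c))%R; last by ring.
rewrite /cis cosN sinN; apply/eqP; rewrite eq_complex; apply/andP; split; apply/eqP.
- by rewrite ReM ReD ImD /=; field.
- by rewrite ImM ReD ImD /=; field.
Qed.

(** By dominated convergence the products converge in $L^2$, where [fourier_range] is closed. *)
Lemma multiplier_lim (p : nat -> R -> R) (q : R -> R) (B : R) :
  (forall n, multiplier (p n)) -> (forall n t, (`|p n t| <= B)%R) ->
  (forall t, p n t @[n --> \oo] --> q t)%R -> multiplier q.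
Proof.
move=> mp pB pq.
have mpn n : measurable_fun setT (p n) by case: (mp n).
have mq : measurable_fun setT q.
  by apply: (measurable_fun_cvg mpn) => t _; exact: pq.
have qB t : (`|q t| <= B)%R.
  have h : (`|p n t| @[n --> \oo] --> `|q t|)%R by apply: cvg_norm; exact: pq.
  by apply: (cvgr_to_le h); near=> n; exact: pB.
have B0 : (0 <= B)%R by exact: le_trans (qB 0%R).
split => //; first by exists B.
move=> v rv; have [mv voo _] := rv.
have mqv := cmeas_multiplier mq mv.
have csqR (a : R) z : csq (a%:C%C * z)%R = (a ^+ 2 * csq z)%R.
  by rewrite csqM /csq /= expr0n addr0.
apply: (fourier_range_lim PK) => //.
  apply: (@le_lt_trans _ _ ((B ^+ 2)%:E * energy leb13 v)).
    rewrite /energy -ge0_integralZl//; last 3 first.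
    - exact: measurable_Ecsq.
    - by move=> x _; rewrite lee_fin csq_ge0.
    - by rewrite lee_fin sqr_ge0.
    apply: ge0_le_integral => //.
    - by move=> x _; rewrite lee_fin csq_ge0.
    - exact: measurable_Ecsq.
    - by apply: measurable_funeM; exact: measurable_Ecsq.
    - move=> x _; rewrite csqR -EFinM lee_fin ler_wpM2r ?csq_ge0//.
      by rewrite -real_normK ?num_real// ler_pXn2r ?nnegrE.
  by rewrite lte_mul_pinfty// lee_fin sqr_ge0.
move=> e e0.
have [] := @dominated_convergence _ _ _ (@leb13 R) setT measurableT
  (fun n X => (csq ((p n (dot3 X.2 w))%:C%C * v X - (q (dot3 X.2 w))%:C%C * v X)%R)%:E)
  (cst 0) (fun X => ((2 * B) ^+ 2)%:E * (csq (v X))%:E).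
- by move=> n; apply: measurable_Ecsq; apply: cmeasB => //; exact: cmeas_multiplier.
- exact: measurable_cst.
- apply: aeW => X _; under eq_fun do rewrite -mulrBl -rmorphB csqR.
  apply: cvg_EFin; first by near=> n.
  rewrite /comp /=; have -> : nbhs (0 : R)%R = nbhs ((0 : R) ^+ 2 * csq (v X))%R.
    by rewrite expr0n mul0r.
  apply: cvgM; last exact: cvg_cst.
  have h : (p n (dot3 X.2 w) - q (dot3 X.2 w) @[n --> \oo] --> (0 : R))%R.
    rewrite -(subrr (q (dot3 X.2 w))); apply: cvgB; [exact: pq|exact: cvg_cst].
  by rewrite expr2; under eq_fun do rewrite expr2; exact: cvgM.
- apply: integrableZl => //; apply/integrableP; split; first exact: measurable_Ecsq.
  by under eq_integral do rewrite gee0_abs ?lee_fin ?csq_ge0//.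
- apply: aeW => X n _; rewrite gee0_abs ?lee_fin ?csq_ge0//.
  rewrite -mulrBl -rmorphB csqR ler_wpM2r ?csq_ge0//.
  rewrite -real_normK ?num_real// ler_pXn2r ?nnegrE ?mulr_ge0//.
  by apply: le_trans (ler_normB _ _) _; rewrite mulrDl mul1r lerD.
move=> _ _; rewrite integral0 => /ecvg0P h.
have {}h := h (fun n => energy_ge0 _ _) e e0.
have [n _ hn] := h.
exists (fun X => (p n (dot3 X.2 w))%:C%C * v X)%R.
  by have [_ _] := mp n; apply.
exact: hn n (leqnn n).
Unshelve. all: by end_near. Qed.

(** A superlevel set of a cosine, that is, a periodic family of arcs. The equation for [L] records
    that this boundary value is the same for all [t], [c] and [h], as is needed to let [t] vary. *)
Lemma multiplier_arc (t c h : R) :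
  exists2 L : R, (0 <= L <= 1)%R & multiplier (fun s =>
    if (cos (t * h) < cos (t * (s - c)))%R then 1%R else
    if (cos (t * h) == cos (t * (s - c)))%R then L else 0%R) /\
    L = limn (fun n => smooth_step n (2^-1 : R)).
Proof.
(* An affine image of the cosine with values in $[0,1]$, equal to $1/2$ exactly where the two
   cosines agree. *)
pose x s := (2^-1 + 4^-1 * (cos (t * h) - cos (t * (s - c))))%R.
have x01 s : (0 <= x s <= 1)%R.
  have := cos_le1 (t * h)%R; have := cos_geN1 (t * h)%R.
  have := cos_le1 (t * (s - c))%R; have := cos_geN1 (t * (s - c))%R.
  by rewrite /x; move=> *; apply/andP; split; lra.
have Lcvg := @smooth_step_half_cvg R.
exists (limn (fun n => smooth_step n (2^-1 : R))).
  have h12 : (0 <= (2^-1 : R) <= 1)%R by apply/andP; split; lra.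
  apply/andP; split.
  - by apply: limr_ge => //; near=> n; have /andP[] := smooth_step_itv n h12.
  - by apply: limr_le => //; near=> n; have /andP[] := smooth_step_itv n h12.
split => //.
apply: (@multiplier_lim (fun n s => smooth_step n (x s)) _ 1).
- move=> n; apply: multiplierX; apply: multiplierB; first exact: multiplier_cst.
  apply: multiplierX; apply: multiplierD; first exact: multiplier_cst.
  apply: multiplierM; first exact: multiplier_cst.
  apply: multiplierB; first exact: multiplier_cst.
  exact: multiplier_cos.
- by move=> n s; have /andP[? ?] := smooth_step_itv n (x01 s); rewrite ger0_norm.
move=> s; have /andP[x0 x1] := x01 s; case: ltrgtP => h3.
- apply: smooth_step_lt; rewrite x0 /=; rewrite /x; lra.
- apply: smooth_step_gt; rewrite x1 andbT; rewrite /x; lra.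
- by rewrite /x h3 subrr mulr0 addr0.
Unshelve. all: by end_near. Qed.

(** Let the frequency $t=1/(n+1)$ of the arcs tend to 0. For fixed [s], both $th$ and $t|s-c|$
    eventually lie in $[0,\pi]$, where the cosine decreases, so only the arc around [c] remains. *)
Lemma multiplier_itv_open (c h : R) : (0 < h)%R ->
  exists2 L : R, (0 <= L <= 1)%R & multiplier (fun s =>
    if (`|s - c| < h)%R then 1%R else if (`|s - c| == h)%R then L else 0%R).
Proof.
move=> h0.
pose L := limn (fun n => smooth_step n (2^-1 : R)).
have arc n : multiplier (fun s =>
    if (cos (n.+1%:R^-1 * h) < cos (n.+1%:R^-1 * (s - c)))%R then 1%R else
    if (cos (n.+1%:R^-1 * h) == cos (n.+1%:R^-1 * (s - c)))%R then L else 0%R).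
  by have [L' _ [mL LE]] := multiplier_arc n.+1%:R^-1 c h; rewrite /L -LE.
have L01 : (0 <= L <= 1)%R by have [L' L'01 [_ LE]] := multiplier_arc 1 c h; rewrite /L -LE.
have /andP[L0 L1] := L01.
exists L => //.
apply: (multiplier_lim (B := 1%R) arc).
  by move=> n t; case: ifP => _; [|case: ifP => _]; rewrite ?normr1 ?normr0// ger0_norm.
move=> s; apply: cvg_near_cst.
have ev (a : R) : (0 <= a)%R -> \forall n \near \oo, (0 <= n.+1%:R^-1 * a <= pi)%R.
  move=> a0; near=> n.
  rewrite mulr_ge0 ?invr_ge0//= mulrC ler_pdivrMr//.
  apply: (@le_trans _ _ (pi * n%:R)%R); last by rewrite ler_pM2l ?pi_gt0// ler_nat.
  rewrite mulrC -ler_pdivrMr ?pi_gt0//.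
  near: n; exact: nbhs_infty_ger.
have := ev h (ltW h0); have := ev `|s - c|%R (normr_ge0 _).
apply: filterS2 => n sn hn.
have -> : cos (n.+1%:R^-1 * (s - c))%R = cos (n.+1%:R^-1 * `|s - c|)%R.
  by rewrite -[LHS]cos_norm normrM [X in (X * _)%R]ger0_norm.
have n0 : (0 < n.+1%:R^-1 :> R)%R by rewrite invr_gt0.
have cl (a b : R) : (0 <= n.+1%:R^-1 * a <= pi)%R -> (0 <= n.+1%:R^-1 * b <= pi)%R ->
   (cos (n.+1%:R^-1 * a) < cos (n.+1%:R^-1 * b))%R = (b < a)%R.
  by move=> ha hb; rewrite ltr_cos ?in_itv//= ltr_pM2l.
rewrite cl//; case: ltrgtP => sh.
- by [].
- by have := cl _ _ sn hn; rewrite sh => cc; rewrite gt_eqF.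
- by rewrite sh eqxx.
Unshelve. all: by end_near. Qed.

(** The interval is approached from outside: a point of $[a,b]$ lies strictly inside every enlarged
    interval, any other point eventually lies strictly outside. The value at the ends thus drops
    out, and $a=b$ is covered. *)
Lemma multiplier_itv (a b : R) : (a <= b)%R ->
  multiplier (\1_(`[a, b]%classic) : R -> R).
Proof.
move=> ab; pose c := ((a + b) / 2)%R; pose h := ((b - a) / 2)%R.
have h0 : (0 <= h)%R by rewrite divr_ge0// subr_ge0.
have hn n : (0 < h + n.+1%:R^-1)%R by rewrite ltr_wpDl// invr_gt0.
have /choice[L LP] : forall n, exists L : R, (0 <= L <= 1)%R /\ multiplier (fun s =>
    if (`|s - c| < h + n.+1%:R^-1)%R then 1%R else
    if (`|s - c| == h + n.+1%:R^-1)%R then L else 0%R).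
  by move=> n; have [L ? ?] := multiplier_itv_open c (hn n); exists L.
apply: (@multiplier_lim _ _ 1 (fun n => (LP n).2)).
  move=> n t; have [/andP[L0 L1] _] := LP n.
  by case: ifP => _; [|case: ifP => _]; rewrite ?normr1 ?normr0// ger0_norm.
move=> s; apply: cvg_near_cst.
have E : (s \in `[a, b]%classic) = (`|s - c| <= h)%R.
  rewrite mem_setE in_itv/= ler_distl /c /h.
  by congr (_ && _); apply/idP/idP => ?; lra.
rewrite indicE E; have [sh|sh] := lerP `|s - c|%R h.
  by near=> n; rewrite (le_lt_trans sh)// ltrDl invr_gt0.
have d0 : (0 < `|s - c| - h)%R by rewrite subr_gt0.
have := near_infty_natSinv_lt (PosNum d0); apply: filterS => n /=.
rewrite ltrBrDl => hs; rewrite ltNge (ltW hs) /=.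
by rewrite gt_eqF.
Unshelve. all: by end_near. Qed.

End multipliers.

(** * Transforms picked by choice and projections *)

Section projections.
Context {R : realType}.
Local Open Scope ereal_scope.
Local Opaque leb13.
Variable K : R.
Hypothesis K0 : (0 < K)%R.
Hypothesis PK : forall u : spacetime R -> R[i], cmeas u -> mass leb13 u < +oo ->
  energy leb13 u < +oo ->
  cmeas (fourier1 u) /\ energy leb13 (fourier1 u) = K%:E * energy leb13 u.
Implicit Types (u v : spacetime R -> R[i]) (X : spacetime R).

Lemma fourier_cases u : is_fourier u (fourier u) \/
  ((~ exists v, is_fourier u v) /\ fourier u = (fun=> 0%R)).
Proof.
rewrite /fourier; have [[v uv]|h] := pselect (exists v, is_fourier u v).
  by left; exact: (xgetPex _ (ex_intro [set v | is_fourier u v] v uv)).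
by right; split => //; apply: xgetPN => v uv; apply: h; exists v.
Qed.

Lemma inv_fourier_cases v : is_fourier (inv_fourier v) v \/
  ((~ exists u, is_fourier u v) /\ inv_fourier v = (fun=> 0%R)).
Proof.
rewrite /inv_fourier; have [[u uv]|h] := pselect (exists u, is_fourier u v).
  by left; exact: (xgetPex _ (ex_intro [set u | is_fourier u v] u uv)).
by right; split => //; apply: xgetPN => u uv; apply: h; exists u.
Qed.

Lemma energy0 : energy (@leb13 R) (fun=> 0%R) = 0.
Proof. by apply: integral0_eq => X _; rewrite csq0. Qed.

Lemma fourier_L2 u : cmeas (fourier u) /\ energy leb13 (fourier u) < +oo.
Proof.
have [/is_fourierP[_ [mv voo] _]|[_ ->]] := fourier_cases u; first by [].
by rewrite energy0; split => //; exact: cmeas_cst.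
Qed.

Lemma energy_fourier_le u : energy leb13 (fourier u) <= (4 * K)%:E * energy leb13 u.
Proof.
have [/(fourier_upper K0 PK)//|[_ ->]] := fourier_cases u.
by rewrite energy0 mule_ge0 ?energy_ge0// lee_fin mulr_ge0// ltW.
Qed.

Lemma energy_inv_fourier_le v :
  energy leb13 (inv_fourier v) <= (4 / K)%:E * energy leb13 v.
Proof.
have [/(fourier_lower K0 PK)//|[_ ->]] := inv_fourier_cases v.
by rewrite energy0 mule_ge0 ?energy_ge0// lee_fin divr_ge0// ltW.
Qed.

(** If [v] is not a transform, [inv_fourier v] is the default 0, whose transform vanishes almost
    everywhere. Either outcome is fine for a bound from above by [v]. *)
Lemma fourier_inv_fourier v :
  {ae leb13, forall X, fourier (inv_fourier v) X = v X} \/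
  {ae leb13, forall X, fourier (inv_fourier v) X = 0%R}.
Proof.
have [h|[_ ->]] := inv_fourier_cases v.
- left; have [h'|[nex _]] := fourier_cases (inv_fourier v).
    exact: (is_fourier_uniq K0 PK h' h).
  by exfalso; apply: nex; exists v.
- right; have [h|[_ ->]] := fourier_cases (fun=> 0%R).
    exact: (is_fourier0 K0 PK h).
  exact: aeW.
Qed.

(** A bound of the projection from below: [multiplier_itv] ensures that the truncated transform has
    a preimage, so [inv_fourier] does not fall back on 0. *)
Lemma energy_slab_le (w : vec3 R) (a b : R) u : (a <= b)%R ->
  energy leb13 (fun X => (\1_(slab w `[a, b]%classic) X)%:C%C * fourier u X)%R <=
  (4 * K)%:E * energy leb13 (fproj (slab w `[a, b]%classic) u).
Proof.
move=> ab.
have [uv|[_ ->]] := fourier_cases u; last first.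
  rewrite [X in X <= _](_ : _ = 0); last first.
    by apply: integral0_eq => X _; rewrite mulr0 csq0.
  by rewrite mule_ge0 ?energy_ge0// lee_fin mulr_ge0// ltW.
have [_ _ rg] := multiplier_itv PK w ab.
have /(fourier_range_ex K0 PK)[u' hu'] := rg _ (is_fourier_range uv).
rewrite /fproj; set v := (fun X => _) in hu'.
rewrite (_ : (fun X => (\1_(slab w `[a, b]%classic) X)%:C%C * fourier u X)%R = v)//.
have [/(fourier_upper K0 PK)//|[nex _]] := inv_fourier_cases v.
by exfalso; apply: nex; exists u'.
Qed.

End projections.

(** * The kernel of the bilinear operator *)

Section line_integral.
Context {R : realType}.
Local Notation mu := (@lebesgue_measure R).
Implicit Types s t : R.

(* A smooth majorant of the indicator of [|t - tau| <= M] whose primitive is an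
   arctangent. *)
Definition bump (tau M t : R) : R := 2 / (1 + ((t - tau) / M) ^+ 2).

Lemma bump_ge0 tau M t : 0 <= bump tau M t.
Proof. by rewrite divr_ge0// addr_ge0// sqr_ge0. Qed.

Lemma bump_ge1 tau M t : 0 < M -> `|t - tau| <= M -> 1 <= bump tau M t.
Proof.
move=> M0 tM; rewrite /bump ler_pdivlMr ?ltr_pwDl ?sqr_ge0// mul1r.
have : ((t - tau) / M) ^+ 2 <= 1.
  rewrite -real_normK ?num_real// exprn_ile1// normrM [X in _ * X]ger0_norm ?invr_ge0 ?(ltW
    M0)//.
  by rewrite ler_pdivrMr// mul1r.
by lra.
Qed.

Lemma continuous_bump tau M : continuous (bump tau M).
Proof.
move=> t; apply: cvgM; first exact: cvg_cst.
apply: cvgV; first by rewrite gt_eqF// ltr_pwDl ?sqr_ge0.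
apply: cvgD; first exact: cvg_cst.
apply: (@continuous_comp _ _ _ (fun x => (x - tau) / M) (fun x => x ^+ 2));
  last exact: exprn_continuous.
by apply: cvgM; [apply: cvgB; [exact: cvg_id|exact: cvg_cst]|exact: cvg_cst].
Qed.

(** The integrand is the derivative of $2M\arctan((F-\tau)/M)$, whose total increase is below $2\pi
    M$ whatever [F] does. *)
Lemma integral_bump_pos (F G : R -> R) (tau M x y : R) : 0 < M -> x <= y ->
  (forall s, is_derive s 1 F (G s)) -> continuous G ->
  (forall s, x <= s <= y -> 0 <= G s) ->
  (\int[mu]_(s in `[x, y]) (`|G s| * bump tau M (F s))%:E <= (2 * pi * M)%:E)%E.
Proof.
move=> M0 xy dF cG G0.
have [->|xney] := eqVneq x y.
  rewrite set_itv1 integral_set1 lee_fin.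
  by rewrite !mulr_ge0 ?pi_ge0 ?(ltW M0).
have {}xy : x < y by rewrite lt_neqAle xney.
have cF : continuous F.
  by move=> s; have [d _] := dF s; apply: differentiable_continuous; apply/derivable1_diffP.
pose P s := 2 * M * atan ((F s - tau) / M).
have dP s : is_derive s 1 P (G s * bump tau M (F s)).
  have d1 : is_derive s 1 (fun u => (F u - tau) / M) (G s / M).
    have := is_deriveM (is_deriveB (dF s) (is_derive_cst tau s 1)) (is_derive_cst M^-1 s 1).
    move/is_derive_eq; apply.
    by rewrite scaler0 add0r subr0 /GRing.scale /= mulrC.
  have d2 := @is_derive1_comp _ (@atan R) (fun u => (F u - tau) / M) s _ _
    (is_derive1_atan _) d1.
  have := is_deriveM (is_derive_cst (2 * M) s 1) d2.
  move/is_derive_eq; apply.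
  rewrite scaler0 addr0 /GRing.scale /= /bump.
  have n1 : 1 + ((F s - tau) / M) ^+ 2 != 0 by rewrite gt_eqF// ltr_pwDl ?sqr_ge0.
  have M' : M != 0 by rewrite gt_eqF.
  set u := (F s - tau) / M in n1 *.
  by field; rewrite n1.
have cP : continuous P.
  by move=> s; have [d _] := dP s; apply: differentiable_continuous; apply/derivable1_diffP.
have -> : (\int[mu]_(s in `[x, y]) (`|G s| * bump tau M (F s))%:E =
   \int[mu]_(s in `[x, y]) (G s * bump tau M (F s))%:E)%E.
  by apply: eq_integral => s; rewrite inE/= in_itv/= => /G0 ?; rewrite ger0_norm.
rewrite (@continuous_FTC2 _ _ P)//.
- rewrite -EFinB lee_fin /P -mulrBr.
  have := atan_ltpi2 ((F y - tau) / M); have := atan_gtNpi2 ((F x - tau) / M).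
  move=> a1 a2; rewrite [leRHS](_ : _ = 2 * M * pi); last by ring.
  by rewrite ler_pM2l ?mulr_gt0//; lra.
- apply: continuous_subspaceT => s; apply: cvgM; first exact: cG.
  by apply: continuous_comp; [exact: cF|exact: continuous_bump].
- split.
  + by move=> s _; have [] := dP s.
  + by apply: cvg_at_right_filter; exact: cP.
  + by apply: cvg_at_left_filter; exact: cP.
- by move=> s _; rewrite derive1E; exact: (@derive_val _ _ _ _ _ _ _ (dP s)).
Qed.

Lemma integral_bump_sign (F G : R -> R) (tau M x y : R) : 0 < M -> x <= y ->
  (forall s, is_derive s 1 F (G s)) -> continuous G ->
  (forall s, x <= s <= y -> 0 <= G s) \/ (forall s, x <= s <= y -> G s <= 0) ->
  (\int[mu]_(s in `[x, y]) (`|G s| * bump tau M (F s))%:E <= (2 * pi * M)%:E)%E.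
Proof.
move=> M0 xy dF cG [G0|G0]; first exact: integral_bump_pos.
have dN s : is_derive s 1 (fun u => - F u) (- G s) by exact: is_deriveN.
have cN : continuous (fun u => - G u) by move=> s; apply: cvgN; exact: cG.
have GN s : x <= s <= y -> 0 <= - G s by move=> /G0; rewrite oppr_ge0.
apply: le_trans (integral_bump_pos (- tau) M0 xy dN cN GN).
rewrite le_eqVlt; apply/orP; left; apply/eqP.
apply: eq_integral => s _; rewrite normrN /bump.
by rewrite -opprD mulNr sqrrN.
Qed.

Lemma integral_bump_affine (F G : R -> R) (tau M B al be : R) : 0 < M -> 0 <= B ->
  (forall s, is_derive s 1 F (G s)) -> continuous G ->
  (forall s, 0 <= al * s + be -> 0 <= G s) ->
  (forall s, al * s + be <= 0 -> G s <= 0) ->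
  (\int[mu]_(s in `[(- B)%R, B]) (`|G s| * bump tau M (F s))%:E <= (4 * pi * M)%:E)%E.
Proof.
move=> M0 B0 dF cG Gp Gn.
(* [z] is the zero of the affine function, moved to an end of the interval when it lies outside; for
   [al = 0] the sign is constant and an end will do. *)
have [z [/andP[zB1 zB2] s1 s2]] : exists z, [/\ - B <= z <= B,
    (forall s, - B <= s <= z -> 0 <= G s) \/ (forall s, - B <= s <= z -> G s <= 0) &
    (forall s, z <= s <= B -> 0 <= G s) \/ (forall s, z <= s <= B -> G s <= 0)].
  have [al0|al0|al0] := ltgtP al 0.
  - have [h|h] := lerP (- be / al) (- B).
      exists (- B); split; first by apply/andP; split; lra.
        by right => s /andP[h1 h2]; apply: Gn; move: h; rewrite ler_ndivrMr//; nra.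
      by right => s /andP[h1 h2]; apply: Gn; move: h; rewrite ler_ndivrMr//; nra.
    have [h'|h'] := lerP B (- be / al).
      exists B; split; first by apply/andP; split; lra.
        by left => s /andP[h1 h2]; apply: Gp; move: h'; rewrite ler_ndivlMr//; nra.
      by left => s /andP[h1 h2]; apply: Gp; move: h'; rewrite ler_ndivlMr//; nra.
    have E : al * (- be / al) = - be by field; rewrite lt_eqF.
    exists (- be / al); split; first by rewrite !ltW.
      by left => s /andP[h1 h2]; apply: Gp; nra.
    by right => s /andP[h1 h2]; apply: Gn; nra.
  - have [h|h] := lerP (- be / al) (- B).
      exists (- B); split; first by apply/andP; split; lra.
        by left => s /andP[h1 h2]; apply: Gp; move: h; rewrite ler_pdivrMr//; nra.
      by left => s /andP[h1 h2]; apply: Gp; move: h; rewrite ler_pdivrMr//; nra.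
    have [h'|h'] := lerP B (- be / al).
      exists B; split; first by apply/andP; split; lra.
        by right => s /andP[h1 h2]; apply: Gn; move: h'; rewrite ler_pdivlMr//; nra.
      by right => s /andP[h1 h2]; apply: Gn; move: h'; rewrite ler_pdivlMr//; nra.
    have E : al * (- be / al) = - be by field; rewrite gt_eqF.
    exists (- be / al); split; first by rewrite !ltW.
      by right => s /andP[h1 h2]; apply: Gn; nra.
    by left => s /andP[h1 h2]; apply: Gp; nra.
  - exists B; split; first by apply/andP; split; lra.
      have [b0|b0] := lerP 0 be.
        by left => s _; apply: Gp; rewrite al0 mul0r add0r.
      by right => s _; apply: Gn; rewrite al0 mul0r add0r ltW.
    have [b0|b0] := lerP 0 be.
      by left => s _; apply: Gp; rewrite al0 mul0r add0r.
    by right => s _; apply: Gn; rewrite al0 mul0r add0r ltW.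
have cF : continuous F.
  by move=> s; have [d _] := dF s; apply: differentiable_continuous; apply/derivable1_diffP.
have mI : measurable_fun setT (fun s : R => (`|G s| * bump tau M (F s))%:E).
  apply/measurable_EFinP; apply: continuous_measurable_fun => s.
  apply: cvgM; first by apply: cvg_norm; exact: cG.
  by apply: continuous_comp; [exact: cF|exact: continuous_bump].
have I0 s : (0 <= (`|G s| * bump tau M (F s))%:E)%E.
  by rewrite lee_fin mulr_ge0// bump_ge0.
apply: (@le_trans _ _ (\int[mu]_(s in `[(- B)%R, z] `|` `[z, B])
    (`|G s| * bump tau M (F s))%:E)%E).
  apply: ge0_subset_integral => //.
  - exact: measurableU.
  - exact: measurable_funTS.
  - move=> s /=; rewrite !in_itv/= => /andP[h1 h2].
    by have [h|h] := lerP s z; [left|right]; rewrite ?h1 ?h2 ?h ?(ltW h).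
apply: le_trans (_ : _ <= (2 * pi * M)%:E + (2 * pi * M)%:E)%E _; last first.
  by rewrite -EFinD lee_fin; lra.
apply: le_trans (leeD (integral_bump_sign tau M0 zB1 dF cG s1)
  (integral_bump_sign tau M0 zB2 dF cG s2)).
rewrite [leLHS]integral_mkcond [X in (_ <= X + _)%E]integral_mkcond.
rewrite [X in (_ <= _ + X)%E]integral_mkcond -ge0_integralD//.
- apply: ge0_le_integral => //.
  + by move=> s _; rewrite patchE; case: ifP.
  + apply/(measurable_restrictT _ _).1; first exact: measurableU.
    exact: measurable_funTS.
  + apply: emeasurable_funD; apply/(measurable_restrictT _ _).1 => //;
    exact: measurable_funTS.
  + move=> s _; rewrite !patchE in_setU.
    by case: (s \in `[(- B)%R, z]%classic); case: (s \in `[z, B]%classic) => //=;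
      rewrite ?adde0 ?add0e// leeDl.
- by move=> s _; rewrite patchE; case: ifP.
- apply/(measurable_restrictT _ _).1 => //; exact: measurable_funTS.
- by move=> s _; rewrite patchE; case: ifP.
- apply/(measurable_restrictT _ _).1 => //; exact: measurable_funTS.
Qed.

(** Here $y_i/h_i=\sqrt a\,\varphi(y_i/\sqrt{D_i})$ with the odd increasing function
    $\varphi(t)=t/\sqrt{1+t^2}$. So the sum has the sign of $y_1/\sqrt{D_1}+y_2/\sqrt{D_2}$. *)
Lemma weighted_sum_ge0 (y1 y2 D1 D2 h1 h2 : R) : 0 < D1 -> 0 < D2 -> 0 < h1 -> 0 < h2 ->
  forall a, 0 < a -> a * h1 ^+ 2 = y1 ^+ 2 + D1 -> a * h2 ^+ 2 = y2 ^+ 2 + D2 ->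
  0 <= y1 * Num.sqrt D2 + y2 * Num.sqrt D1 -> 0 <= y1 / h1 + y2 / h2.
Proof.
move=> D10 D20 h10 h20 a a0 e1 e2.
have d1 : 0 < Num.sqrt D1 by rewrite sqrtr_gt0.
have d2 : 0 < Num.sqrt D2 by rewrite sqrtr_gt0.
have q1 : Num.sqrt D1 ^+ 2 = D1 by rewrite sqr_sqrtr// ltW.
have q2 : Num.sqrt D2 ^+ 2 = D2 by rewrite sqr_sqrtr// ltW.
move=> l0.
rewrite (_ : y1 / h1 + y2 / h2 = (y1 * h2 + y2 * h1) / (h1 * h2)); last first.
  by field; rewrite !gt_eqF.
rewrite divr_ge0 ?mulr_ge0 ?(ltW h10) ?(ltW h20)//.
(* The case of opposite signs: both inequalities compare nonnegative quantities once [u] is moved to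
   the other side, and squaring makes them equivalent. *)
have cmp u v du dv hu hv : 0 < du -> 0 < dv -> 0 < hu -> 0 < hv -> u < 0 -> 0 <= v ->
    a * hu ^+ 2 = u ^+ 2 + du ^+ 2 -> a * hv ^+ 2 = v ^+ 2 + dv ^+ 2 ->
    0 <= u * dv + v * du -> 0 <= u * hv + v * hu.
  move=> du0 dv0 hu0 hv0 u0 v0 eu ev uv.
  rewrite addrC -[u]opprK mulNr subr_ge0.
  have nu : 0 <= - u by lra.
  rewrite -(@ler_pXn2r _ 2) ?nnegrE ?mulr_ge0 ?(ltW hu0) ?(ltW hv0)//.
  rewrite -(ler_pM2l a0) !exprMn [a * (_ * _)]mulrCA ev [a * (_ * _)]mulrCA eu.
  have : (- u * dv) ^+ 2 <= (v * du) ^+ 2.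
    by rewrite ler_pXn2r ?nnegrE ?mulr_ge0 ?(ltW du0) ?(ltW dv0)//; lra.
  by rewrite !exprMn sqrrN; nra.
have [y10|y10] := lerP 0 y1.
  have [y20|y20] := lerP 0 y2; first by rewrite addr_ge0// mulr_ge0// ltW.
  rewrite addrC; apply: (cmp y2 y1 (Num.sqrt D2) (Num.sqrt D1)); rewrite ?q1 ?q2//.
  by rewrite addrC.
have [y20|y20] := lerP 0 y2; last by nra.
by apply: (cmp y1 y2 (Num.sqrt D1) (Num.sqrt D2)); rewrite ?q1 ?q2.
Qed.

(** The norm of a point that moves along a line with parameter [s]. *)
Definition sqrt_quad (a b c s : R) : R := Num.sqrt (a * s ^+ 2 + 2 * b * s + c).

(* With [D_i = a c_i - b_i^2], the derivative of the phase has the sign of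
   [e1 (a s + b1) sqrt D2 + e2 (a s + b2) sqrt D1], which is affine in [s]. *)
Lemma line_bound (a b1 c1 b2 c2 e1 e2 tau M B : R) : 0 < M -> 0 <= B -> 0 < a ->
  b1 ^+ 2 < a * c1 -> b2 ^+ 2 < a * c2 -> e1 ^+ 2 = 1 -> e2 ^+ 2 = 1 ->
  (\int[mu]_(s in `[(- B)%R, B])
    (`|e1 * (a * s + b1) / sqrt_quad a b1 c1 s + e2 * (a * s + b2) / sqrt_quad a b2 c2 s| *
     bump tau M (e1 * sqrt_quad a b1 c1 s + e2 * sqrt_quad a b2 c2 s))%:E <= (4 * pi * M)%:E)%E.
Proof.
move=> M0 B0 a0 D1 D2 e11 e21; rewrite /sqrt_quad.
set h1 := fun s => Num.sqrt (a * s ^+ 2 + 2 * b1 * s + c1).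
set h2 := fun s => Num.sqrt (a * s ^+ 2 + 2 * b2 * s + c2).
have pos b c s : b ^+ 2 < a * c -> 0 < a * s ^+ 2 + 2 * b * s + c.
  move=> D; rewrite -(pmulr_rgt0 _ a0).
  have -> : a * (a * s ^+ 2 + 2 * b * s + c) = (a * s + b) ^+ 2 + (a * c - b ^+ 2) by ring.
  by rewrite ltr_wpDl ?sqr_ge0// subr_gt0.
have hsq b c s : b ^+ 2 < a * c ->
    a * Num.sqrt (a * s ^+ 2 + 2 * b * s + c) ^+ 2 = (a * s + b) ^+ 2 + (a * c - b ^+ 2).
  by move=> D; rewrite sqr_sqrtr ?(ltW (pos _ _ _ D))//; ring.
have dh b c s : b ^+ 2 < a * c ->
    is_derive s 1 (fun s => Num.sqrt (a * s ^+ 2 + 2 * b * s + c))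
      ((a * s + b) / Num.sqrt (a * s ^+ 2 + 2 * b * s + c)).
  move=> D; have p := pos _ _ s D.
  have dq : is_derive s 1 (fun s => a * s ^+ 2 + 2 * b * s + c) (2 * (a * s + b)).
    have dX : is_derive s 1 (fun t : R => t ^+ 2) (2 * s).
      have dd := is_deriveM (is_derive_id s 1) (is_derive_id s 1).
      have -> : (fun t : R => t ^+ 2) = (id * id)%R :> (R -> R) by apply/funext => t;
        rewrite expr2.
      by move/is_derive_eq : dd; apply; rewrite /GRing.scale /= !mulr1 mulr2n mulrDl mul1r.
    have := is_deriveD (is_deriveD (is_deriveM (is_derive_cst a s 1) dX)
      (is_deriveM (is_derive_cst (2 * b) s 1) (is_derive_id s 1))) (is_derive_cst c s 1).
    move/is_derive_eq; apply; rewrite !scaler0 /GRing.scale /=; ring.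
  have := @is_derive1_comp _ (@Num.sqrt R) (fun s => a * s ^+ 2 + 2 * b * s + c) s _ _
     (is_derive1_sqrt p) dq.
  move/is_derive_eq; apply; field.
  by rewrite gt_eqF// sqrtr_gt0.
have ch b c : b ^+ 2 < a * c ->
    continuous (fun s => Num.sqrt (a * s ^+ 2 + 2 * b * s + c)).
  move=> D s; have [d _] := dh b c s D.
  by apply: differentiable_continuous; apply/derivable1_diffP.
pose d1 := Num.sqrt (a * c1 - b1 ^+ 2); pose d2 := Num.sqrt (a * c2 - b2 ^+ 2).
have D1' : 0 < a * c1 - b1 ^+ 2 by rewrite subr_gt0.
have D2' : 0 < a * c2 - b2 ^+ 2 by rewrite subr_gt0.
have h10 s : 0 < h1 s by rewrite sqrtr_gt0; exact: pos.
have h20 s : 0 < h2 s by rewrite sqrtr_gt0; exact: pos.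
apply: (@integral_bump_affine (fun s => e1 * h1 s + e2 * h2 s)
  (fun s => e1 * (a * s + b1) / h1 s + e2 * (a * s + b2) / h2 s) tau M B
  (a * (e1 * d2 + e2 * d1)) (e1 * b1 * d2 + e2 * b2 * d1)) => //.
- move=> s.
  have := is_deriveD (is_deriveM (is_derive_cst e1 s 1) (dh b1 c1 s D1))
    (is_deriveM (is_derive_cst e2 s 1) (dh b2 c2 s D2)).
  move/is_derive_eq; apply; rewrite !scaler0 !addr0 /GRing.scale /= /h1 /h2.
  by rewrite !mulrA.
- have cl e b : continuous (fun s => e * (a * s + b)).
    move=> s; apply: cvgM; first exact: cvg_cst.
    apply: cvgD; last exact: cvg_cst.
    by apply: cvgM; [exact: cvg_cst|exact: cvg_id].
  move=> s; apply: cvgD.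
  + apply: cvgM; first exact: cl.
    by apply: cvgV; [rewrite gt_eqF//; exact: h10|exact: ch].
  + apply: cvgM; first exact: cl.
    by apply: cvgV; [rewrite gt_eqF//; exact: h20|exact: ch].
- move=> s l0; apply: (@weighted_sum_ge0 _ _ _ _ _ _ D1' D2' (h10 s) (h20 s) _ a0).
  + by rewrite hsq// exprMn e11 mul1r.
  + by rewrite hsq// exprMn e21 mul1r.
  + by apply: le_trans l0 _; rewrite -/d1 -/d2 le_eqVlt; apply/orP; left; apply/eqP; ring.
- move=> s l0; rewrite -oppr_ge0 opprD -!mulNr.
  apply: (@weighted_sum_ge0 _ _ _ _ _ _ D1' D2' (h10 s) (h20 s) _ a0).
  + by rewrite hsq// mulNr sqrrN exprMn e11 mul1r.
  + by rewrite hsq// mulNr sqrrN exprMn e21 mul1r.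
  + rewrite -oppr_le0; apply: le_trans l0; rewrite -/d1 -/d2.
    by rewrite le_eqVlt; apply/orP; left; apply/eqP; ring.
Qed.

End line_integral.

(** * Geometry of the angle and the tube *)

Section vectors.
Context {R : realType}.
Implicit Types (a b d w x : vec3 R) (s t : R).

Lemma sub3E a b : a - b = (a.1.1 - b.1.1, a.1.2 - b.1.2, a.2 - b.2) :> vec3 R.
Proof. by []. Qed.

Lemma dot3_ge0 a : 0 <= dot3 a a.
Proof. by rewrite /dot3 -!expr2 !addr_ge0// sqr_ge0. Qed.

Lemma norm3_ge0 a : 0 <= norm3 a.
Proof. exact: sqrtr_ge0. Qed.

Lemma sqr_norm3 a : norm3 a ^+ 2 = dot3 a a.
Proof. by rewrite sqr_sqrtr// dot3_ge0. Qed.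

Lemma lagrange3 a b : dot3 a a * dot3 b b - dot3 a b ^+ 2 =
  (a.1.1 * b.1.2 - a.1.2 * b.1.1) ^+ 2 + (a.1.1 * b.2 - a.2 * b.1.1) ^+ 2 +
  (a.1.2 * b.2 - a.2 * b.1.2) ^+ 2.
Proof. by rewrite /dot3; ring. Qed.

Lemma sqr_dot3_le a b : dot3 a b ^+ 2 <= dot3 a a * dot3 b b.
Proof. by rewrite -subr_ge0 lagrange3 !addr_ge0// sqr_ge0. Qed.

Lemma sqr_coord_le a :
  [/\ a.1.1 ^+ 2 <= dot3 a a, a.1.2 ^+ 2 <= dot3 a a & a.2 ^+ 2 <= dot3 a a].
Proof.
rewrite /dot3 -!expr2; have := sqr_ge0 a.1.1; have := sqr_ge0 a.1.2; have := sqr_ge0 a.2.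
by move=> *; split; lra.
Qed.

Lemma sqr_cross_le a b :
  (a.1.1 * b.2 - a.2 * b.1.1) ^+ 2 <= dot3 a a * dot3 b b - dot3 a b ^+ 2 /\
  (a.1.2 * b.2 - a.2 * b.1.2) ^+ 2 <= dot3 a a * dot3 b b - dot3 a b ^+ 2.
Proof.
rewrite lagrange3; split; last by rewrite lerDr addr_ge0// sqr_ge0.
by rewrite -addrA addrCA lerDl addr_ge0// sqr_ge0.
Qed.

Lemma dot3_scale s t a b : dot3 (scale3 s a) (scale3 t b) = s * t * dot3 a b.
Proof. by rewrite /dot3 /=; ring. Qed.

Lemma norm3_scale_sign (s : bool) a : norm3 (scale3 ((-1) ^+ s) a) = norm3 a.
Proof. by rewrite /norm3 dot3_scale -expr2 sqrr_sign mul1r. Qed.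

(** The gradient at [x] of $e_1|x|+e_2|x_0-x|$, the phase left after integrating in time. *)
Definition direction_gap (e1 e2 : R) x0 x : vec3 R :=
  scale3 (e1 / norm3 x) x - scale3 (e2 / norm3 (x0 - x)) (x0 - x).

Definition cyc a : vec3 R := (a.1.2, a.2, a.1.1).

Lemma dot3_cyc a b : dot3 (cyc a) (cyc b) = dot3 a b.
Proof. by rewrite /dot3 /=; ring. Qed.

Lemma norm3_cyc a : norm3 (cyc a) = norm3 a.
Proof. by rewrite /norm3 dot3_cyc. Qed.

Lemma cycB a b : cyc (a - b) = cyc a - cyc b.
Proof. by []. Qed.

Lemma direction_gap_cyc e1 e2 x0 x :
  direction_gap e1 e2 (cyc x0) (cyc x) = cyc (direction_gap e1 e2 x0 x).
Proof. by rewrite /direction_gap -cycB !norm3_cyc. Qed.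

(* Since [a] and [b] are unit vectors, [|d|^2 = 2 d.a], and [a] is within [dl]
   of the line spanned by [w]. *)
Lemma unit_gap_bound a b d w (k1 k2 dl : R) : d = a - b -> dot3 a a = 1 -> dot3 b b = 1 ->
  dot3 w w = 1 -> 0 <= dl <= 1 -> 1 - dot3 a w ^+ 2 <= dl ^+ 2 ->
  `|k1| <= 2 -> `|k2| <= 2 -> w.1.1 = k1 * w.2 -> w.1.2 = k2 * w.2 ->
  dot3 d d <= 4 * `|dot3 d (k1, k2, 1)| + 6 * dl * (`|d.1.1| + `|d.1.2|).
Proof.
move=> dE a1 b1 w1 /andP[dl0 dl1] aw hk1 hk2 w11 w12.
set s := dot3 a w in aw.
have s1 : `|s| <= 1.
  have := sqr_dot3_le a w; rewrite a1 w1 mulr1 -/s => h.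
  by rewrite -(@ler_pXn2r _ 2) ?nnegrE// expr1n real_normK ?num_real.
have E1 : dot3 d d = 2 * dot3 d a.
  have : dot3 d d = dot3 a a + dot3 b b - 2 * dot3 a b by rewrite dE sub3E /dot3 /=; ring.
  have : dot3 d a = dot3 a a - dot3 a b by rewrite dE sub3E /dot3 /=; ring.
  by rewrite a1 b1; lra.
pose p : vec3 R := a - scale3 s w.
have E2 : dot3 d a = s * dot3 d w + dot3 d p.
  by rewrite /p sub3E /dot3 /=; ring.
have pp : dot3 p p = 1 - s ^+ 2.
  have : dot3 p p = dot3 a a - 2 * s * dot3 a w + s ^+ 2 * dot3 w w.
    by rewrite /p sub3E /dot3 /=; ring.
  by rewrite a1 w1 -/s => ->; ring.
have D0 := norm3_ge0 d; set D := norm3 d in D0.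
have DD : D ^+ 2 = dot3 d d by exact: sqr_norm3.
have dp : `|dot3 d p| <= D * dl.
  rewrite -(@ler_pXn2r _ 2) ?nnegrE ?mulr_ge0// real_normK ?num_real// exprMn DD.
  by apply: le_trans (sqr_dot3_le d p) _; rewrite pp ler_wpM2l// dot3_ge0.
have w3 : `|w.2| <= 1.
  rewrite -(@ler_pXn2r _ 2) ?nnegrE// expr1n real_normK ?num_real// -w1 /dot3.
  by rewrite -!expr2; have := sqr_ge0 w.1.1; have := sqr_ge0 w.1.2; lra.
have dw : dot3 d w = w.2 * dot3 d (k1, k2, 1).
  by rewrite /dot3 /= w11 w12; ring.
set V := dot3 d (k1, k2, 1) in dw *.
have sdw : `|s * dot3 d w| <= `|V|.
  by rewrite normrM dw normrM mulrA ler_piMl// mulr_ile1.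
(* The third component of [d] is recovered from [V] and the other two, with coefficients at most
   2. *)
have DV : D <= `|V| + 3 * (`|d.1.1| + `|d.1.2|).
  have h1 : D <= `|d.1.1| + `|d.1.2| + `|d.2|.
    rewrite -(@ler_pXn2r _ 2) ?nnegrE ?addr_ge0// DD /dot3 -!expr2.
    rewrite -(real_normK (num_real d.1.1)) -(real_normK (num_real d.1.2)) -(real_normK
      (num_real d.2)).
    by have := normr_ge0 d.1.1; have := normr_ge0 d.1.2; have := normr_ge0 d.2; nra.
  have dz : d.2 = V - k1 * d.1.1 - k2 * d.1.2 by rewrite /V /dot3 /=; ring.
  have h2 : `|d.2| <= `|V| + 2 * `|d.1.1| + 2 * `|d.1.2|.
    rewrite dz; apply: le_trans (ler_normB _ _) _; apply: lerD.
      by apply: le_trans (ler_normB _ _) _; rewrite lerD2l normrM ler_wpM2r.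
    by rewrite normrM ler_wpM2r.
  by lra.
have : dot3 d d <= 2 * `|V| + 2 * (D * dl).
  rewrite E1 E2; have := ler_norm (s * dot3 d w); have := ler_norm (dot3 d p); lra.
have := normr_ge0 V; have := normr_ge0 d.1.1; have := normr_ge0 d.1.2.
set X := `|d.1.1| in DV *; set Y := `|d.1.2| in DV *; set W := `|V| in DV *.
move=> Y0 X0 W0 h.
have : D * dl <= (W + 3 * (X + Y)) * dl by rewrite ler_wpM2r.
have : W * dl <= W by rewrite ler_piMr.
by lra.
Qed.

Lemma dot3_gap e1 e2 x0 x : e1 ^+ 2 = 1 -> e2 ^+ 2 = 1 -> 0 < norm3 x -> 0 < norm3 (x0 - x) ->
  dot3 (scale3 (e1 / norm3 x) x) (scale3 (e1 / norm3 x) x) = 1 /\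
  dot3 (scale3 (e2 / norm3 (x0 - x)) (x0 - x)) (scale3 (e2 / norm3 (x0 - x)) (x0 - x)) = 1.
Proof.
move=> e11 e21 n1 n2.
by split; rewrite dot3_scale -sqr_norm3 -expr2 expr_div_n ?e11 ?e21 div1r mulVf//
  expf_neq0// gt_eqF.
Qed.

(** The left side is the squared distance from [a] to the line; it bounds each competitor in the
    infimum from below, so attainment is not an issue. *)
Lemma tube_sub (r : R) w a : norm3 w = 1 -> 0 < r -> tube r w a ->
  dot3 a a - dot3 a w ^+ 2 <= r ^+ 2.
Proof.
move=> w1 r0 ar; have ww : dot3 w w = 1 by rewrite -sqr_norm3 w1 expr1n.
have h t : dot3 a a - dot3 a w ^+ 2 <= norm3 (a - scale3 t w) ^+ 2.
  rewrite sqr_norm3.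
  have -> : dot3 (a - scale3 t w) (a - scale3 t w) =
    dot3 a a - 2 * t * dot3 a w + t ^+ 2 * dot3 w w by rewrite sub3E /dot3 /=; ring.
  by rewrite ww; have := sqr_ge0 (t - dot3 a w); nra.
set q := dot3 a a - dot3 a w ^+ 2 in h *.
have q0 : 0 <= q by rewrite subr_ge0; have := sqr_dot3_le a w; rewrite ww mulr1.
rewrite -(sqr_sqrtr q0) ler_pXn2r ?nnegrE ?sqrtr_ge0 ?(ltW r0)//.
apply: le_trans ar; apply: lb_le_inf.
  by exists (norm3 (a - scale3 0 w)), 0.
move=> _ [t _ <-]; rewrite -[leRHS]ger0_norm ?norm3_ge0// -sqrtr_sqr.
by rewrite ler_wsqrtr.
Qed.

(** By the mean value theorem $\sin t=t\cos c$ with $c\le1$, and $\cos c\ge1-c^2/2\ge1/2$ by the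
    double-angle formula. *)
Lemma sin_bounds t : 0 <= t <= 1 -> t / 2 <= sin t <= t.
Proof.
move=> /andP[t0 t1].
have sub (u : R) : 0 <= u -> exists2 c : R, 0 <= c <= u & sin u = cos c * u.
  rewrite le_eqVlt => /predU1P[<-|u0].
    by exists 0; rewrite ?lexx// sin0 mulr0.
  have [|c] := @MVT R (@sin R) (@cos R) 0 u u0.
    by apply: continuous_subspaceT; exact: continuous_sin.
  rewrite in_itv/= sin0 !subr0 => /andP[c0 cu] ->.
  by exists c; rewrite ?(ltW c0) ?(ltW cu).
have up (u : R) : 0 <= u -> sin u <= u.
  by move=> u0; have [c _ ->] := sub u u0; rewrite ler_piMl// cos_le1.
rewrite up// andbT; have [c /andP[c0 ct] ->] := sub t t0.
rewrite mulrC ler_wpM2r//.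
have -> : c = c / 2 *+ 2 by rewrite -mulr_natr; field.
rewrite cos_mulr2n.
have c2 : 0 <= c / 2 by lra.
have : sin (c / 2) ^+ 2 <= (c / 2) ^+ 2.
  rewrite ler_pXn2r ?nnegrE ?up// sin_ge0_pi// c2/=.
  by have := pi_ge2 R; lra.
by have := cos2Dsin2 (c / 2); nra.
Qed.

Lemma theta_cos (s1 s2 : bool) a b : `|dot3 (scale3 ((-1) ^+ s1) a) (scale3 ((-1) ^+ s2) b) /
  (norm3 a * norm3 b)| <= 1.
Proof.
have n0 : 0 <= norm3 a * norm3 b by rewrite mulr_ge0// norm3_ge0.
have h : `|dot3 (scale3 ((-1) ^+ s1) a) (scale3 ((-1) ^+ s2) b)| <= norm3 a * norm3 b.
  rewrite -(@ler_pXn2r _ 2) ?nnegrE// real_normK ?num_real// exprMn.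
  rewrite -(norm3_scale_sign s1 a) -(norm3_scale_sign s2 b) !sqr_norm3.
  exact: sqr_dot3_le.
rewrite normrM [X in _ * X]ger0_norm ?invr_ge0//.
have [->|nz] := eqVneq (norm3 a * norm3 b) 0; first by rewrite invr0 mulr0.
by rewrite ler_pdivrMr ?mul1r// lt_neqAle eq_sym nz.
Qed.

Lemma theta_ge0 (s1 s2 : bool) a b : 0 <= theta s1 s2 a b.
Proof.
rewrite /theta /angle !norm3_scale_sign acos_ge0//.
by rewrite -ler_norml theta_cos.
Qed.

(** $|d|^2=2-2\cos\theta=4\sin^2(\theta/2)$, and $\sin(\theta/2)\ge\theta/4$ for small angles. *)
Lemma theta_gap (s1 s2 : bool) x0 x : theta s1 s2 x (x0 - x) <= 1 / 2 ->
  let d := direction_gap ((-1) ^+ s1) ((-1) ^+ s2) x0 x in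
  [/\ 0 < norm3 x, 0 < norm3 (x0 - x) & theta s1 s2 x (x0 - x) ^+ 2 <= 4 * dot3 d d].
Proof.
move=> th d; have th0 := theta_ge0 s1 s2 x (x0 - x).
have c1 := theta_cos s1 s2 x (x0 - x).
have pi2 := pihalf_ge1 R.
have nz : norm3 x * norm3 (x0 - x) != 0.
  (* If one of the vectors vanished, the angle would take its junk value $\pi/2$, which exceeds
     $1/2$. *)
  apply: contraTneq th => z; rewrite -ltNge /theta /angle !norm3_scale_sign z invr0 mulr0 acos0.
  by lra.
have [nx ny] : norm3 x != 0 /\ norm3 (x0 - x) != 0 by apply/andP; move: nz;
  rewrite mulf_eq0 negb_or.
have n1 : 0 < norm3 x by rewrite lt_neqAle eq_sym nx norm3_ge0.
have n2 : 0 < norm3 (x0 - x) by rewrite lt_neqAle eq_sym ny norm3_ge0.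
split => //.
have e1 : ((-1) ^+ s1) ^+ 2 = 1 :> R by rewrite sqrr_sign.
have e2 : ((-1) ^+ s2) ^+ 2 = 1 :> R by rewrite sqrr_sign.
have [g1 g2] := dot3_gap e1 e2 n1 n2.
set c := _ / _ in c1.
have ck : cos (theta s1 s2 x (x0 - x)) = c.
  by rewrite /theta /angle !norm3_scale_sign acosK// in_itv/= -ler_norml.
have -> : dot3 d d = 2 - 2 * c.
  pose a1 := scale3 ((-1) ^+ s1 / norm3 x) x.
  pose b1 := scale3 ((-1) ^+ s2 / norm3 (x0 - x)) (x0 - x).
  have -> : dot3 d d = dot3 a1 a1 + dot3 b1 b1 - 2 * dot3 a1 b1.
    by rewrite /d /direction_gap -/a1 -/b1 sub3E /dot3 /=; ring.
  rewrite /a1 /b1 g1 g2 /c !dot3_scale; field.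
  by rewrite nx ny.
rewrite -ck; set t := theta _ _ _ _ in th th0 *.
have -> : t = t / 2 *+ 2 by rewrite -mulr_natr; field.
have t2 : 0 <= t / 2 <= 1 by apply/andP; split; lra.
have /andP[sl su] := sin_bounds t2.
rewrite cos_mulr2n -mulr_natr.
have := cos2Dsin2 (t / 2).
have : (t / 2 / 2) ^+ 2 <= sin (t / 2) ^+ 2.
  by rewrite ler_pXn2r ?nnegrE//; lra.
by nra.
Qed.

End vectors.

(** * Measurability of the geometric quantities *)

Section measurability.
Context {R : realType}.

Lemma measurable_invr : measurable_fun setT (fun x : measurableTypeR R => x^-1 : R).
Proof.
have U : setT = [set 0] `|` ~` [set 0] :> set (measurableTypeR R) by rewrite setUv.
rewrite U; apply/measurable_funU => //; first exact: measurableC.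
split; first exact: measurable_fun_set1.
apply: open_continuous_measurable_fun; first by apply: closed_openC; exact: closed_eq.
by move=> x; rewrite inE/= => /eqP x0; exact: inv_continuous.
Qed.

Lemma measurable_acos : measurable_fun setT (@acos R : measurableTypeR R -> R).
Proof.
have m1 : measurable ([set x | -1 <= x <= 1] : set (measurableTypeR R)).
  by rewrite (_ : [set x | _] = `[-1, 1]%classic)//; apply/seteqP; split => x /=;
    rewrite in_itv.
have m2 : measurable (`]-1, 1[%classic : set (measurableTypeR R)) by [].
have U : setT = ~` [set x | -1 <= x <= 1] `|` ([set -1] `|` ([set 1] `|` `]-1, 1[%classic))
  :> set (measurableTypeR R).
  apply/seteqP; split => // x _ /=; rewrite in_itv/=.
  have [h|h] := boolP (-1 <= x <= 1); last by left; exact/negP.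
  right; have [->|x1] := eqVneq x (-1); first by left.
  right; have [->|x2] := eqVneq x 1; first by left.
  by right; case/andP: h => h1 h2; rewrite !lt_neqAle h1 h2 x2 eq_sym x1.
rewrite U; apply/measurable_funU; [exact: measurableC|by apply: measurableU => //;
  exact: measurableU|].
split.
  (* Outside $[-1,1]$ the arccosine is chosen from an empty set, so it is constant there; 2 is a
     sample point. *)
  apply: (@eq_measurable_fun _ _ _ _ _ (cst (acos 2))); last exact: measurable_cst.
  move=> x; rewrite inE/= => hx; rewrite unlock.
  have e (y : R) : ~ (-1 <= y <= 1) -> [set z | 0 <= z <= pi /\ cos z = y] = set0.
    by move=> hy; apply/seteqP; split => // z [_ cz]; apply: hy; rewrite -cz cos_geN1 cos_le1.
  by rewrite !e//; move=> /andP[]; lra.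
apply/measurable_funU; [by []|exact: measurableU|]; split; first exact: measurable_fun_set1.
apply/measurable_funU => //; split; first exact: measurable_fun_set1.
apply: open_continuous_measurable_fun; first exact: interval_open.
by move=> x; rewrite inE/= in_itv/=; exact: continuous_acos.
Qed.

Context d (T : measurableType d).
Implicit Types f g : T -> vec3 R.

Lemma measurable_vec (a b c : T -> measurableTypeR R) : measurable_fun setT a ->
  measurable_fun setT b -> measurable_fun setT c ->
  measurable_fun setT (fun x => (a x, b x, c x) : vec3 R).
Proof. by move=> ma mb mc; apply: measurable_fun_pair => //; exact: measurable_fun_pair. Qed.

Lemma measurable_vecB f g : measurable_fun setT f -> measurable_fun setT g ->
  measurable_fun setT (fun x => f x - g x).
Proof.
move=> /measurable_coord[f1 f2 f3] /measurable_coord[g1 g2 g3].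
by apply: measurable_vec; exact: measurable_funB.
Qed.

Lemma measurable_scale3 (t : T -> measurableTypeR R) f : measurable_fun setT t ->
  measurable_fun setT f ->
  measurable_fun setT (fun x => scale3 (t x) (f x)).
Proof.
move=> mt /measurable_coord[f1 f2 f3].
by apply: measurable_vec; exact: measurable_funM.
Qed.

Lemma measurable_norm3 f : measurable_fun setT f ->
  measurable_fun setT (fun x => norm3 (f x) : measurableTypeR R).
Proof.
move=> mf; apply: (measurableT_comp _ (measurable_dot3 mf mf)).
by apply: continuous_measurable_fun; exact: sqrt_continuous.
Qed.

Lemma measurable_direction_gap e1 e2 f g : measurable_fun setT f -> measurable_fun setT g ->
  measurable_fun setT (fun x => direction_gap e1 e2 (f x) (g x)).
Proof.
move=> mf mg.
have h e (k : T -> vec3 R) : measurable_fun setT k ->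
    measurable_fun setT (fun x => scale3 (e / norm3 (k x)) (k x)).
  move=> mk; apply: measurable_scale3 => //; apply: measurable_funM => //.
  by apply: (measurableT_comp measurable_invr); exact: measurable_norm3.
by apply: measurable_vecB; apply: h => //; exact: measurable_vecB.
Qed.

Lemma measurable_bump tau M (t : T -> measurableTypeR R) : measurable_fun setT t ->
  measurable_fun setT (fun x => bump tau M (t x) : measurableTypeR R).
Proof.
by move=> mt; apply: (measurableT_comp _ mt); apply: continuous_measurable_fun;
  exact: continuous_bump.
Qed.

Lemma measurable_theta s1 s2 f g : measurable_fun setT f -> measurable_fun setT g ->
  measurable_fun setT (fun x => theta s1 s2 (f x) (g x) : measurableTypeR R).
Proof.
move=> mf mg; apply: (measurableT_comp measurable_acos).
have m1 : measurable_fun setT (fun x => scale3 ((-1) ^+ s1) (f x)) by exact: measurable_scale3.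
have m2 : measurable_fun setT (fun x => scale3 ((-1) ^+ s2) (g x)) by exact: measurable_scale3.
apply: measurable_funM; first exact: measurable_dot3.
apply: (measurableT_comp measurable_invr).
by apply: measurable_funM; exact: measurable_norm3.
Qed.

Lemma measurable_indic_comp d' (T' : measurableType d') (D : set T') (h : T -> T') :
  measurable D -> measurable_fun setT h ->
  measurable_fun setT (fun x => \1_D (h x) : R).
Proof. by move=> mD mh; apply: (measurableT_comp _ mh); exact: measurable_indic. Qed.

End measurability.

Lemma integral_indicT {R : realType} d (T : measurableType d) (m : {measure set T -> \bar R})
    (D : set T) : measurable D -> (\int[m]_x (\1_D x)%:E)%E = m D.
Proof. by move=> mD; rewrite integral_indic// setIT. Qed.

(** * Integration along parallel lines *)

Section leb3_integrals.
Context {R : realType}.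
Local Notation mu := (@lebesgue_measure R).
Local Open Scope ereal_scope.

Lemma leb3_invariant_cyc : invariant (@leb3 R) (@cyc R).
Proof.
have mc : measurable_fun setT (@cyc R).
  by have [h1 h2 h3] := @measurable_coord R _ _ _ (@measurable_id _ (vec3 R) setT);
    exact: measurable_vec.
split => // f mf f0.
rewrite (@fubini_tonelli1 _ _ _ _ _ (@leb2 R) mu (fun x => f (cyc x)))//;
  last exact: (measurableT_comp mf).
rewrite (@fubini_tonelli2 _ _ _ _ _ (@leb2 R) mu f)//.
rewrite /fubini_F /fubini_G /=.
pose g := fun p : measurableTypeR R * (measurableTypeR R * measurableTypeR R) => f (p.2, p.1).
have mg : measurable_fun setT g.
  by apply: (measurableT_comp mf); apply: measurable_fun_pair;
    [exact: measurable_snd|exact: measurable_fst].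
transitivity (\int[mu]_x \int[mu]_y \int[mu]_z f ((y, z), x)).
  rewrite (@fubini_tonelli1 _ _ _ _ _ mu mu (fun p => \int[mu]_z f ((p.2, z), p.1)))//.
  - pose h := fun q : (measurableTypeR R * measurableTypeR R) * measurableTypeR R =>
    f ((q.1.2, q.2), q.1.1).
    apply: (@measurable_fun_fubini_tonelli_F _ _ _ _ _ mu h) => //.
      by apply: (measurableT_comp mf) mc.
    by move=> p; exact: f0.
  - by move=> p; exact: integral_ge0.
apply: eq_integral => x _.
rewrite (@fubini_tonelli1 _ _ _ _ _ mu mu (fun p => f (p, x)))//.
by apply: (measurableT_comp mf); apply: measurable_fun_pair.
Qed.

Lemma leb2_invariant_shift (c : measurableTypeR R * measurableTypeR R) :
  invariant (@leb2 R) (fun p => p + c)%R.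
Proof.
case: c => a b.
exact: (@invariant_prod R _ _ _ _ lebesgue_measure lebesgue_measure _ _ (invariant_shift a)
  (invariant_shift b)).
Qed.

Lemma ae_snd_neq (c : R) : {ae (@leb2 R), forall p, p.2 != c}.
Proof.
exists (setT `*` [set c]); split.
- by apply: measurableX.
- apply: (etrans (@product_measure1E _ _ _ _ _ mu mu setT [set c] measurableT
  (measurable_set1 c))).
  apply: (etrans (congr1 (fun t => _ * t) (lebesgue_measure_set1 c))); exact: mule0.
- by move=> [x y] /= /negP; rewrite negbK => /eqP.
Qed.

(** [D] collects the points where lines of direction [(k1, k2, 1)] cross the plane on which the
    third coordinate vanishes, [B] cuts these lines to finite length, and the last factor is the
    integrand of [line_bound]. *)
Definition line_weight (k1 k2 B M tau e1 e2 : R) (x0 : vec3 R)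
    (D : set (measurableTypeR R * measurableTypeR R)) (x : vec3 R) : R :=
  (\1_D (x.1.1 - k1 * x.2, x.1.2 - k2 * x.2) * \1_`[- B, B]%classic x.2 *
    (`|dot3 (direction_gap e1 e2 x0 x) (k1, k2, 1)| *
     bump tau M (e1 * norm3 x + e2 * norm3 (x0 - x))))%R.

Lemma line_weight_ge0 k1 k2 B M tau e1 e2 x0 D x :
  (0 <= line_weight k1 k2 B M tau e1 e2 x0 D x)%R.
Proof.
apply: mulr_ge0; first exact: mulr_ge0.
by apply: mulr_ge0 => //; exact: bump_ge0.
Qed.

Lemma measurable_gap_bump d (T : measurableType d) (f : T -> vec3 R) e1 e2 tau M x0 :
  measurable_fun setT f -> measurable_fun setT
    (fun x => bump tau M (e1 * norm3 (f x) + e2 * norm3 (x0 - f x)) : measurableTypeR R)%R.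
Proof.
move=> mf; apply: measurable_bump; apply: measurable_funD; apply: measurable_funM => //.
  exact: measurable_norm3.
by apply: measurable_norm3; exact: measurable_vecB.
Qed.

Lemma measurable_line_weight k1 k2 B M tau e1 e2 x0 D : measurable D ->
  measurable_fun setT (line_weight k1 k2 B M tau e1 e2 x0 D).
Proof.
move=> mD.
have [c1 c2 c3] := @measurable_coord R _ _ _ (@measurable_id _ (vec3 R) setT).
apply: measurable_funM; first apply: measurable_funM.
- apply: measurable_indic_comp => //; apply: measurable_fun_pair.
  + by apply: measurable_funB => //; exact: measurable_funM.
  + by apply: measurable_funB => //; exact: measurable_funM.
- by apply: measurable_indic_comp.
- apply: measurable_funM; last exact: measurable_gap_bump.
  apply: measurableT_comp => //; apply: measurable_dot3; last exact: measurable_cst.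
  by apply: measurable_direction_gap.
Qed.

(* The lines of direction [(k1, k2, 1)] foliate the space; on almost all of
   them [line_bound] applies. *)
Lemma integral_direction_le (k1 k2 B M tau e1 e2 : R) (x0 : vec3 R)
    (D : set (measurableTypeR R * measurableTypeR R)) : (0 < M)%R -> (0 <= B)%R ->
  (e1 ^+ 2 = 1)%R -> (e2 ^+ 2 = 1)%R -> measurable D ->
  \int[@leb3 R]_x (line_weight k1 k2 B M tau e1 e2 x0 D x)%:E <= (4 * pi * M)%:E * leb2 D.
Proof.
move=> M0 B0 e11 e21 mD.
pose g (x : vec3 R) := (line_weight k1 k2 B M tau e1 e2 x0 D x)%:E.
have g0 x : 0 <= g x by rewrite lee_fin line_weight_ge0.
have mg : measurable_fun setT g by apply/measurable_EFinP; exact: measurable_line_weight.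
have [c1 c2 c3] := @measurable_coord R _ _ _ (@measurable_id _ (vec3 R) setT).
pose h (x : vec3 R) := g (x.1 + (k1 * x.2, k2 * x.2), x.2)%R.
have mh : measurable_fun setT h.
  apply: (measurableT_comp mg); apply: measurable_vec => //.
  + by apply: measurable_funD => //; exact: measurable_funM.
  + by apply: measurable_funD => //; exact: measurable_funM.
have h0 x : 0 <= h x by exact: g0.
rewrite -/(g _).
(* The shear that straightens the lines is a translation on each horizontal slice. *)
have -> : \int[@leb3 R]_x g x = \int[@leb3 R]_x h x.
  rewrite (@fubini_tonelli2 _ _ _ _ _ (@leb2 R) mu g mg g0).
  rewrite (@fubini_tonelli2 _ _ _ _ _ (@leb2 R) mu h mh h0).
  apply: eq_integral => z _; rewrite /fubini_G.
  have [_ i] := leb2_invariant_shift (k1 * z, k2 * z)%R.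
  rewrite -[LHS](i (fun p => g (p, z)))//.
  by apply: (measurableT_comp mg); exact: measurable_fun_pair.
rewrite (@fubini_tonelli1 _ _ _ _ _ (@leb2 R) mu h mh h0).
have -> : (4 * pi * M)%:E * leb2 D = \int[@leb2 R]_p ((4 * pi * M)%:E * (\1_D p)%:E).
  rewrite ge0_integralZl//.
  - by rewrite (integral_indicT _ mD).
  - by apply/measurable_EFinP; exact: measurable_indic.
  - by rewrite lee_fin !mulr_ge0 ?pi_ge0 ?(ltW M0).
apply: ae_ge0_le_integral => //.
- by move=> p _; exact: integral_ge0.
- exact: measurable_fun_fubini_tonelli_F.
- by move=> p _; rewrite -EFinM lee_fin !mulr_ge0 ?pi_ge0 ?(ltW M0).
- by apply/measurable_EFinP; apply: measurable_funM => //; exact: measurable_indic.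
have aeF : Filter (almost_everywhere (@leb2 R)) by exact: (ae_filter_ringOfSetsType (@leb2 R)).
(* These two null sets contain all lines through 0 or [x0], on which one of the quadratics has a
   real zero and [line_bound] does not apply. *)
apply: (@filterS2 _ _ aeF _ _ _ _ (ae_snd_neq 0%R) (ae_snd_neq (x0.1.2 - k2 * x0.2)%R)).
move=> [x y] /= y0 y1 _; rewrite /fubini_F.
pose p : vec3 R := (x, y, 0%R).
pose q : vec3 R := (x0 - p)%R.
pose v : vec3 R := (k1, k2, 1%R).
have vv : (0 < dot3 v v)%R by rewrite /dot3 /= mulr1 ltr_wpDl// addr_ge0// -expr2 sqr_ge0.
have D1 : (dot3 v p ^+ 2 < dot3 v v * dot3 p p)%R.
  rewrite -subr_gt0 lagrange3 ltr_wpDl// ?addr_ge0 ?sqr_ge0//=.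
  by rewrite mulr0 mul1r sub0r sqrrN lt_neqAle sqr_ge0 andbT eq_sym expf_neq0.
have D2 : ((- dot3 v q) ^+ 2 < dot3 v v * dot3 q q)%R.
  rewrite sqrrN -subr_gt0 lagrange3 ltr_wpDl// ?addr_ge0 ?sqr_ge0//=.
  rewrite mul1r lt_neqAle sqr_ge0 andbT eq_sym expf_neq0// subr0.
  rewrite -oppr_eq0 opprB subr_eq0; apply: contra y1 => /eqP E.
  by apply/eqP; rewrite -E; ring.
have key z : h ((x, y), z) = (\1_D (x, y) * \1_`[- B, B]%classic z *
   (`|e1 * (dot3 v v * z + dot3 v p) / sqrt_quad (dot3 v v) (dot3 v p) (dot3 p p) z +
      e2 * (dot3 v v * z + - dot3 v q) / sqrt_quad (dot3 v v) (- dot3 v q) (dot3 q q) z| *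
    bump tau M (e1 * sqrt_quad (dot3 v v) (dot3 v p) (dot3 p p) z +
      e2 * sqrt_quad (dot3 v v) (- dot3 v q) (dot3 q q) z)))%R%:E.
  rewrite /h /g /line_weight /=; set X : vec3 R := (_, _, _).
  have n1 : norm3 X = sqrt_quad (dot3 v v) (dot3 v p) (dot3 p p) z.
    by rewrite /norm3 /sqrt_quad; congr Num.sqrt; rewrite /X /dot3 /=; ring.
  have n2 : norm3 (x0 - X)%R = sqrt_quad (dot3 v v) (- dot3 v q) (dot3 q q) z.
    by rewrite /norm3 /sqrt_quad; congr Num.sqrt; rewrite /q !sub3E /X /dot3 /=; ring.
  have -> : ((x + k1 * z - k1 * z)%R, (y + k2 * z - k2 * z)%R) = (x, y) by rewrite !addrK.
  congr (_ * _ * (`|_| * bump _ _ _))%:E; last by rewrite n1 n2.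
  rewrite /direction_gap n1 n2; set A := sqrt_quad _ _ _ z; set A' := sqrt_quad _ _ _ z.
  by rewrite /q !sub3E /X /dot3 /=; ring.
pose F z := (`|e1 * (dot3 v v * z + dot3 v p) / sqrt_quad (dot3 v v) (dot3 v p) (dot3 p p) z +
      e2 * (dot3 v v * z + - dot3 v q) / sqrt_quad (dot3 v v) (- dot3 v q) (dot3 q q) z| *
    bump tau M (e1 * sqrt_quad (dot3 v v) (dot3 v p) (dot3 p p) z +
      e2 * sqrt_quad (dot3 v v) (- dot3 v q) (dot3 q q) z))%R.
have -> : \int[mu]_z h ((x, y), z) = (\1_D (x, y))%:E * \int[mu]_(z in `[(- B)%R, B]) (F z)%:E.
  transitivity (\int[mu]_z (\1_D (x, y) * \1_`[- B, B]%classic z * F z)%R%:E).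
    by apply: eq_integral => z _; exact: key.
  have [E|E] : \1_D (x, y) = 0%R :> R \/ \1_D (x, y) = 1%R :> R.
    by rewrite indicE; case: (_ \in _); [right|left].
    by rewrite E mul0e; apply: integral0_eq => z _; rewrite !mul0r.
  rewrite E mul1e [RHS]integral_mkcond; apply: eq_integral => z _.
  by rewrite patchE indicE mul1r; case: ifP => _; rewrite ?mul1r ?mul0r.
rewrite muleC; apply: lee_wpmul2r; first by rewrite lee_fin.
exact: line_bound.
Qed.

End leb3_integrals.

Section strips.
Context {R : realType}.
Local Notation mu := (@lebesgue_measure R).
Local Open Scope ereal_scope.

Lemma lebesgue_measure_itv_center (L : R) : (0 <= L)%R -> mu `[(- L)%R, L]%classic = (2 * L)%:E.
Proof.
move=> L0; rewrite lebesgue_measure_itv/= lte_fin; case: ltP => h.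
  by rewrite -EFinB; congr EFin; ring.
by congr EFin; lra.
Qed.

(** Integrates out the time variable: the window has length $2L$ wherever its centre lies. *)
Lemma integral_strip d (T : measurableType d) (m : {sigma_finite_measure set T -> \bar R})
    (c : T -> measurableTypeR R) (L : R) (f : T -> \bar R) : (0 <= L)%R ->
  measurable_fun setT c -> measurable_fun setT f -> (forall x, 0 <= f x) ->
  \int[mu \x m]_p ((\1_`[- L, L]%classic (p.1 - c p.2)%R)%:E * f p.2) =
  (2 * L)%:E * \int[m]_x f x.
Proof.
move=> L0 mc mf f0.
pose g (p : measurableTypeR R * T) := (\1_`[- L, L]%classic (p.1 - c p.2)%R : R)%:E * f p.2.
have mg : measurable_fun setT g.
  apply: emeasurable_funM; last by apply: (measurableT_comp mf); exact: measurable_snd.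
  apply/measurable_EFinP; apply: measurable_indic_comp => //.
  by apply: measurable_funB => //; exact: (measurableT_comp mc measurable_snd).
have g0 p : 0 <= g p by rewrite mule_ge0// lee_fin.
rewrite (@fubini_tonelli2 _ _ _ _ _ mu m g mg g0) -ge0_integralZl//;
  last by rewrite lee_fin mulr_ge0.
apply: eq_integral => x _; rewrite /fubini_G /g /=.
have mI : measurable_fun setT (fun t : measurableTypeR R =>
  (\1_`[- L, L]%classic (t - c x)%R : R)%:E).
  by apply/measurable_EFinP; apply: measurable_indic_comp => //; exact: measurable_funB.
rewrite ge0_integralZr//.
congr (_ * _).
have [_ i] := invariant_shift (- c x)%R.
rewrite (i (fun t => (\1_`[- L, L]%classic t)%:E))//; last first.
  by apply/measurable_EFinP; exact: measurable_indic.
by rewrite integral_indic// setIT; exact: lebesgue_measure_itv_center.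
Qed.

Lemma leb2_swap (D : set (measurableTypeR R * measurableTypeR R)) : measurable D ->
  leb2 D = leb2 [set p | D (p.2, p.1)].
Proof.
move=> mD.
have ms : measurable_fun setT (fun p : measurableTypeR R * measurableTypeR R => (p.2, p.1)).
  by apply: measurable_fun_pair; [exact: measurable_snd|exact: measurable_fst].
have mD' : measurable [set p : measurableTypeR R * measurableTypeR R | D (p.2, p.1)].
  by have := ms measurableT D mD; rewrite setTI.
have m1 (E : set (measurableTypeR R * measurableTypeR R)) : measurable E ->
    measurable_fun setT (fun p => (\1_E p : R)%:E).
  by move=> mE; apply/measurable_EFinP; exact: measurable_indic.
have p1 (E : set (measurableTypeR R * measurableTypeR R)) p : 0 <= (\1_E p : R)%:E by
  rewrite lee_fin.
rewrite -(integral_indicT (@leb2 R) mD) -(integral_indicT (@leb2 R) mD').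
rewrite (@fubini_tonelli1 _ _ _ _ _ mu mu _ (m1 _ mD) (p1 _)).
by rewrite (@fubini_tonelli2 _ _ _ _ _ mu mu _ (m1 _ mD') (p1 _)).
Qed.

Definition strip (k N s : R) : set (measurableTypeR R * measurableTypeR R) :=
  [set p | (`|p.2| <= N)%R /\ (`|p.1 - k * p.2| <= s)%R].

Lemma leb2_strip (k N s : R) : (0 <= N)%R -> (0 <= s)%R ->
  measurable (strip k N s) /\ leb2 (strip k N s) = (4 * N * s)%:E.
Proof.
move=> N0 s0; set D := strip k N s.
have mk : measurable_fun setT (fun y : measurableTypeR R =>
  k * y : measurableTypeR R)%R by exact: measurable_funM.
have DE p : (\1_D p : R) = (\1_`[- s, s]%classic (p.1 - k * p.2) * \1_`[- N, N]%classic p.2)%R.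
  rewrite !indicE -natrM mulnb; congr ((nat_of_bool _)%:R).
  apply/idP/andP; rewrite !inE/= !in_itv/= -!ler_norml.
    by move=> [].
  by move=> [].
have mD : measurable D.
  have m1 : measurable_fun setT (fun p : measurableTypeR R * measurableTypeR R =>
    p.1 - k * p.2 : measurableTypeR R)%R.
    by apply: measurable_funB => //; exact: measurable_funM.
  have -> : D = ((fun p => p.1 - k * p.2)%R @^-1` `[(- s)%R, s]%classic) `&` (snd @^-1`
    `[(- N)%R, N]%classic).
    by apply/seteqP; split => p /=; rewrite !in_itv/= -!ler_norml => -[].
  apply: measurableI; rewrite -[X in measurable X]setTI; first exact: m1.
  exact: measurable_snd.
split => //.
rewrite -(integral_indicT (@leb2 R) mD).
have h := @integral_strip _ _ mu (fun y => k * y)%R s (fun y =>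
  (\1_`[- N, N]%classic y)%:E) s0 mk.
rewrite /leb2; under eq_integral do rewrite DE EFinM.
rewrite h//; last first.
  by apply/measurable_EFinP; exact: measurable_indic.
rewrite integral_indic// setIT; apply: etrans (congr1 (fun t =>
  _ * t) (lebesgue_measure_itv_center N0)) _.
by rewrite -EFinM; congr EFin; ring.
Qed.

End strips.

Lemma le_integral_lin {R : realType} d (T : measurableType d) (m : {measure set T -> \bar R})
    (F f g : T -> R) (a b : R) : measurable_fun setT F -> measurable_fun setT f ->
  measurable_fun setT g -> (forall x, 0 <= F x) -> (forall x, 0 <= f x) ->
  (forall x, 0 <= g x) -> 0 <= a -> 0 <= b -> (forall x, F x <= a * f x + b * g x) ->
  (\int[m]_x (F x)%:E <= a%:E * \int[m]_x (f x)%:E + b%:E * \int[m]_x (g x)%:E)%E.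
Proof.
move=> mF mf mg F0 f0 g0 a0 b0 h.
have Ef : measurable_fun setT (fun x => (f x)%:E) by exact/measurable_EFinP.
have Eg : measurable_fun setT (fun x => (g x)%:E) by exact/measurable_EFinP.
rewrite -!ge0_integralZl//; last 2 first.
- by move=> x _; rewrite lee_fin.
- by move=> x _; rewrite lee_fin.
rewrite -ge0_integralD//.
- apply: ge0_le_integral => //.
  + by move=> x _; rewrite lee_fin.
  + exact/measurable_EFinP.
  + by apply: emeasurable_funD; exact: measurable_funeM.
  + by move=> x _; rewrite -!EFinM -EFinD lee_fin.
- by move=> x _; rewrite -EFinM lee_fin mulr_ge0.
- exact: measurable_funeM.
- by move=> x _; rewrite -EFinM lee_fin mulr_ge0.
- exact: measurable_funeM.
Qed.

(** * The kernel over a tube *)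

Section tube_kernel.
Context {R : realType}.
Variables (e1 e2 tau M r N : R).
Hypotheses (e11 : e1 ^+ 2 = 1) (e21 : e2 ^+ 2 = 1) (M0 : 0 < M) (r0 : 0 < r) (rN : r <= N / 2).
Implicit Types w x : vec3 R.

(** The first condition is that of [tube_sub]; the last keeps [direction_gap] away from its
    singularity at [x0]. *)
Definition tube_shell w (x0 : vec3 R) : set (vec3 R) :=
  [set x | [&& dot3 x x - dot3 x w ^+ 2 <= r ^+ 2,
  N / 2 < norm3 x, norm3 x <= N & 0 < norm3 (x0 - x)]].

Definition tube_weight w (x0 : vec3 R) x : R := \1_(tube_shell w x0) x *
  (dot3 (direction_gap e1 e2 x0 x) (direction_gap e1 e2 x0 x) *
   bump tau M (e1 * norm3 x + e2 * norm3 (x0 - x))).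

(** This is [unit_gap_bound] with $\delta=2r/N$. The component along the tube uses lines through a
    square of side $4r$. The two transversal ones use lines parallel to the first and second axis,
    made vertical by [cyc], through strips of length $2N$ and width $4r$. *)
Lemma tube_weight_le w (x0 : vec3 R) x k1 k2 : norm3 w = 1 -> 1 / 3 <= w.2 ^+ 2 ->
  w.1.1 = k1 * w.2 -> w.1.2 = k2 * w.2 ->
  tube_weight w x0 x <=
  4 * line_weight k1 k2 N M tau e1 e2 x0 (strip 0 (2 * r) (2 * r)) x +
  12 * r / N *
  (line_weight 0 0 N M tau e1 e2 (cyc x0) (strip k2 N (2 * r)) (cyc x) +
   line_weight 0 0 N M tau e1 e2 (cyc (cyc x0)) [set p | strip k1 N (2 * r) (p.2, p.1)]
     (cyc (cyc x))).
Proof.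
move=> w1 w3 E1 E2; have N0 : 0 < N by move: r0 rN; lra.
have ww : dot3 w w = 1 by rewrite -sqr_norm3 w1 expr1n.
rewrite /tube_weight indicE; case: (boolP (x \in _)) => [|_]; last first.
  rewrite mul0r addr_ge0// mulr_ge0// ?line_weight_ge0// ?addr_ge0 ?line_weight_ge0//.
  by rewrite divr_ge0 ?mulr_ge0 ?(ltW r0) ?(ltW N0).
rewrite inE => /and4P[xr nx1 nx2 n2].
have n1 : 0 < norm3 x by lra.
have [g1 g2] := dot3_gap e11 e21 n1 n2.
have xx : dot3 x x = norm3 x ^+ 2 by rewrite sqr_norm3.
(* The bound $1/2$ on $|w_3|$ gives $|k_1|,|k_2|\le2$ and turns distances [r] to the axis into
   deviations $2r$ at fixed third coordinate. *)
have w3' : 1 / 2 <= `|w.2|.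
  rewrite -(@ler_pXn2r _ 2) ?nnegrE// real_normK ?num_real//; lra.
have w20 : 0 < `|w.2| by lra.
have kb k u : u = k * w.2 -> u ^+ 2 + w.2 ^+ 2 <= 1 -> `|k| <= 2.
  move=> uE h; have : (`|k| * `|w.2|) ^+ 2 <= 1.
    by rewrite -normrM -uE real_normK ?num_real//; have := sqr_ge0 w.2; lra.
  move=> h'; have h2 : `|k| * `|w.2| <= 1.
    by rewrite -(@ler_pXn2r _ 2) ?nnegrE ?mulr_ge0// expr1n.
  by have := normr_ge0 k; nra.
have wsum : w.1.1 ^+ 2 + w.1.2 ^+ 2 + w.2 ^+ 2 = 1 by rewrite -ww /dot3 !expr2.
have hk1 : `|k1| <= 2.
  by apply: (kb _ _ E1); have := sqr_ge0 w.1.2; lra.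
have hk2 : `|k2| <= 2.
  by apply: (kb _ _ E2); have := sqr_ge0 w.1.1; lra.
have [cross1 cross2] := sqr_cross_le x w; rewrite ww mulr1 in cross1 cross2.
have line u k t : u = k * w.2 -> (t * w.2 - x.2 * u) ^+ 2 <= r ^+ 2 -> `|t - k * x.2| <= 2 * r.
  move=> uE; have -> : t * w.2 - x.2 * u = (t - k * x.2) * w.2 by rewrite uE; ring.
  rewrite -real_normK ?num_real// ler_pXn2r ?nnegrE ?(ltW r0)// normrM => h.
  by have := normr_ge0 (t - k * x.2); nra.
have l1 : `|x.1.1 - k1 * x.2| <= 2 * r by apply: (line _ _ _ E1); exact: le_trans cross1 xr.
have l2 : `|x.1.2 - k2 * x.2| <= 2 * r by apply: (line _ _ _ E2); exact: le_trans cross2 xr.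
have comp u : u ^+ 2 <= dot3 x x -> `|u| <= N.
  move=> h; apply: le_trans nx2; rewrite -(@ler_pXn2r _ 2) ?nnegrE ?norm3_ge0// real_normK
    ?num_real//.
  by rewrite sqr_norm3.
have [/comp x1 /comp x2 /comp x3] := sqr_coord_le x.
have ind (D : set (measurableTypeR R * measurableTypeR R)) p : D p -> \1_D p = 1 :> R.
  by move=> Dp; rewrite indicE mem_set.
have indI u : `|u| <= N -> \1_`[- N, N]%classic u = 1 :> R.
  by move=> h; rewrite indicE mem_set//= in_itv/= -ler_norml.
rewrite /line_weight !direction_gap_cyc -!cycB !norm3_cyc /=.
rewrite !indI//.
rewrite !ind; last 3 first.
- by rewrite /strip/= !mul0r !subr0.
- by rewrite /strip/= !mul0r !subr0.
- by rewrite /strip/= !mul0r !subr0.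
set d := direction_gap e1 e2 x0 x; set b := bump _ _ _.
rewrite !mul1r.
have -> : dot3 (cyc d) (0, 0, 1) = d.1.1 by rewrite /dot3 /=; ring.
have -> : dot3 (cyc (cyc d)) (0, 0, 1) = d.1.2 by rewrite /dot3 /=; ring.
have b0 : 0 <= b by exact: bump_ge0.
have -> : 4 * (`|dot3 d (k1, k2, 1)| * b) + 12 * r / N * (`|d.1.1| * b + `|d.1.2| * b) =
  (4 * `|dot3 d (k1, k2, 1)| + 6 * (2 * r / N) * (`|d.1.1| + `|d.1.2|)) * b by ring.
apply: ler_wpM2r => //.
apply: (@unit_gap_bound _ _ _ d w k1 k2 (2 * r / N) (erefl _) g1 g2 ww) => //.
- rewrite divr_ge0 ?mulr_ge0 ?(ltW r0) ?(ltW N0)//=.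
  by rewrite ler_pdivrMr// mul1r mulrC -ler_pdivlMr.
- have -> : dot3 (scale3 (e1 / norm3 x) x) w = e1 / norm3 x * dot3 x w by rewrite /dot3 /=;
  ring.
  rewrite exprMn expr_div_n e11 -(@ler_pM2r _ (norm3 x ^+ 2)) ?exprn_gt0//.
  have -> : (1 - 1 / norm3 x ^+ 2 * dot3 x w ^+ 2) * norm3 x ^+ 2 = dot3 x x - dot3 x w ^+ 2.
    by rewrite xx; field; rewrite gt_eqF.
  apply: le_trans xr _.
  rewrite -exprMn ler_pXn2r ?nnegrE ?(ltW r0) ?mulr_ge0 ?invr_ge0 ?(ltW r0) ?(ltW N0)
    ?norm3_ge0//.
  have -> : r = 2 * r / N * (N / 2) by field; rewrite gt_eqF.
  apply: ler_pM; rewrite ?divr_ge0 ?mulr_ge0 ?(ltW r0) ?(ltW N0)//.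
    have -> // : 2 * (2 * r / N * (N / 2)) / N = 2 * r / N by field; rewrite gt_eqF.
  exact: ltW.
Qed.

Lemma measurable_tube_shell w x0 : measurable (tube_shell w x0).
Proof.
have mi : measurable_fun setT (id : vec3 R -> vec3 R) by exact: measurable_id.
have mc : measurable_fun setT (fun _ : vec3 R => x0) by exact: measurable_cst.
have m1 : measurable_fun setT (fun x : vec3 R => dot3 x x - dot3 x w ^+ 2 : measurableTypeR R).
  apply: measurable_funB; first exact: measurable_dot3.
  by apply: measurable_funX; exact: measurable_dot3.
have m2 : measurable_fun setT (fun x : vec3 R =>
  norm3 x : measurableTypeR R) by exact: measurable_norm3.
have m3 : measurable_fun setT (fun x : vec3 R => norm3 (x0 - x) : measurableTypeR R).
  by apply: measurable_norm3; exact: measurable_vecB.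
have -> : tube_shell w x0 =
    ((fun x => dot3 x x - dot3 x w ^+ 2) @^-1` `]-oo, r ^+ 2]%classic `&`
     (fun x => norm3 x) @^-1` `]N / 2, N]%classic) `&`
    (fun x => norm3 (x0 - x)) @^-1` `]0, +oo[%classic.
  apply/seteqP; split => x; rewrite /tube_shell/= !in_itv/= !andbT.
    by move=> /and4P[-> -> -> ->].
  by move=> [[-> /andP[-> ->]] ->].
by apply: measurableI; [apply: measurableI|]; rewrite -[X in measurable X]setTI;
  [exact: m1|exact: m2|exact: m3].
Qed.

Lemma measurable_tube_weight w x0 : measurable_fun setT (tube_weight w x0).
Proof.
have mi : measurable_fun setT (id : vec3 R -> vec3 R) by exact: measurable_id.
apply: measurable_funM; first by apply: measurable_indic; exact: measurable_tube_shell.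
apply: measurable_funM; last exact: measurable_gap_bump.
by apply: measurable_dot3; apply: measurable_direction_gap.
Qed.

Lemma tube_weight_ge0 w x0 x : 0 <= tube_weight w x0 x.
Proof.
by apply: mulr_ge0 => //; apply: mulr_ge0; [exact: dot3_ge0|exact: bump_ge0].
Qed.

Lemma tube_weight_cyc w x0 x : tube_weight (cyc w) (cyc x0) (cyc x) = tube_weight w x0 x.
Proof.
rewrite /tube_weight direction_gap_cyc dot3_cyc -cycB !norm3_cyc; congr (_ * _).
rewrite !indicE; congr ((nat_of_bool _)%:R).
by apply/idP/idP; rewrite !inE/= /tube_shell/= -cycB !norm3_cyc !dot3_cyc.
Qed.

(** The factor $r/N$ on the transversal families compensates the area $8Nr$ of their bases. In units
    of $\pi r^2M$ the axial lines contribute 256 and the transversal ones 768. *)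
Lemma integral_tube_weight_axis w x0 : norm3 w = 1 -> 1 / 3 <= w.2 ^+ 2 ->
  (\int[@leb3 R]_x (tube_weight w x0 x)%:E <= (1024 * pi * r ^+ 2 * M)%:E)%E.
Proof.
move=> w1 w3; have N0 : 0 < N by move: r0 rN; lra.
have r20 : 0 <= 2 * r by rewrite mulr_ge0 ?(ltW r0).
have w0 : w.2 != 0 by apply: contraTneq w3 => ->; rewrite expr0n/= -ltNge; lra.
pose k1 := w.1.1 / w.2; pose k2 := w.1.2 / w.2.
have E1 : w.1.1 = k1 * w.2 by rewrite /k1 divfK.
have E2 : w.1.2 = k2 * w.2 by rewrite /k2 divfK.
have [mD1 D1] := leb2_strip 0 r20 r20.
have [mD2 D2] := leb2_strip k2 (ltW N0) r20.
have [mD3 D3] := leb2_strip k1 (ltW N0) r20.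
have mD3' : measurable [set p | strip k1 N (2 * r) (p.2, p.1)].
  have ms : measurable_fun setT (fun p : measurableTypeR R * measurableTypeR R => (p.2, p.1)).
    by apply: measurable_fun_pair; [exact: measurable_snd|exact: measurable_fst].
  by have := ms measurableT _ mD3; rewrite setTI.
rewrite leb2_swap// in D3.
have [mc ic] := @leb3_invariant_cyc R.
have mcc : measurable_fun setT (fun x : vec3 R =>
  cyc (cyc x)) by exact: (measurableT_comp mc mc).
pose f1 := line_weight k1 k2 N M tau e1 e2 x0 (strip 0 (2 * r) (2 * r)).
pose f2 := line_weight 0 0 N M tau e1 e2 (cyc x0) (strip k2 N (2 * r)).
pose f3 := line_weight 0 0 N M tau e1 e2 (cyc (cyc x0)) [set p | strip k1 N (2 * r) (p.2, p.1)].
have m1 : measurable_fun setT f1 by exact: measurable_line_weight.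
have m2 : measurable_fun setT f2 by exact: measurable_line_weight.
have m3 : measurable_fun setT f3 by exact: measurable_line_weight.
have f10 x : 0 <= f1 x by exact: line_weight_ge0.
have f20 x : 0 <= f2 x by exact: line_weight_ge0.
have f30 x : 0 <= f3 x by exact: line_weight_ge0.
have m2' : measurable_fun setT (fun x => f2 (cyc x)) by exact: (measurableT_comp m2 mc).
have m3' : measurable_fun setT (fun x => f3 (cyc (cyc x))) by exact: (measurableT_comp m3 mcc).
have I1 : (\int[@leb3 R]_x (f1 x)%:E <= (4 * pi * M * (4 * (2 * r) * (2 * r)))%:E)%E.
  by have := @integral_direction_le R k1 k2 N M tau e1 e2 x0 _ M0 (ltW N0) e11 e21 mD1;
    rewrite D1 -EFinM.
have I2 : (\int[@leb3 R]_x (f2 (cyc x))%:E <= (4 * pi * M * (4 * N * (2 * r)))%:E)%E.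
  rewrite (ic (fun x => (f2 x)%:E)); [|exact/measurable_EFinP|by []].
  by have := @integral_direction_le R 0 0 N M tau e1 e2 (cyc x0) _ M0 (ltW N0) e11 e21 mD2;
    rewrite D2 -EFinM.
have I3 : (\int[@leb3 R]_x (f3 (cyc (cyc x)))%:E <= (4 * pi * M * (4 * N * (2 * r)))%:E)%E.
  rewrite (ic (fun x => (f3 (cyc x))%:E)); [| |by move=> x; exact: f30]; last first.
    by apply/measurable_EFinP; exact: (measurableT_comp m3 mc).
  rewrite (ic (fun x => (f3 x)%:E)); [|exact/measurable_EFinP|by []].
  by have := @integral_direction_le R 0 0 N M tau e1 e2 (cyc (cyc x0)) _ M0 (ltW N0) e11
    e21 mD3'; rewrite D3 -EFinM.
have c0 : 0 <= 12 * r / N by rewrite divr_ge0 ?mulr_ge0 ?(ltW r0) ?(ltW N0).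
apply: (le_trans (@le_integral_lin _ _ _ (@leb3 R) (tube_weight w x0) f1
  (fun x => f2 (cyc x) + f3 (cyc (cyc x))) 4 (12 * r / N) _ m1 _ _ f10 _ _ c0 _)) => //.
- exact: measurable_tube_weight.
- exact: measurable_funD.
- by move=> x; exact: tube_weight_ge0.
- by move=> x; rewrite addr_ge0.
- by move=> x; exact: tube_weight_le.
have I23 : (\int[@leb3 R]_x (f2 (cyc x) + f3 (cyc (cyc x)))%:E <=
    (4 * pi * M * (4 * N * (2 * r)) + 4 * pi * M * (4 * N * (2 * r)))%:E)%E.
  under eq_integral do rewrite EFinD.
  rewrite ge0_integralD//; last 4 first.
  - by move=> x _; rewrite lee_fin.
  - exact/measurable_EFinP.
  - by move=> x _; rewrite lee_fin.
  - exact/measurable_EFinP.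
  by rewrite EFinD; exact: leeD I2 I3.
apply: le_trans (leeD (lee_wpmul2l _ I1) (lee_wpmul2l _ I23)) _ => //.
rewrite -!EFinM -EFinD lee_fin le_eqVlt; apply/orP; left; apply/eqP.
by field; rewrite gt_eqF.
Qed.

Lemma integral_tube_weight w x0 : norm3 w = 1 ->
  (\int[@leb3 R]_x (tube_weight w x0 x)%:E <= (1024 * pi * r ^+ 2 * M)%:E)%E.
Proof.
move=> w1; have [mc ic] := @leb3_invariant_cyc R.
have mt w' x' : measurable_fun setT (fun x => (tube_weight w' x' x)%:E).
  by apply/measurable_EFinP; exact: measurable_tube_weight.
have t0 w' x' x : (0 <= (tube_weight w' x' x)%:E)%E by rewrite lee_fin tube_weight_ge0.
have E w' x' : (\int[@leb3 R]_x (tube_weight w' x' x)%:E =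
    \int[@leb3 R]_x (tube_weight (cyc w') (cyc x') x)%:E)%E.
  rewrite -(ic (fun x => (tube_weight (cyc w') (cyc x') x)%:E) (mt _ _) (t0 _ _)).
  by apply: eq_integral => x _; rewrite tube_weight_cyc.
have ww : w.1.1 ^+ 2 + w.1.2 ^+ 2 + w.2 ^+ 2 = 1.
  by have := sqr_norm3 w; rewrite w1 expr1n /dot3 !expr2.
have [h|h] := lerP (1 / 3) (w.2 ^+ 2); first exact: integral_tube_weight_axis.
have [h'|h'] := lerP (1 / 3) (w.1.1 ^+ 2).
  by rewrite E; apply: integral_tube_weight_axis; rewrite ?norm3_cyc.
by rewrite E E; apply: integral_tube_weight_axis; rewrite ?norm3_cyc//=; lra.
Qed.

End tube_kernel.

(** * The squared symbol over the admissible frequencies *)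

Section bilinear_kernel.
Context {R : realType}.
Local Open Scope ereal_scope.
Implicit Types (w : vec3 R) (X : spacetime R).

Definition symbol (eps : R) (s1 s2 : bool) (X0 X1 : spacetime R) : R :=
  theta s1 s2 X1.2 (X0 - X1)%R.2 * (theta s1 s2 X1.2 (X0 - X1)%R.2 <= eps)%R%:R.

Lemma measurable_spacetimeB d (T : measurableType d) (f g : T -> spacetime R) :
  measurable_fun setT f -> measurable_fun setT g -> measurable_fun setT (fun x => f x - g x)%R.
Proof.
move=> mf mg.
apply: measurable_fun_pair.
  by apply: measurable_funB; [exact: (measurableT_comp measurable_fst mf)|exact:
    (measurableT_comp measurable_fst mg)].
by apply: measurable_vecB; [exact: (measurableT_comp measurable_snd mf)|exact:
  (measurableT_comp measurable_snd mg)].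
Qed.

Lemma measurable_symbol eps s1 s2 d (T : measurableType d) (f g : T -> spacetime R) :
  measurable_fun setT f -> measurable_fun setT g ->
  measurable_fun setT (fun x => symbol eps s1 s2 (f x) (g x)).
Proof.
move=> mf mg.
have mt : measurable_fun setT (fun x =>
  theta s1 s2 (g x).2 (f x - g x)%R.2 : measurableTypeR R).
  apply: measurable_theta; first exact: (measurableT_comp measurable_snd mg).
  by apply: (measurableT_comp measurable_snd); exact: measurable_spacetimeB.
apply: measurable_funM => //.
rewrite (_ : (fun _ => _) = (fun x =>
  \1_`]-oo, eps]%classic (theta s1 s2 (g x).2 (f x - g x)%R.2))).
  exact: measurable_indic_comp.
by apply/funext => x; rewrite indicE mem_setE/= in_itv.
Qed.

Definition kernel_set w (r N1 L1 L2 : R) (s1 s2 : bool) X0 : set (spacetime R) :=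
  [set X | [&& dot3 X.2 X.2 - dot3 X.2 w ^+ 2 <= r ^+ 2, N1 / 2 < norm3 X.2, norm3 X.2 <= N1,
    `|- X.1 + (-1) ^+ s1 * norm3 X.2| <= L1 &
    `|- (X0.1 - X.1) + (-1) ^+ s2 * norm3 (X0.2 - X.2)| <= L2]%R].

Lemma measurable_kernel_set w r N1 L1 L2 s1 s2 X0 : measurable (kernel_set w r N1 L1 L2 s1
  s2 X0).
Proof.
have m2 : measurable_fun setT (fun X : spacetime R => X.2) by exact: measurable_snd.
have mc : measurable_fun setT (fun X : spacetime R => X0.2) by exact: measurable_cst.
have f1 : measurable_fun setT (fun X : spacetime R =>
  dot3 X.2 X.2 - dot3 X.2 w ^+ 2 : measurableTypeR R)%R.
  apply: measurable_funB; first exact: measurable_dot3.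
  by apply: measurable_funX; apply: measurable_dot3 => //; exact: measurable_cst.
have f2 : measurable_fun setT (fun X : spacetime R =>
  norm3 X.2 : measurableTypeR R) by exact: measurable_norm3.
have f3 : measurable_fun setT (fun X : spacetime R =>
  `|- X.1 + (-1) ^+ s1 * norm3 X.2| : measurableTypeR R)%R.
  apply: measurableT_comp => //; apply: measurable_funD; last exact: measurable_funM.
  by apply: measurableT_comp => //; exact: measurable_fst.
have f4 : measurable_fun setT (fun X : spacetime R =>
  `|- (X0.1 - X.1) + (-1) ^+ s2 * norm3 (X0.2 - X.2)| : measurableTypeR R)%R.
  apply: measurableT_comp => //; apply: measurable_funD; last first.
    by apply: measurable_funM => //; apply: measurable_norm3; exact: measurable_vecB.
  apply: measurableT_comp => //; apply: measurable_funB => //; exact: measurable_fst.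
have -> : kernel_set w r N1 L1 L2 s1 s2 X0 =
    (((fun X => dot3 X.2 X.2 - dot3 X.2 w ^+ 2)%R @^-1` `]-oo, (r ^+ 2)%R]%classic `&`
     (fun X => norm3 X.2) @^-1` `](N1 / 2)%R, N1]%classic) `&`
    (fun X => `|- X.1 + (-1) ^+ s1 * norm3 X.2|)%R @^-1` `]-oo, L1]%classic) `&`
    (fun X => `|- (X0.1 - X.1) + (-1) ^+ s2 * norm3 (X0.2 - X.2)|)%R @^-1` `]-oo, L2]%classic.
  apply/seteqP; split => X; rewrite /kernel_set/= !in_itv/=.
    by move=> /and5P[-> -> -> -> ->].
  by move=> [[[-> /andP[-> ->]] ->] ->].
apply: measurableI; [apply: measurableI; [apply: measurableI|]|];
  rewrite -[X in measurable X]setTI;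
  [exact: f1|exact: f2|exact: f3|exact: f4].
Qed.

(** The time window is that of the thinner of the two cones. Adding both cone conditions eliminates
    the time variable and places the phase within $L_1+L_2\le2\max(L_1,L_2)$ of $\tau_0$, where
    [bump] is at least 1. *)
Lemma symbol_kernel_le w r N1 L1 L2 s1 s2 X0 X : (0 < L1)%R -> (0 < L2)%R ->
  (\1_(kernel_set w r N1 L1 L2 s1 s2 X0) X * symbol 2^-1%R s1 s2 X0 X ^+ 2 <=
   \1_`[- Num.min L1 L2, Num.min L1 L2]%classic
     (X.1 - (if L1 <= L2 then (-1) ^+ s1 * norm3 X.2 else X0.1 - (-1) ^+ s2 * norm3 (X0.2 -
       X.2))) *
   (4 * tube_weight ((-1) ^+ s1) ((-1) ^+ s2) X0.1 (2 * Num.max L1 L2) r N1 w X0.2 X.2))%R.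
Proof.
move=> L10 L20; set c := (if _ then _ else _).
have rhs0 : (0 <= \1_`[- Num.min L1 L2, Num.min L1 L2]%classic (X.1 - c) *
    (4 * tube_weight ((-1) ^+ s1) ((-1) ^+ s2) X0.1 (2 * Num.max L1 L2) r N1 w X0.2 X.2))%R.
  by apply: mulr_ge0 => //; apply: mulr_ge0 => //; exact: tube_weight_ge0.
rewrite [X in (X * _ <= _)%R]indicE; case: (boolP (X \in _)) => [|_]; last by rewrite mul0r.
rewrite inE => /and5P[h1 h2 h3 h4 h5]; rewrite mul1r /symbol.
case: (lerP (theta s1 s2 X.2 (X0 - X)%R.2) 2^-1%R) => [th|_]; last by rewrite mulr0 expr0n.
rewrite mulr1.
have th' : (theta s1 s2 X.2 (X0.2 - X.2) <= 1 / 2)%R by rewrite div1r.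
have [n1 n2 tle] := theta_gap th'.
rewrite indicE mem_set/=; last first.
  rewrite in_itv/= -ler_norml /c; case: ifP => L12.
    by rewrite minEle L12 -normrN opprB addrC.
  rewrite minEle L12.
  have -> // : (X.1 - (X0.1 - (-1) ^+ s2 * norm3 (X0.2 - X.2)) = - (X0.1 - X.1) + (-1) ^+
    s2 * norm3 (X0.2 - X.2))%R by ring.
rewrite mul1r; apply: le_trans tle _; rewrite ler_pM2l//.
rewrite /tube_weight indicE mem_set/=; last by apply/and4P; split.
rewrite mul1r; apply: ler_peMr; first exact: dot3_ge0.
have mx1 : (L1 <= Num.max L1 L2)%R by rewrite le_max lexx.
have mx2 : (L2 <= Num.max L1 L2)%R by rewrite le_max lexx orbT.
apply: bump_ge1; first by rewrite mulr_gt0// lt_max L10.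
have -> : ((-1) ^+ s1 * norm3 X.2 + (-1) ^+ s2 * norm3 (X0.2 - X.2) - X0.1 =
  (- X.1 + (-1) ^+ s1 * norm3 X.2) + (- (X0.1 - X.1) + (-1) ^+ s2 * norm3 (X0.2 - X.2)))%R
    by ring.
apply: le_trans (ler_normD _ _) _; lra.
Qed.

(** The constant is $2\cdot4\cdot1024\cdot2$: the time window $2\min$, the 4 of [theta_gap], the
    tube, and the width $2\max$ of the phase; $\min\cdot\max=L_1L_2$. *)
Lemma energy_symbol_le w r N1 L1 L2 s1 s2 X0 : norm3 w = 1%R -> (0 < r)%R -> (r <= N1 / 2)%R ->
  (0 < L1)%R -> (0 < L2)%R ->
  \int[@leb13 R]_X (\1_(kernel_set w r N1 L1 L2 s1 s2 X0) X * symbol 2^-1%R s1 s2 X0 X ^+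
    2)%:E <=
  (16384 * pi * (r ^+ 2 * L1 * L2))%:E.
Proof.
move=> w1 r0 rN L10 L20.
set mn := Num.min L1 L2; set mx := Num.max L1 L2.
have mn0 : (0 < mn)%R by rewrite lt_min L10.
have mx0 : (0 < mx)%R by rewrite lt_max L10.
have e1 s : (((-1) ^+ s) ^+ 2 = 1 :> R)%R by rewrite sqrr_sign.
pose c (x : vec3 R) := (if L1 <= L2 then (-1) ^+ s1 * norm3 x else X0.1 - (-1) ^+ s2 *
  norm3 (X0.2 - x))%R.
have mc : measurable_fun setT (c : vec3 R -> measurableTypeR R).
  have mi : measurable_fun setT (fun x : vec3 R => x) by exact: measurable_id.
  rewrite /c; case: (L1 <= L2)%R.
    by apply: measurable_funM => //; exact: measurable_norm3.
  apply: measurable_funB => //; apply: measurable_funM => //; apply: measurable_norm3.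
  by apply: measurable_vecB => //; exact: measurable_cst.
pose f x := (4 * tube_weight ((-1) ^+ s1) ((-1) ^+ s2) X0.1 (2 * mx) r N1 w X0.2 x)%R.
have mf : measurable_fun setT (fun x => (f x)%:E).
  by apply/measurable_EFinP; apply: measurable_funM => //; exact: measurable_tube_weight.
have f0 x : 0 <= (f x)%:E by rewrite lee_fin mulr_ge0// tube_weight_ge0.
apply: (@le_trans _ _ (\int[@leb13 R]_X ((\1_`[- mn, mn]%classic (X.1 - c X.2)%R)%:E * (f
  X.2)%:E))).
  apply: ge0_le_integral => //.
  - by move=> X _; rewrite lee_fin mulr_ge0// sqr_ge0.
  - apply/measurable_EFinP; apply: measurable_funM; first by apply: measurable_indic;
    exact: measurable_kernel_set.
    by apply: measurable_funX; apply: measurable_symbol;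
      [exact: measurable_cst|exact: measurable_id].
  - apply: emeasurable_funM; last exact: (measurableT_comp mf measurable_snd).
    apply/measurable_EFinP; apply: measurable_indic_comp => //.
    by apply: measurable_funB => //; exact: (measurableT_comp mc measurable_snd).
  - by move=> X _; rewrite -EFinM lee_fin; exact: symbol_kernel_le.
have := @integral_strip R _ _ (@leb3 R) c mn (fun x => (f x)%:E) (ltW mn0) mc mf f0.
rewrite /leb13 => ->.
have I : \int[@leb3 R]_x (f x)%:E <= (4 * (1024 * pi * r ^+ 2 * (2 * mx)))%:E.
  under eq_integral do rewrite EFinM.
  rewrite ge0_integralZl//; last 2 first.
  - by apply/measurable_EFinP; exact: measurable_tube_weight.
  - by move=> x _; rewrite lee_fin tube_weight_ge0.
  rewrite EFinM; apply: lee_wpmul2l => //.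
  by apply: integral_tube_weight => //; rewrite mulr_gt0.
apply: le_trans (lee_wpmul2l _ I) _; first by rewrite lee_fin mulr_ge0// ltW.
rewrite -EFinM lee_fin le_eqVlt; apply/orP; left; apply/eqP.
have E : (mn * mx = L1 * L2)%R by rewrite /mn /mx minEle maxEle; case: ifP => _ //;
  rewrite mulrC.
by rewrite -(mulrA (r ^+ 2)%R) -E; ring.
Qed.

End bilinear_kernel.

(** * The bilinear estimate *)

Section bilinear_estimate.
Context {R : realType}.
Local Open Scope ereal_scope.
Local Opaque leb13.
Implicit Types (F G u v : spacetime R -> R[i]) (X : spacetime R).

Lemma csq_scale (t : R) (z : R[i]) : csq (t%:C%C * z)%R = (t ^+ 2 * csq z)%R.
Proof. by rewrite csqM /csq /= expr0n addr0. Qed.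

Lemma mass_mul_sqr_le u v : cmeas u -> cmeas v ->
  mass leb13 (fun X => u X * v X)%R * mass leb13 (fun X => u X * v X)%R <=
  energy leb13 u * energy leb13 v.
Proof.
move=> mu mv.
have h : mass leb13 (fun X => u X * v X)%R <= L2norm u * L2norm v.
  have h2 : (2^-1 + 2^-1 = 1 :> R)%R by field.
  have := @hoelder _ (spacetime R) R (@leb13 R) (fun X => Normc.normc (u X))
    (fun X => Normc.normc (v X)) 2 2 (measurable_normc mu) (measurable_normc mv) (ltr0Sn _
      1) (ltr0Sn _ 1) h2.
  rewrite Lnorm1; apply: le_trans.
  rewrite le_eqVlt; apply/orP; left; apply/eqP; apply: eq_integral => X _.
  by rewrite Normc.normcM /= ger0_norm ?mulr_ge0 ?normc_ge0.
apply: (le_trans (lee_pmul (mass_ge0 _ _) (mass_ge0 _ _) h h)).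
by rewrite muleACA !L2norm_sqr.
Qed.

(** Cauchy-Schwarz; the 4 is the squared constant of [normc_cint]. *)
Lemma csq_cint_le F v (p : spacetime R -> R) (A : R) : cmeas F -> cmeas v ->
  measurable_fun setT p -> {ae leb13, forall X, F X = ((p X)%:C%C * v X)%R} ->
  \int[@leb13 R]_X (p X ^+ 2)%:E <= A%:E ->
  (csq (cint leb13 F))%:E <= (4 * A)%:E * energy leb13 v.
Proof.
move=> mF mv mp Fv pA.
have mpc := cmeas_real mp.
have E : mass leb13 F = mass leb13 (fun X => (p X)%:C%C * v X)%R.
  apply: ge0_ae_eq_integral => //.
  - exact: measurable_Enormc.
  - by apply: measurable_Enormc; exact: cmeasM.
  - by move=> X _; rewrite lee_fin normc_ge0.
  - by move=> X _; rewrite lee_fin normc_ge0.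
  - by apply: filterS Fv => X -> _.
have h := normc_cint leb13 mF.
have n0 : 0 <= (Normc.normc (cint leb13 F))%:E by rewrite lee_fin normc_ge0.
rewrite -sqr_normc expr2 EFinM; apply: (le_trans (lee_pmul n0 n0 h h)).
rewrite muleACA E -EFinM.
rewrite [X in X * _ <= _](_ : _ = 4%:E); last by congr EFin; ring.
rewrite EFinM -muleA; apply: lee_wpmul2l => //.
apply: (le_trans (mass_mul_sqr_le mpc mv)).
apply: lee_wpmul2r; first exact: energy_ge0.
apply: le_trans pA; rewrite /energy le_eqVlt; apply/orP; left; apply/eqP.
by apply: eq_integral => X _; rewrite /csq /= expr0n addr0.
Qed.

(** The kernel [p X0] represents [Q] only almost everywhere for each [X0], since supports are known
    only up to null sets. With $X_2$ fixed, $X_0=X+X_2$, which is where the shifted weight in the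
    hypothesis on [B] comes from. *)
Lemma energy_bilinear_le (Q : spacetime R * spacetime R -> R[i]) (p : spacetime R ->
  spacetime R -> R)
    G1 G2 (chi : spacetime R -> R) (A : R) (B : \bar R) :
  (0 <= A)%R -> cmeas Q -> cmeas G1 -> cmeas G2 -> measurable_fun setT chi ->
    (forall X, 0 <= chi X)%R ->
  (forall X0, measurable_fun setT (p X0)) ->
  (forall X0, {ae leb13, forall X, Q (X0, X) = ((p X0 X)%:C%C * (G1 X * G2 (X0 - X)))%R}) ->
  (forall X0, \int[@leb13 R]_X (p X0 X ^+ 2)%:E <= A%:E) ->
  0 <= B -> (forall X2, \int[@leb13 R]_X (chi (X + X2)%R * csq (G1 X))%:E <= B) ->
  \int[@leb13 R]_X0 (chi X0 * csq (cint leb13 (fun X => Q (X0, X))))%:E <=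
  (4 * A)%:E * (B * energy leb13 G2).
Proof.
move=> A0 mQ mG1 mG2 mchi chi0 mp Qp pA B0 hB.
have ms1 (X0 : spacetime R) := (leb13_invariant_reflect X0).1.
have ms2 (X0 : spacetime R) := (leb13_invariant_reflect X0).2.
have mA : measurable_fun setT (fun Z : spacetime R * spacetime R => Z.1 - Z.2)%R.
  by apply: measurable_spacetimeB; [exact: measurable_fst|exact: measurable_snd].
pose g (Z : spacetime R * spacetime R) := (chi Z.1 * (csq (G1 (Z.1 - Z.2)) * csq (G2 Z.2)))%:E.
have g0 Z : 0 <= g Z by rewrite lee_fin !mulr_ge0// csq_ge0.
have mg : measurable_fun setT g.
  apply/measurable_EFinP; apply: measurable_funM;
    first exact: (measurableT_comp mchi measurable_fst).
  apply: measurable_funM; first exact: (measurableT_comp (measurable_csq mG1) mA).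
  exact: (measurableT_comp (measurable_csq mG2) measurable_snd).
have step1 X0 : (chi X0 * csq (cint leb13 (fun X => Q (X0, X))))%:E <=
    (4 * A)%:E * \int[@leb13 R]_X g (X0, X).
  have mQ0 : cmeas (fun X => Q (X0, X)) by apply: cmeas_comp mQ _; exact: measurable_fun_pair.
  have mv : cmeas (fun X => G1 X * G2 (X0 - X))%R by apply: cmeasM => //;
    exact: (cmeas_comp mG2 (ms1 X0)).
  have := csq_cint_le mQ0 mv (mp X0) (Qp X0) (pA X0).
  move=> h; rewrite EFinM; apply: le_trans (lee_wpmul2l _ h) _; first by rewrite lee_fin.
  rewrite muleCA; apply: lee_wpmul2l; first by rewrite lee_fin mulr_ge0.
  rewrite -ge0_integralZl//; last 3 first.
  - exact: measurable_Ecsq.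
  - by move=> X _; rewrite lee_fin csq_ge0.
  - by rewrite lee_fin.
  have mgX : measurable_fun setT (fun X => g (X0, X)).
    by apply: (measurableT_comp mg); exact: measurable_fun_pair.
  rewrite -(ms2 X0 (fun X => g (X0, X)) mgX)//.
  rewrite le_eqVlt; apply/orP; left; apply/eqP; apply: eq_integral => X _.
  by rewrite /g/= subKr -EFinM csqM.
apply: (@le_trans _ _ (\int[@leb13 R]_X0 ((4 * A)%:E * \int[@leb13 R]_X g (X0, X)))).
  apply: ge0_le_integral; first exact: measurableT.
  - by move=> X _; rewrite lee_fin mulr_ge0// csq_ge0.
  - apply/measurable_EFinP; apply: measurable_funM => //.
    by apply: measurable_csq; exact: (@cmeas_cint R _ _ (spacetime R) (spacetime R) (@leb13 R)).
  - by apply: measurable_funeM; exact: (@measurable_fun_fubini_tonelli_F _ _ _ _ _ (@leb13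
    R) g mg g0).
  - by move=> X0 _; exact: step1.
rewrite ge0_integralZl//; last 3 first.
- exact: (@measurable_fun_fubini_tonelli_F _ _ _ _ _ (@leb13 R) g mg g0).
- by move=> X _; exact: integral_ge0.
- by rewrite lee_fin mulr_ge0.
apply: lee_wpmul2l; first by rewrite lee_fin mulr_ge0.
rewrite (@fubini_tonelli _ _ _ _ _ (@leb13 R) (@leb13 R) g mg g0).
rewrite -ge0_integralZl//; last 2 first.
- exact: measurable_Ecsq.
- by move=> X _; rewrite lee_fin csq_ge0.
apply: ge0_le_integral; first exact: measurableT.
- by move=> X _; exact: integral_ge0.
- exact: (@measurable_fun_fubini_tonelli_G _ _ _ _ _ (@leb13 R) g mg g0).
- by apply: measurable_funeM; exact: measurable_Ecsq.
move=> X2 _.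
have [_ is_] := leb13_invariant_shift X2.
rewrite -(is_ (fun X => g (X, X2)))//; last first.
  by apply: (measurableT_comp mg); exact: measurable_fun_pair.
apply: (@le_trans _ _ (\int[@leb13 R]_X ((chi (X + X2)%R * csq (G1 X))%:E * (csq (G2 X2))%:E))).
  rewrite le_eqVlt; apply/orP; left; apply/eqP; apply: eq_integral => X _.
  by rewrite /g/= addrK mulrA EFinM.
rewrite ge0_integralZr//; last 3 first.
- apply/measurable_EFinP; apply: measurable_funM; last exact: measurable_csq.
  by apply: (measurableT_comp mchi); exact: (leb13_invariant_shift X2).1.
- by move=> X _; rewrite lee_fin mulr_ge0// csq_ge0.
- by rewrite lee_fin csq_ge0.
by apply: lee_wpmul2r; first by rewrite lee_fin csq_ge0.
Qed.

Variable K : R.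
Hypothesis K0 : (0 < K)%R.
Hypothesis PK : forall u, cmeas u -> mass leb13 u < +oo -> energy leb13 u < +oo ->
  cmeas (fourier1 u) /\ energy leb13 (fourier1 u) = K%:E * energy leb13 u.

Variables (N1 N2 L1 L2 r : R) (s1 s2 : bool) (w : vec3 R) (u1 u2 : spacetime R -> R[i]).
Hypotheses (L10 : (0 < L1)%R) (L20 : (0 < L2)%R) (r0 : (0 < r)%R) (rN : (r <= N1 / 2)%R)
  (w1 : norm3 w = 1%R).
Hypotheses (supp1 : fsupp_in u1 (cone_nbhd s1 N1 L1)) (supp2 : fsupp_in u2 (cone_nbhd s2 N2
  L2)).

Let Pu1 := fproj [set X | tube r w X.2] u1.
Let bh := bilin_hat 2^-1%R s1 s2 Pu1 u2.

Lemma aeF13 : Filter (almost_everywhere (@leb13 R)).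
Proof. exact: (ae_filter_ringOfSetsType (@leb13 R)). Qed.

(** The alternative 0 covers both the points outside the supports and the case where the tube
    projection takes its default value. *)
Lemma fourier_Pu1_ae : {ae leb13, forall X, fourier Pu1 X = 0%R \/
  [/\ fourier Pu1 X = fourier u1 X, (dot3 X.2 X.2 - dot3 X.2 w ^+ 2 <= r ^+ 2)%R &
    cone_nbhd s1 N1 L1 X]}.
Proof.
have F13 := aeF13.
pose v X := ((\1_[set X : spacetime R | tube r w X.2] X)%:C%C * fourier u1 X)%R.
rewrite /Pu1 /fproj -/v.
have [h|h] := fourier_inv_fourier K0 PK v; last by apply: filterS h => X ->; left.
apply: (@filterS2 _ _ F13 _ _ _ _ h supp1) => X -> hX; rewrite /v indicE.
have [k|k] := pselect (cone_nbhd s1 N1 L1 X); last by left; rewrite hX// mulr0.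
case: (boolP (X \in _)) => [|_]; last by left; rewrite mul0r.
rewrite inE/= => t; right; split => //; first by rewrite mul1r.
exact: tube_sub w1 r0 t.
Qed.

Lemma csq_fourier_Pu1_ae : {ae leb13, forall X, (csq (fourier Pu1 X) <= csq (fourier u1 X))%R}.
Proof.
have F13 := aeF13; apply: filterS fourier_Pu1_ae => X [->|[-> _ _]]//.
by rewrite csq0 csq_ge0.
Qed.

Lemma cmeas_bilinear_integrand : cmeas (fun Z : spacetime R * spacetime R =>
  (symbol 2^-1%R s1 s2 Z.1 Z.2)%:C%C * fourier Pu1 Z.2 * fourier u2 (Z.1 - Z.2))%R.
Proof.
have [m1 _] := fourier_L2 Pu1; have [m2 _] := fourier_L2 u2.
apply: cmeasM; first apply: cmeasM.
- by apply: cmeas_real; apply: measurable_symbol; [exact: measurable_fst|exact: measurable_snd].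
- exact: (cmeas_comp m1 measurable_snd).
- apply: (cmeas_comp m2); apply: measurable_spacetimeB;
  [exact: measurable_fst|exact: measurable_snd].
Qed.

Let A : R := (16384 * pi * (r ^+ 2 * L1 * L2))%R.

Lemma bilin_const_ge0 : (0 <= A)%R.
Proof.
apply: mulr_ge0; first by apply: mulr_ge0; [exact: ler0n|exact: pi_ge0].
by apply: mulr_ge0 (ltW L20); apply: mulr_ge0 (ltW L10); exact: sqr_ge0.
Qed.

Lemma measurable_slab (a b : R) : measurable_fun setT (\1_(slab w `[a, b]%classic) :
  spacetime R -> R).
Proof.
rewrite (_ : \1_(slab _ _) = fun X : spacetime R => \1_`[a, b]%classic (dot3 X.2 w) : R).
  by apply: measurable_indic_comp => //; exact: measurable_freq.
by apply/funext => X; rewrite !indicE; congr ((nat_of_bool _)%:R); apply/idP/idP; rewrite !inE.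
Qed.

(** The weight is general because it is used twice: with 1 for square integrability and with the
    indicator of the slab for the estimate. *)
Lemma bilin_hat_weight_le (chi : spacetime R -> R) (B : \bar R) :
  measurable_fun setT chi -> (forall X, 0 <= chi X)%R -> 0 <= B ->
  (forall X2, \int[@leb13 R]_X (chi (X + X2)%R * csq (fourier Pu1 X))%:E <= B) ->
  \int[@leb13 R]_X (chi X * csq (bh X))%:E <= (4 * A)%:E * (B * energy leb13 (fourier u2)).
Proof.
move=> mchi chi0 B0 hB; have F13 := aeF13.
have [m1 _] := fourier_L2 Pu1; have [m2 _] := fourier_L2 u2.
apply: (@energy_bilinear_le (fun Z : spacetime R * spacetime R =>
  (symbol 2^-1%R s1 s2 Z.1 Z.2)%:C%C * fourier Pu1 Z.2 * fourier u2 (Z.1 - Z.2))%R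
  (fun X0 X => \1_(kernel_set w r N1 L1 L2 s1 s2 X0) X *
   symbol 2^-1%R s1 s2 X0 X)%R (fourier Pu1) (fourier u2) chi A B) => //.
- exact: bilin_const_ge0.
- exact: cmeas_bilinear_integrand.
- move=> X0; apply: measurable_funM; first by apply: measurable_indic;
  exact: measurable_kernel_set.
  by apply: measurable_symbol; [exact: measurable_cst|exact: measurable_id].
- move=> X0; have supp2' := invariant_ae (leb13_invariant_reflect X0) supp2.
  apply: (@filterS2 _ _ F13 _ _ _ _ fourier_Pu1_ae supp2') => X /= h1 h2.
  case: h1 => [h1|[_ t [n l]]]; first by rewrite h1 mul0r !mulr0 mul0r.
  have [k|k] := pselect (cone_nbhd s2 N2 L2 (X0 - X)%R); last by rewrite h2// !mulr0.
  rewrite indicE mem_set; first by rewrite mul1r mulrA.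
  by case/andP: n => n1 n2; case: k => _ k; apply/and5P; split.
- move=> X0; apply: le_trans (energy_symbol_le s1 s2 X0 w1 r0 rN L10 L20).
  rewrite le_eqVlt; apply/orP; left; apply/eqP; apply: eq_integral => X _.
  rewrite exprMn; congr (_ * _)%:E; rewrite indicE.
  by case: (_ \in _); rewrite ?expr1n ?expr0n.
Qed.

Lemma bilin_hat_L2 : cLp 2%:E bh.
Proof.
have [m1 e1] := fourier_L2 Pu1; have [m2 e2] := fourier_L2 u2.
apply/cLp2P; split.
  exact: (@cmeas_cint R _ _ (spacetime R) (spacetime R) (@leb13 R) _ cmeas_bilinear_integrand).
have := @bilin_hat_weight_le (fun=> 1%R) (energy leb13 (fourier Pu1)).
move=> /(_ _ _ _ _)/le_lt_trans h.
have -> : energy leb13 bh = \int[@leb13 R]_X (1 * csq (bh X))%R%:E.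
  by apply: eq_integral => X _; rewrite mul1r.
apply: h => //.
- exact: energy_ge0.
- move=> X2; rewrite le_eqVlt; apply/orP; left; apply/eqP.
  by apply: eq_integral => X _; rewrite mul1r.
- have : (0 <= 4 * A)%R by apply: mulr_ge0 bilin_const_ge0; exact: ler0n.
  move: (4 * A)%R => c c0.
  rewrite lte_mul_pinfty ?lee_fin// lte_mul_pinfty// ?energy_ge0//.
  by rewrite (ge0_fin_numE (energy_ge0 _ _)); exact: e1.
Qed.

(** Shifting the argument by [X2] moves the interval by $-\xi_2\cdot\omega$; the tube projection is
    dropped, as it only decreases the modulus of the transform. *)
Lemma energy_slab_translate_le (a b : R) (S : \bar R) X2 : (a <= b)%R ->
  (forall c : R, L2norm (fproj (slab w `[(a + c)%R, (b + c)%R]%classic) u1) <= S) ->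
  \int[@leb13 R]_X (\1_(slab w `[a, b]%classic) (X + X2)%R * csq (fourier Pu1 X))%:E <=
  (4 * K)%:E * (S * S).
Proof.
move=> ab hS; have F13 := aeF13.
have [m1 _] := fourier_L2 Pu1; have [m2 _] := fourier_L2 u1.
pose c := (- dot3 X2.2 w)%R.
have ab' : (a + c <= b + c)%R by rewrite lerD2r.
have E X : \1_(slab w `[a, b]%classic) (X + X2)%R =
    \1_(slab w `[(a + c)%R, (b + c)%R]%classic) X :> R.
  rewrite !indicE; congr ((nat_of_bool _)%:R); apply/idP/idP; rewrite !inE/= /slab/= !in_itv/=;
  have -> : dot3 (X + X2)%R.2 w = (dot3 X.2 w - c)%R by rewrite /c /dot3 /=; ring.
  - by move=> /andP[h1 h2]; apply/andP; split; lra.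
  - by move=> /andP[h1 h2]; apply/andP; split; lra.
have mI : measurable_fun setT (\1_(slab w `[(a + c)%R, (b + c)%R]%classic) : spacetime R -> R).
  exact: measurable_slab.
apply: (@le_trans _ _ (energy leb13 (fun X =>
  (\1_(slab w `[(a + c)%R, (b + c)%R]%classic) X)%:C%C * fourier u1 X)%R)).
  rewrite /energy; apply: ae_ge0_le_integral => //.
  - by move=> X _; rewrite lee_fin mulr_ge0// csq_ge0.
  - under eq_fun do rewrite E.
    by apply/measurable_EFinP; apply: measurable_funM => //; exact: measurable_csq.
  - by move=> X _; rewrite lee_fin csq_ge0.
  - by apply: measurable_Ecsq; apply: cmeasM => //; exact: cmeas_real.
  apply: filterS csq_fourier_Pu1_ae => X h _; rewrite E csq_scale lee_fin.
  have -> : (\1_(slab w `[(a + c)%R, (b + c)%R]%classic) X ^+ 2 = \1_(slab w `[(a + c)%R,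
    (b + c)%R]%classic) X :> R)%R.
    by rewrite indicE; case: (_ \in _); rewrite ?expr1n ?expr0n.
  by rewrite ler_wpM2l.
apply: le_trans (energy_slab_le K0 PK w u1 ab') _.
apply: lee_wpmul2l; first by rewrite lee_fin mulr_ge0// ltW.
by rewrite -L2norm_sqr; apply: lee_pmul; rewrite ?L2norm_ge0.
Qed.

(** Squares are compared. The factor $256K$ is $(4/K)\cdot4\cdot4K\cdot4K$: the inverse transform on
    the left, the 4 of [csq_cint_le], and the passage to the transforms of [u1] and [u2]. *)
Lemma L2norm_bilin_le (a b : R) (S : \bar R) : (a <= b)%R ->
  (forall c : R, L2norm (fproj (slab w `[(a + c)%R, (b + c)%R]%classic) u1) <= S) ->
  L2norm (fproj (slab w `[a, b]%classic) (bilin 2^-1%R s1 s2 Pu1 u2)) <=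
  ((1 + 256 * K * (16384 * pi)) * Num.sqrt (r ^+ 2 * L1 * L2))%:E * S * L2norm u2.
Proof.
move=> ab hS.
have S0 : 0 <= S by apply: le_trans (hS 0%R); exact: L2norm_ge0.
set D := (r ^+ 2 * L1 * L2)%R; set C := (1 + _)%R.
have D0 : (0 <= D)%R by rewrite !mulr_ge0 ?exprn_ge0 ?(ltW r0) ?(ltW L10) ?(ltW L20).
have P0 : (0 <= 256 * K * (16384 * pi) :> R)%R.
  by apply: mulr_ge0; apply: mulr_ge0; [exact: ler0n|exact: ltW|exact: ler0n|exact: pi_ge0].
have C0 : (0 <= C)%R by rewrite addr_ge0.
apply: mule_self_le; first exact: L2norm_ge0.
  by rewrite !mule_ge0 ?L2norm_ge0// lee_fin mulr_ge0 ?sqrtr_ge0.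
rewrite L2norm_sqr muleACA L2norm_sqr muleACA -EFinM.
have mbh : cmeas bh by have /cLp2P[] := bilin_hat_L2.
have mI := measurable_slab a b.
have [mfb _] := fourier_L2 (bilin 2^-1%R s1 s2 Pu1 u2).
have step : energy leb13 (fun X => (\1_(slab w `[a, b]%classic) X)%:C%C * fourier (bilin
  2^-1%R s1 s2 Pu1 u2) X)%R <=
   (4 * A)%:E * ((4 * K)%:E * (S * S) * ((4 * K)%:E * energy leb13 u2)).
  have F13 := aeF13.
  have B0 : 0 <= (4 * K)%:E * (S * S) by rewrite !mule_ge0// lee_fin mulr_ge0// ltW.
  have R0 : 0 <= (4 * A)%:E * ((4 * K)%:E * (S * S) * ((4 * K)%:E * energy leb13 u2)).
    apply: mule_ge0; first by rewrite lee_fin mulr_ge0// bilin_const_ge0.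
    by rewrite mule_ge0// mule_ge0 ?energy_ge0// lee_fin mulr_ge0// ltW.
  have [h|h] := fourier_inv_fourier K0 PK bh; last first.
    have -> : energy leb13 (fun X => (\1_(slab w `[a, b]%classic) X)%:C%C *
        fourier (bilin 2^-1%R s1 s2 Pu1 u2) X)%R = energy (@leb13 R) (fun=> 0%R).
      apply: ae_eq_energy; [|exact: cmeas_cst|].
        by apply: cmeasM => //; exact: cmeas_real.
      by apply: filterS h => X; rewrite /bilin -/bh => ->; rewrite mulr0.
    by rewrite energy0.
  have -> : energy leb13 (fun X => (\1_(slab w `[a, b]%classic) X)%:C%C *
      fourier (bilin 2^-1%R s1 s2 Pu1 u2) X)%R =
      energy leb13 (fun X => (\1_(slab w `[a, b]%classic) X)%:C%C * bh X)%R.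
    apply: ae_eq_energy.
    - by apply: cmeasM => //; exact: cmeas_real.
    - by apply: cmeasM => //; exact: cmeas_real.
    - by apply: filterS h => X; rewrite /bilin -/bh => ->.
  apply: (@le_trans _ _ ((4 * A)%:E * ((4 * K)%:E * (S * S) * energy leb13 (fourier u2)))).
    have -> : energy leb13 (fun X => (\1_(slab w `[a, b]%classic) X)%:C%C * bh X)%R =
        \int[@leb13 R]_X (\1_(slab w `[a, b]%classic) X * csq (bh X))%R%:E.
      apply: eq_integral => X _; rewrite csq_scale indicE.
      by case: (_ \in _); rewrite ?expr1n ?expr0n.
    apply: bilin_hat_weight_le => // X2.
    exact: energy_slab_translate_le.
  apply: lee_wpmul2l; first by rewrite lee_fin mulr_ge0// bilin_const_ge0.
  by apply: lee_wpmul2l => //; exact: (energy_fourier_le K0 PK).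
apply: le_trans (energy_inv_fourier_le K0 PK _) _.
apply: le_trans (lee_wpmul2l _ step) _; first by rewrite lee_fin divr_ge0// ltW.
have E0 := energy_ge0 leb13 u2.
have SS0 : 0 <= S * S by exact: mule_ge0.
move: (S * S) (energy leb13 u2) SS0 E0 => T E SS0 E0.
have -> : (4 / K)%:E * ((4 * A)%:E * ((4 * K)%:E * T * ((4 * K)%:E * E))) = (256 * K *
  A)%:E * T * E.
  rewrite [(4 * K)%:E * T * _]muleACA !muleA -!EFinM; congr (_%:E * _ * _).
  by field; rewrite gt_eqF.
apply: lee_wpmul2r => //; apply: lee_wpmul2r => //; rewrite lee_fin.
have -> : (256 * K * A = 256 * K * (16384 * pi) * D)%R by rewrite /A -/D mulrA.
rewrite [leRHS]mulrACA -[X in (_ <= _ * X)%R]expr2 sqr_sqrtr//.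
(* No square root of the constant is taken: $P\le(1+P)^2$, and $1+P\ge1$ as the theorem demands. *)
apply: ler_wpM2r => //; rewrite /C; move: (256 * K * (16384 * pi))%R P0 => P P0.
apply: (@le_trans _ _ (1 + P)%R); first by rewrite lerDr.
by rewrite ler_peMr ?lerDl ?addr_ge0.
Qed.

End bilinear_estimate.

Theorem theorem2p5 (R : realType) :
  exists eps0 C : R,
    [/\ 0 < eps0, eps0 < 1, 1 <= C &
      forall (N1 N2 L1 L2 : R) (s1 s2 : bool) (r : R) (w : vec3 R) (a b : R)
             (u1 u2 : spacetime R -> R[i]),
        0 < N1 -> 0 < N2 -> 0 < L1 -> 0 < L2 ->
        0 < r -> norm3 w = 1 -> a <= b ->
        cLp 2%:E u1 -> cLp 2%:E u2 ->
        fsupp_in u1 (cone_nbhd s1 N1 L1) ->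
        fsupp_in u2 (cone_nbhd s2 N2 L2) ->
        r <= eps0 * Num.min N1 N2 ->
        let Pu1 := fproj [set X | tube r w X.2] u1 in
        let I (c : R) := `[a + c, b + c]%classic in
        cLp 2%:E (bilin_hat eps0 s1 s2 Pu1 u2) /\
        (L2norm (fproj (slab w `[a, b]%classic) (bilin eps0 s1 s2 Pu1 u2)) <=
           (C * Num.sqrt (r ^+ 2 * L1 * L2))%:E *
           ereal_sup [set L2norm (fproj (slab w (I c)) u1) | c in [set: R]] *
           L2norm u2)%E].
Proof.
have [K K0 PK] := @plancherel_spacetime R.
exists 2^-1, (1 + 256 * K * (16384 * pi)); split.
- by rewrite invr_gt0.
- by rewrite invf_lt1 ?ltr1n.
- rewrite lerDl; apply: mulr_ge0; apply: mulr_ge0;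
  [exact: ler0n|exact: ltW|exact: ler0n|exact: pi_ge0].
move=> N1 N2 L1 L2 s1 s2 r w a b u1 u2 N10 N20 L10 L20 r0 w1 ab _ _ supp1 supp2 rN Pu1 I.
have rN1 : r <= N1 / 2.
  apply: le_trans rN _; rewrite mulrC ler_pM2r ?invr_gt0//.
  by rewrite ge_min lexx.
split; first exact: (bilin_hat_L2 K0 PK L10 L20 r0 rN1 w1 supp1 supp2).
apply: (L2norm_bilin_le K0 PK L10 L20 r0 rN1 w1 supp1 supp2 ab) => c.
by apply: ereal_sup_ubound; exists c.
Qed.
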